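(* Let $d\ge2$ and let $\Omega\subseteq\left[-\frac12,\frac12\right)^d$ be a measurable set. Assume there exist constants $\kappa_2>0$, $0<\beta_2<1$, a neighborhood $U$ of the identity of $SO(d)$, and $v\in\Sigma_{d-1}$ such that for all sufficiently large $\rho$ and for every $\Theta\in\Sigma_{d-1}$, $$\int_U|\widehat{\chi_{\sigma\Omega}}(\rho\Theta)|^2\,d\sigma\;\le\;\begin{cases}\dfrac{\kappa_2}{\rho^{d+1}} & \text{if } |\Theta\cdot v|\le\beta_2,\\[2mm] \dfrac{\kappa_2}{\rho^{d+2}} & \text{if } \beta_2<|\Theta\cdot v|.\end{cases}$$ Then there exist a constant $c>0$ and a diverging sequence of integers $N_j$ such that for every $j$ there exist points $z_1,\dots,z_{N_j}\in\mathbb{T}^d$ for which $$\int_U\int_{\mathbb{T}^d}|D_{N_j}(x,\sigma)|^2\,dx\,d\sigma\;\le\; c\,N_j^{1-\frac{d+1}{d^2+d-1}}.$$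
   Context: $\Sigma_{d-1}$ is the unit sphere of $\mathbb{R}^d$ and $d\sigma$ is the normalized Haar measure on $SO(d)$. The torus $\mathbb{T}^d=\mathbb{R}^d/\mathbb{Z}^d$ is identified with the unit cube $[-\frac12,\frac12)^d$. For a bounded measurable set $F\subset\mathbb{R}^d$, $\widehat{\chi_F}(\xi)=\int_F e^{-2\pi i\xi\cdot x}\,dx$, and $|F|$ is its Lebesgue measure. For a finite sequence $z_1,\dots,z_N\in\mathbb{T}^d$ (repetitions allowed), $$D_N(x,\sigma)=\sum_{j=1}^N\chi_{-x+\sigma\Omega}(z_j)-N|\Omega|,\qquad (x,\sigma)\in\mathbb{T}^d\times SO(d),$$ where $\chi_{-x+\sigma\Omega}$ is viewed on $\mathbb{T}^d$ through periodization: $\chi_{-x+\sigma\Omega}(z)=\sum_{k\in\mathbb{Z}^d}\chi_{\sigma\Omega}(z+x+k)$. ''For all sufficiently large $\rho$ and every $\Theta$'' means the threshold on $\rho$ is independent of $\Theta$. *)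

(* Defs.v *)
From HB Require Import structures.
From mathcomp Require Import all_boot all_order all_algebra.
From mathcomp Require Import all_classical all_reals all_analysis.
From mathcomp Require Import complex.

Set Implicit Arguments.
Unset Strict Implicit.
Unset Printing Implicit Defensive.

Import Order.TTheory GRing.Theory Num.Theory.
Import numFieldNormedType.Exports.

Local Open Scope classical_set_scope.
Local Open Scope ring_scope.
Local Open Scope complex_scope.

Definition measure_matrix_display : measure_display -> measure_display.
Proof. exact. Qed.

Section measurable_matrix.
Context {d : measure_display} {T : measurableType d}.
Variables m n : nat.

(* For T = R this is the Borel sigma-algebra of R^(m x n). *)
Definition matrix_cylinders : set (set 'M[T]_(m, n)) :=
  \bigcup_(ij in [set: 'I_m * 'I_n])
    preimage_set_system setT (fun M : 'M[T]_(m, n) => M ij.1 ij.2) measurable.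

Let matrix_set0 : <<s matrix_cylinders >> set0.
Proof. exact: sigma_algebra0. Qed.

Let matrix_setC A : <<s matrix_cylinders >> A -> <<s matrix_cylinders >> (~` A).
Proof. exact: sigma_algebraC. Qed.

Let matrix_bigcup (F : (set 'M[T]_(m, n))^nat) :
  (forall i, <<s matrix_cylinders >> (F i)) ->
  <<s matrix_cylinders >> (\bigcup_i (F i)).
Proof. exact: sigma_algebra_bigcup. Qed.

HB.instance Definition _ := @isMeasurable.Build (measure_matrix_display d)
  'M[T]_(m, n) <<s matrix_cylinders >> matrix_set0 matrix_setC matrix_bigcup.

End measurable_matrix.

Section measurable_entries.
Context {R : realType}.

Lemma measurable_entry m n (i : 'I_m) (j : 'I_n) :
  measurable_fun setT (fun M : 'M[R]_(m, n) => M i j : measurableTypeR R).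
Proof.
by move=> _ Y mY; apply: sub_sigma_algebra; exists (i, j) => //; exists Y.
Qed.

Lemma measurable_fun_entries d (T : measurableType d) m n
    (f : T -> 'M[R]_(m, n)) :
  (forall i j, measurable_fun setT (fun t => f t i j : measurableTypeR R)) ->
  measurable_fun setT f.
Proof.
move=> mf; apply: (measurability (@matrix_cylinders _ R m n)) => //.
move=> _ [_ [[i j] _ [B mB <-]] <-]; rewrite /= setTI.
exact: mf.
Qed.

End measurable_entries.

Section euclidean_lebesgue_measure.
Local Open Scope ereal_scope.
Context {R : realType}.

Definition vcons n (p : measurableTypeR R * 'cV[R]_n) : 'cV[R]_n.+1 :=
  (\col_i oapp (fun j => p.2 j ord0) p.1 (unlift ord0 i))%R.

Definition vuncons n (x : 'cV[R]_n.+1) : measurableTypeR R * 'cV[R]_n :=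
  (x ord0 ord0, \col_j x (lift ord0 j) ord0)%R.

Lemma vconsK n : cancel (@vcons n) (@vuncons n).
Proof.
case=> a x; rewrite /vuncons /vcons mxE unlift_none; congr pair.
by apply/colP => j; rewrite !mxE liftK.
Qed.

Lemma measurable_vcons n : measurable_fun setT (@vcons n).
Proof.
apply: measurable_fun_entries => i j.
under eq_fun do rewrite mxE.
case: unliftP => [k _|_] /=; last exact: measurable_fst.
exact: (measurableT_comp (measurable_entry k ord0) measurable_snd).
Qed.

Lemma measurable_vuncons n : measurable_fun setT (@vuncons n).
Proof.
apply/measurable_fun_pairP; split; first exact: measurable_entry.
apply: measurable_fun_entries => i j.
under eq_fun do rewrite /= mxE.
exact: measurable_entry.
Qed.

HB.instance Definition _ n :=
  isMeasurableFun.Build _ _ _ _ (@vcons n) (@measurable_vcons n).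

Section step.
Variables (n : nat) (mu : {sigma_finite_measure set 'cV[R]_n -> \bar R}).

Definition lebesgue_step : set 'cV[R]_n.+1 -> \bar R :=
  pushforward (lebesgue_measure \x mu) (@vcons n).

Let step0 : lebesgue_step set0 = 0. Proof. exact: measure0. Qed.

Let step_ge0 A : 0 <= lebesgue_step A. Proof. exact: measure_ge0. Qed.

Let step_sigma_additive : semi_sigma_additive lebesgue_step.
Proof. exact: measure_semi_sigma_additive. Qed.

HB.instance Definition _ := isMeasure.Build _ _ _ lebesgue_step
  step0 step_ge0 step_sigma_additive.

Let step_sigma_finite : sigma_finite setT lebesgue_step.
Proof.
have /sigma_finiteP[F [FT ndF Foo]] := sigma_finiteT (@lebesgue_measure R).
have /sigma_finiteP[G [GT ndG Goo]] := sigma_finiteT mu.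
exists (fun k => @vuncons n @^-1` (F k `*` G k)).
  apply/seteqP; split=> // x _; set p := vuncons x.
  have [i _ Fi] : (\bigcup_k F k) p.1 by rewrite -FT.
  have [j _ Gj] : (\bigcup_k G k) p.2 by rewrite -GT.
  exists (maxn i j) => //; split.
    by move: (p.1) Fi; exact/subsetPset/ndF/leq_maxl.
  by move: (p.2) Gj; exact/subsetPset/ndG/leq_maxr.
move=> k; have [mF Fk] := Foo k; have [mG Gk] := Goo k; split.
  rewrite -[X in measurable X]setTI; apply: measurable_vuncons => //.
  exact: measurableX.
rewrite /lebesgue_step /pushforward -comp_preimage.
rewrite (_ : _ \o _ = id); last by apply/funext => p; exact: vconsK.
by rewrite preimage_id product_measure1E// lte_mul_pinfty// ge0_fin_numE.
Qed.

HB.instance Definition _ := Measure_isSigmaFinite.Build _ _ _ lebesgue_step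
  step_sigma_finite.

End step.

Fixpoint borel_lebesgue n : {sigma_finite_measure set 'cV[R]_n -> \bar R} :=
  if n is m.+1 then lebesgue_step (borel_lebesgue m)
  else \d_(0%R : 'cV[R]_0).

(* [borel_lebesgue n] is the product measure on Borel sets; [leb n] completes
   it, so that it measures every Lebesgue measurable set. *)
Definition leb n := @completed_measure_extension _ _ _ (borel_lebesgue n).

HB.instance Definition _ n := Measure.on (@leb n).

End euclidean_lebesgue_measure.
Arguments leb {R n}.

Definition lebesgue_measurable (R : realType) n (A : set 'cV[R]_n) : Prop :=
  (borel_lebesgue n)^*%mu.-cara.-measurable A.

Section rotations.
Context {R : realType} {d : nat}.

Definition SO : set 'M[R]_d := [set s | s^T *m s = 1%:M /\ \det s = 1].

(* The normalized Haar measure of SO(d), regarded as a Borel probability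
   measure on 'M[R]_d carried by SO(d); it is unique. *)
Definition is_haar (mu : probability 'M[R]_d R) : Prop :=
  mu SO = 1%E /\
  forall g, SO g -> forall A, measurable A -> A `<=` SO ->
    mu [set g *m s | s in A] = mu A.

Definition rotate (s : 'M[R]_d) (A : set 'cV[R]_d) : set 'cV[R]_d :=
  [set s *m x | x in A].

End rotations.
Arguments SO : clear implicits.

Section euclidean.
Context {R : realType} {d : nat}.
Implicit Types (x y xi : 'cV[R]_d) (F Omega : set 'cV[R]_d).

Definition dotv x y : R := \sum_i x i ord0 * y i ord0.

Definition unit_sphere : set 'cV[R]_d := [set x | dotv x x = 1].

Definition unit_cube : set 'cV[R]_d :=
  [set x | forall i, - (1 / 2) <= x i ord0 < 1 / 2].

(* int_F exp (-2 pi i xi . x) dx *)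
Definition fourier_indic F xi : R[i] :=
  (\int[leb]_(x in F) cos (2 * pi * dotv xi x)) +i*
  (- \int[leb]_(x in F) sin (2 * pi * dotv xi x)).

(* Points of the torus are represented in [unit_cube]; for bounded F only
   finitely many k contribute. *)
Definition periodized_indic F x : R :=
  \sum_(k \in [set: 'cV[int]_d]) (\1_F (x + map_mx intr k) : R).

Definition discrepancy Omega N (z : 'I_N -> 'cV[R]_d) x (s : 'M[R]_d) : R :=
  \sum_(j < N) periodized_indic (rotate s Omega) (z j + x) -
  N%:R * fine (leb Omega).

End euclidean.
Arguments unit_sphere : clear implicits.
Arguments unit_cube : clear implicits.

(* Main.v *)
From HB Require Import structures.
Require Import Defs.
From mathcomp Require Import all_boot all_order all_algebra.
From mathcomp Require Import all_classical all_reals all_analysis.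
From mathcomp Require Import measurable_realfun complex ring lra zify.

(* The points form a finite subgroup of the torus (a sheared grid), so that the
   discrepancy only sees the frequencies of its dual lattice, a sublattice of
   Z^d.  That lattice is generated by an integer vector of length about
   L = t^d, whose direction is so close to v that it lies in the cone where the
   decay is rho^-(d+2), and by vectors of length about M = t^(d+1) in the
   remaining directions.  Multiples of the first generator contribute
   L^-(d+2), all the other frequencies contribute sum |k|^-(d+1), which is of
   order 1/(L M^d); the exponents are chosen to make both equal to
   t^-(d^2+2d), while N is of order t^(d^2+d-1).
   The passage from the discrepancy to Fourier coefficients only uses the
   inequality "L^2 norm <= sum of squared coefficients", that is, density of
   trigonometric polynomials in L^2 of the torus: the sets whose indicator
   function is approximable form a sigma-algebra, because (1 - T^(2n))^(n 4^n)
   tends to the indicator function of {T < 1/2} whenever 0 <= T <= 1.  Rotation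
   invariance of Lebesgue measure comes from translation invariance, by
   comparing with the unit ball. *)

Set Implicit Arguments.
Unset Strict Implicit.
Unset Printing Implicit Defensive.

Import Order.TTheory GRing.Theory Num.Theory.
Import numFieldNormedType.Exports.

Local Open Scope classical_set_scope.
Local Open Scope ring_scope.

(** * Translation and rotation invariance of Lebesgue measure *)

(** The direction of the first generator is fixed once and for all: the cone [beta2 < |Theta . v|]
    is open, so it contains a nonzero integer vector [w], and the generator is [L w]. With a pivot
    entry [q > 0] of [w] and the vectors [M e_i] at the other indices, the lattice has index
    [N = q L M^(d-1)] in Z^d. As [w] does not depend on [t], the constants comparing a frequency
    with its lattice coordinates are uniform in [t]. Equating [L^(d+2)] with [L M^d] gives
    [M^d = L^(d+1)], whence [L = t^d] and [M = t^(d+1)]. Nonzero frequencies have length at least a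
    constant times [L], so large [t] puts them all in the range of the decay hypothesis. Two
    obstacles shape the rest. [Omega] is only Lebesgue measurable, whereas measurability in the
    rotation comes from functions that are Borel on the product of matrices and vectors; hence
    [Omega] is replaced by a Borel set equal to it off a null set. Moreover the truncation in the
    Parseval inequality depends on the rotation, while the decay is known only after integration
    over [U]; bounds uniform in the truncation and monotone convergence bridge this. *)

Section lebesgue_translation.
Context {R : realType}.

Let addr_itvoc (a b c : R) :
  (fun x : R => x + a) @^-1` `]b, c]%classic = `]b - a, c - a]%classic.
Proof.
apply/seteqP; split => x /=; rewrite !in_itv /=.
  by rewrite lerBrDr ltrBlDr.
by rewrite lerBrDr ltrBlDr.
Qed.

Lemma measurable_addr (a : R) :
  measurable_fun setT (fun x : measurableTypeR R => x + a : measurableTypeR R).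
Proof. exact: measurable_funD. Qed.

Lemma lebesgue_measure_translate (a : R) (A : set (measurableTypeR R)) :
  measurable A -> lebesgue_measure ((fun x : R => x + a) @^-1` A) =
  lebesgue_measure A.
Proof.
move=> mA; pose f := (fun x : measurableTypeR R => x + a : measurableTypeR R).
pose fm : {mfun _ >-> _} :=
  HB.pack f (isMeasurableFun.Build _ _ _ _ f (measurable_addr a)).
pose m := pushforward (@lebesgue_measure R) fm.
apply/esym.
apply: (@lebesgue_measure_unique R m) => //= _ [[b c]] _ <- /=.
rewrite /m /pushforward /= addr_itvoc !lebesgue_measure_itv/=.
rewrite !lte_fin ltrD2r; case: ifP => // _.
by rewrite -!EFinB; congr (_%:E); ring.
Qed.

Local Notation lam := (@borel_lebesgue R _).

Lemma measurable_addv n (a : 'cV[R]_n) :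
  measurable_fun setT (fun x : 'cV[R]_n => x + a).
Proof.
apply: measurable_fun_entries => i j.
under eq_fun do rewrite mxE.
apply: measurable_funD => //; exact: measurable_entry.
Qed.

(** Induction on [n]: under [vcons] a translation acts on each factor separately, so the
    pushed-forward product measure agrees with the original one on rectangles, and these determine
    it. *)
Lemma borel_lebesgue_translate n (a : 'cV[R]_n) (A : set 'cV[R]_n) :
  measurable A -> lam ((fun x => x + a) @^-1` A) = lam A.
Proof.
elim: n a A => [a A mA|n IH a A mA].
  by congr (lam _); apply/seteqP; split => x /=; rewrite (flatmx0 (x + a)) (flatmx0 x).
rewrite /= /lebesgue_step /pushforward.
pose a' : 'cV[R]_n := (vuncons a).2.
pose f (p : measurableTypeR R * 'cV[R]_n) : measurableTypeR R * 'cV[R]_n :=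
  (p.1 + a ord0 ord0, p.2 + a').
have mf : measurable_fun setT f.
  apply/measurable_fun_pairP; split.
    exact: (measurableT_comp (measurable_addr _) measurable_fst).
  exact: (measurableT_comp (measurable_addv _) measurable_snd).
pose fm : {mfun _ >-> _} := HB.pack f (isMeasurableFun.Build _ _ _ _ f mf).
pose m := pushforward (lebesgue_measure \x borel_lebesgue n)%E fm.
have -> : @vcons R n @^-1` ((fun x => x + a) @^-1` A) =
          f @^-1` (@vcons R n @^-1` A).
  apply/seteqP; split => p /=; congr (A _); apply/colP => i; rewrite !mxE /f /=;
    case: unliftP => [k ->|->] /=; rewrite ?mxE//.
apply/esym; apply: (@product_measure_unique _ _ _ _ _ _ _ m); last first.
  by rewrite -[X in measurable X]setTI; apply: measurable_vcons.
move=> B C mB mC; rewrite /m /pushforward.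
pose B' := (fun x : R => x + a ord0 ord0) @^-1` B.
pose C' := (fun x => x + a') @^-1` C.
transitivity ((lebesgue_measure \x borel_lebesgue n)%E (B' `*` C')); first by [].
have mB' : measurable B'.
  by rewrite -[X in measurable X]setTI; apply: (measurable_addr (a ord0 ord0)).
have mC' : measurable C'.
  by rewrite -[X in measurable X]setTI; apply: measurable_addv.
rewrite product_measure1E//; congr (_ * _)%E; last exact: IH.
exact: lebesgue_measure_translate.
Qed.

Lemma measurable_cube n (a b : R) :
  measurable [set x : 'cV[R]_n | forall i, a <= x i ord0 < b].
Proof.
have -> : [set x : 'cV[R]_n | forall i, a <= x i ord0 < b] =
  \bigcap_(i in [set: 'I_n]) ((fun x : 'cV[R]_n => x i ord0 : measurableTypeR R) @^-1` `[a, b[%classic).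
  apply/seteqP; split => x /= H i => [_|]; first by rewrite /= in_itv /=; apply: H.
  by have := H i I; rewrite /= in_itv.
apply: fin_bigcap_measurable => // i _.
by rewrite -[X in measurable X]setTI; apply: measurable_entry.
Qed.

Lemma borel_lebesgue_cube n (a b : R) : a <= b ->
  lam [set x : 'cV[R]_n | forall i, a <= x i ord0 < b] = ((b - a) ^+ n)%:E.
Proof.
move=> ab; elim: n => [|n IH].
  rewrite expr0 /= diracE mem_set//.
  by case.
rewrite /= /lebesgue_step /pushforward.
have -> : @vcons R n @^-1` [set x : 'cV[R]_n.+1 | forall i, a <= x i ord0 < b] =
   `[a, b[%classic `*` [set x : 'cV[R]_n | forall i, a <= x i ord0 < b].
  apply/seteqP; split => [p /= H|p /= [H1 H2] i]; last first.
    by rewrite mxE; case: unliftP => [k _|_] /=; [apply: H2|rewrite in_itv /= in H1].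
  split; first by have := H ord0; rewrite mxE unlift_none in_itv.
  by move=> i; have := H (lift ord0 i); rewrite mxE liftK.
rewrite product_measure1E ?IH//.
  rewrite exprS EFinM; congr (_ * _)%E.
  have := @lebesgue_measure_itv R `[a, b[ => /= ->; rewrite lte_fin.
  by case: ltgtP ab => // -> _; rewrite subrr.
exact: measurable_cube.
Qed.

Lemma ge0_integral_translate n (a : 'cV[R]_n) (f : 'cV[R]_n -> \bar R) :
  measurable_fun setT f -> (forall x, (0 <= f x)%E) ->
  (\int[lam]_x f (x + a)%R = \int[lam]_x f x)%E.
Proof.
move=> mf f0.
have := @ge0_integral_pushforward _ _ _ _ R _ (measurable_addv a) lam setT f
  measurableT mf (fun y _ => f0 y).
rewrite preimage_setT => <-.
apply: eq_measure_integral => [A mA|mA' A mA _].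
  exact: (measurable_addv a).
exact: borel_lebesgue_translate.
Qed.

End lebesgue_translation.

Section rotation_invariance.
Context {R : realType}.
Local Notation lam := (@borel_lebesgue R _).

Lemma measurable_preimage d d' (T : measurableType d) (T' : measurableType d')
    (f : T -> T') (A : set T') :
  measurable_fun setT f -> measurable A -> measurable (f @^-1` A).
Proof. by move=> mf mA; rewrite -[X in measurable X]setTI; exact: mf. Qed.

Lemma measurable_mulmxv n :
  measurable_fun setT (fun p : 'M[R]_n * 'cV[R]_n => p.1 *m p.2).
Proof.
apply: measurable_fun_entries => i j.
under eq_fun do rewrite mxE.
apply: measurable_sum => k; apply: measurable_funM.
- exact: (measurableT_comp (measurable_entry i k) measurable_fst).
- exact: (measurableT_comp (measurable_entry k j) measurable_snd).
Qed.

Lemma measurable_mulmx_const n (s : 'M[R]_n) :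
  measurable_fun setT (fun x : 'cV[R]_n => s *m x).
Proof.
exact: (measurableT_comp (@measurable_mulmxv n) (measurable_pair1 s)).
Qed.

Lemma measurable_oppv n : measurable_fun setT (fun x : 'cV[R]_n => - x).
Proof.
apply: measurable_fun_entries => i j.
under eq_fun do rewrite mxE.
exact: (measurableT_comp _ (measurable_entry i j)).
Qed.

Lemma measurable_addv2 d (T : measurableType d) n (f g : T -> 'cV[R]_n) :
  measurable_fun setT f -> measurable_fun setT g ->
  measurable_fun setT (fun t => f t + g t).
Proof.
move=> mf mg; apply: measurable_fun_entries => i j.
under eq_fun do rewrite mxE.
by apply: measurable_funD; exact: (measurableT_comp (measurable_entry i j)).
Qed.

Lemma dotvE n (x y : 'cV[R]_n) : dotv x y = (x^T *m y) ord0 ord0.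
Proof. by rewrite mxE; apply: eq_bigr => i _; rewrite mxE. Qed.

Lemma dotv_orth n (s : 'M[R]_n) (x y : 'cV[R]_n) : s^T *m s = 1%:M ->
  dotv (s *m x) (s *m y) = dotv x y.
Proof. by move=> ss; rewrite !dotvE trmx_mul mulmxA -(mulmxA x^T) ss mulmx1. Qed.

Lemma dotvNN n (x : 'cV[R]_n) : dotv (- x) (- x) = dotv x x.
Proof. by apply: eq_bigr => i _; rewrite mxE mulrNN. Qed.

Lemma measurable_dotv d (T : measurableType d) n (f g : T -> 'cV[R]_n) :
  measurable_fun setT f -> measurable_fun setT g ->
  measurable_fun setT (fun t => dotv (f t) (g t)).
Proof.
move=> mf mg; apply: measurable_sum => i.
by apply: measurable_funM; exact: (measurableT_comp (measurable_entry i ord0)).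
Qed.

Definition unit_ball n : set 'cV[R]_n := [set x | dotv x x <= 1].

Lemma measurable_unit_ball n : measurable (@unit_ball n).
Proof.
have := @measurable_dotv _ _ n id id (@measurable_id _ _ _) (@measurable_id _ _ _).
move=> /(_ measurableT `]-oo, 1]%classic (measurable_itv _)).
by rewrite setTI.
Qed.

Lemma unit_ball_gt0 n : (0 < lam (@unit_ball n))%E.
Proof.
(* Entries in [[0, a[] with [a <= 1] make [dotv x x] at most [n a <= 1]; [n.+1] keeps [a] positive
   when [n = 0]. *)
pose a : R := n.+1%:R^-1.
have a0 : 0 < a by rewrite invr_gt0.
have sub : [set x : 'cV[R]_n | forall i, 0 <= x i ord0 < a] `<=` @unit_ball n.
  move=> x /= H; rewrite /unit_ball /= /dotv.
  apply: (@le_trans _ _ (\sum_(i < n) a)).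
    apply: ler_sum => i _; have /andP[x0 xa] := H i.
    rewrite (le_trans (ler_wpM2l x0 (ltW xa)))//.
    rewrite ler_piMl// ?(ltW a0)// (le_trans (ltW xa))//.
    by rewrite invf_le1// ler1n.
  rewrite sumr_const card_ord -mulr_natl /a.
  by rewrite ler_pdivrMr// mul1r ler_nat.
apply: (@lt_le_trans _ _ (((a - 0) ^+ n)%:E)).
  by rewrite lte_fin subr0 exprn_gt0.
rewrite -borel_lebesgue_cube ?(ltW a0)//.
apply: le_measure => //; rewrite inE; first exact: measurable_cube.
exact: measurable_unit_ball.
Qed.

Lemma unit_ball_lty n : (lam (@unit_ball n) < +oo)%E.
Proof.
(* The cube is half open and an entry can equal 1, hence the upper end 2. *)
have sub : @unit_ball n `<=` [set x : 'cV[R]_n | forall i, - 1 <= x i ord0 < 2].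
  move=> x /= H i.
  have : x i ord0 * x i ord0 <= 1.
    apply: le_trans H; rewrite /dotv (bigD1 i)//= lerDl.
    by apply: sumr_ge0 => j _; rewrite -expr2 sqr_ge0.
  by move=> h; apply/andP; split; nra.
apply: (@le_lt_trans _ _ (((2 - -1) ^+ n)%:E)); last exact: ltry.
rewrite -borel_lebesgue_cube; last lra.
apply: le_measure => //; rewrite inE; first exact: measurable_unit_ball.
exact: measurable_cube.
Qed.

Lemma measurable_EFin_indic d (T : measurableType d) (A : set T) :
  measurable A -> measurable_fun setT (fun x => (\1_A x : R)%:E).
Proof. by move=> mA; apply/measurable_EFinP; exact: measurable_indic. Qed.

(* Both sides are the double integral of [1_A (s x + y) 1_B (y)] with [B] the
   unit ball: substitute [x + s^T y] for [x], resp. [y - s x] for [y], and use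
   that [B] is symmetric and [s]-invariant. *)
Lemma borel_lebesgue_orth_ball n (s : 'M[R]_n) (A : set 'cV[R]_n) :
  s^T *m s = 1%:M -> measurable A ->
  (lam ((fun x => s *m x) @^-1` A) * lam (@unit_ball n) =
   lam A * lam (@unit_ball n))%E.
Proof.
move=> ss mA; have ss' : s *m s^T = 1%:M by exact: mulmx1C.
pose B := @unit_ball n; have mB : measurable B by exact: measurable_unit_ball.
pose h (p : 'cV[R]_n * 'cV[R]_n) : \bar R :=
  ((\1_A (s *m p.1 + p.2)) * (\1_B p.2))%:E.
have ms : measurable_fun setT (fun x : 'cV[R]_n => s *m x).
  exact: measurable_mulmx_const.
have msT : measurable_fun setT (fun x : 'cV[R]_n => s^T *m x).
  exact: measurable_mulmx_const.
have mind (C : set 'cV[R]_n) d (T : measurableType d) (f : T -> 'cV[R]_n) :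
    measurable C -> measurable_fun setT f ->
    measurable_fun setT (fun x => \1_C (f x) : R).
  move=> mC mf; apply: (measurableT_comp _ mf).
  exact: measurable_indic.
have mh : measurable_fun setT h.
  apply/measurable_EFinP; apply: measurable_funM; apply: mind => //.
  apply: measurable_addv2 => //.
  exact: (measurableT_comp ms measurable_fst).
have ind0 (C : set 'cV[R]_n) x : 0 <= \1_C x :> R by rewrite indicE.
have h0 p : (0 <= h p)%E by rewrite lee_fin mulr_ge0.
have L : (\int[lam]_y \int[lam]_x h (x, y) =
          lam ((fun x => s *m x) @^-1` A) * lam B)%E.
  have mA' : measurable ((fun x => s *m x) @^-1` A) by exact: measurable_preimage.
  transitivity (\int[lam]_y (lam ((fun x => s *m x) @^-1` A) * (\1_B y)%:E))%E.
    apply: eq_integral => y _.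
    pose k (x : 'cV[R]_n) : \bar R := ((\1_B y)%:E * (\1_A (s *m x))%:E)%E.
    transitivity (\int[lam]_x k (x + s^T *m y)%R)%E.
      apply: eq_integral => x _.
      by rewrite /k /h mulmxDr mulmxA ss' mul1mx -EFinM mulrC.
    rewrite ge0_integral_translate.
    + rewrite ge0_integralZl//.
      * rewrite muleC; congr (_ * _)%E.
        transitivity (\int[lam]_x (\1_((fun x => s *m x) @^-1` A) x : R)%:E)%E.
          by apply: eq_integral => x _; rewrite !indicE.
        by rewrite integral_indic// setIT.
      * by apply/measurable_EFinP; exact: mind.
    + apply: emeasurable_funM; first exact: measurable_cst.
      by apply/measurable_EFinP; exact: mind.
    + by move=> x; rewrite mule_ge0// lee_fin.
  rewrite ge0_integralZl//.
  - by rewrite integral_indic// setIT.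
  - exact: measurable_EFin_indic.
pose h' (p : 'cV[R]_n * 'cV[R]_n) : \bar R :=
  ((\1_A p.2) * (\1_B (p.2 - s *m p.1)))%:E.
have mh' : measurable_fun setT h'.
  apply/measurable_EFinP; apply: measurable_funM; apply: mind => //.
  apply: measurable_addv2 => //.
  apply: (measurableT_comp (@measurable_oppv n)).
  exact: (measurableT_comp ms measurable_fst).
have h'0 p : (0 <= h' p)%E by rewrite lee_fin mulr_ge0.
have Rr : (\int[lam]_y \int[lam]_x h' (x, y) = lam A * lam B)%E.
  transitivity (\int[lam]_y ((\1_A y)%:E * lam B))%E.
    apply: eq_integral => y _.
    pose k (x : 'cV[R]_n) : \bar R := ((\1_A y)%:E * (\1_B x)%:E)%E.
    transitivity (\int[lam]_x k (x + (- (s^T *m y)))%R)%E.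
      apply: eq_integral => x _; rewrite /k /h' -EFinM /=.
      congr (_ * _)%:E; rewrite !indicE.
      congr ((_ : bool)%:R); apply/idP/idP; rewrite !inE /B /unit_ball /=;
        rewrite -(dotvNN (y - _)) opprB;
        rewrite -(dotv_orth (x - _) (x - _) ss) mulmxBr mulmxA ss' mul1mx//.
    rewrite ge0_integral_translate.
    + rewrite ge0_integralZl//.
      * by rewrite integral_indic// setIT.
      * exact: measurable_EFin_indic.
    + apply: emeasurable_funM; first exact: measurable_cst.
      exact: measurable_EFin_indic.
    + by move=> x; rewrite mule_ge0// lee_fin.
  rewrite ge0_integralZr//.
  - by rewrite integral_indic// setIT.
  - exact: measurable_EFin_indic.
have FL := @fubini_tonelli _ _ _ _ R lam lam h mh h0.
have FR := @fubini_tonelli _ _ _ _ R lam lam h' mh' h'0.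
apply: etrans (esym L) _; apply: etrans (esym FL) _; apply: etrans Rr.
apply: etrans FR; apply: eq_integral => x _.
transitivity (\int[lam]_y h' (x, (y + s *m x)%R))%E.
  by apply: eq_integral => y _; rewrite /h' /h /= addrK addrC.
apply: (@ge0_integral_translate _ _ (s *m x) (fun y => h' (x, y))) => //.
exact: (measurableT_comp mh' (measurable_pair1 x)).
Qed.

(** The unit ball has positive finite measure, so its factor cancels in
    [borel_lebesgue_orth_ball]. *)
Lemma borel_lebesgue_orth n (s : 'M[R]_n) (A : set 'cV[R]_n) :
  s^T *m s = 1%:M -> measurable A ->
  lam ((fun x => s *m x) @^-1` A) = lam A.
Proof.
move=> ss mA; have := borel_lebesgue_orth_ball ss mA.
have b0 := unit_ball_gt0 n; have boo := unit_ball_lty n.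
have bfin : lam (@unit_ball n) \is a fin_num by rewrite ge0_fin_numE.
move/(congr1 (fun e => e * ((fine (lam (@unit_ball n)))^-1)%:E))%E.
rewrite -!muleA -{1 3}(fineK bfin) -EFinM divff ?mule1//.
by rewrite gt_eqF// fine_gt0// b0.
Qed.

End rotation_invariance.

(** * Completed Lebesgue measure *)

Section completed_lebesgue.
Context {R : realType}.
Local Notation lam := (@borel_lebesgue R _).
Local Open Scope ereal_scope.

(** Preimages under a linear map are measurable at once, unlike images; measurability and measure of
    [rotate s A] are obtained through this form. *)
Lemma rotateE n (s : 'M[R]_n) (A : set 'cV[R]_n) : (s^T *m s)%R = 1%:M%R ->
  rotate s A = (fun x => s^T *m x)%R @^-1` A.
Proof.
move=> ss; have ss' : (s *m s^T)%R = 1%:M%R by exact: mulmx1C.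
apply/seteqP; split => [_ [x Ax <-] /=|x /= Ax].
  by rewrite mulmxA ss mul1mx.
by exists (s^T *m x)%R => //; rewrite mulmxA ss' mul1mx.
Qed.

Lemma measurable_rotate n (s : 'M[R]_n) (A : set 'cV[R]_n) :
  (s^T *m s)%R = 1%:M%R -> measurable A -> measurable (rotate s A).
Proof.
move=> ss mA; rewrite rotateE//; apply: measurable_preimage => //.
exact: measurable_mulmx_const.
Qed.

Lemma borel_lebesgue_rotate n (s : 'M[R]_n) (A : set 'cV[R]_n) :
  (s^T *m s)%R = 1%:M%R -> measurable A -> lam (rotate s A) = lam A.
Proof.
move=> ss mA; rewrite rotateE// borel_lebesgue_orth// trmxK.
exact: mulmx1C.
Qed.

Lemma ge0_integral_rotate n (s : 'M[R]_n) (A : set 'cV[R]_n)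
    (f : 'cV[R]_n -> \bar R) : (s^T *m s)%R = 1%:M%R -> measurable A ->
  measurable_fun setT f -> (forall x, 0 <= f x) ->
  \int[lam]_(x in rotate s A) f x = \int[lam]_(x in A) f (s *m x)%R.
Proof.
move=> ss mA mf f0; have mrA := measurable_rotate ss mA.
have ms := @measurable_mulmx_const R n s.
have E : (fun x => s *m x)%R @^-1` rotate s A = A.
  rewrite rotateE//; apply/seteqP; split => x /=; by rewrite mulmxA ss mul1mx.
have := @ge0_integral_pushforward _ _ _ _ R _ ms lam (rotate s A) f
  mrA (measurable_funTS mf) (fun y _ => f0 y).
rewrite E => <-; apply: eq_measure_integral => B mB _.
apply/esym; exact: borel_lebesgue_orth.
Qed.

Lemma integral_rotate n (s : 'M[R]_n) (A : set 'cV[R]_n)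
    (f : 'cV[R]_n -> \bar R) : (s^T *m s)%R = 1%:M%R -> measurable A ->
  measurable_fun setT f ->
  \int[lam]_(x in rotate s A) f x = \int[lam]_(x in A) f (s *m x)%R.
Proof.
move=> ss mA mf; rewrite integralE [RHS]integralE.
rewrite !ge0_integral_rotate//; [by congr (_ - _); apply: eq_integral => x _; rewrite ?funeposE ?funenegE|exact: measurable_funeneg|exact: measurable_funepos].
Qed.

Lemma leb_borel n (A : set 'cV[R]_n) : measurable A -> leb A = lam A.
Proof. by move=> mA; rewrite /leb /completed_measure_extension measurable_mu_extE. Qed.

Lemma borel_lebesgue_measurable n (A : set 'cV[R]_n) :
  measurable A -> lebesgue_measurable A.
Proof. by move=> mA; exact: caratheodory_measurable_mu_ext. Qed.

Local Notation cara n := (caratheodory_type (mu_ext (borel_lebesgue n))).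

Lemma measurable_fun_cara d (T : measurableType d) n (f : 'cV[R]_n -> T)
    (D : set 'cV[R]_n) :
  measurable_fun setT f -> lebesgue_measurable D ->
  measurable_fun (D : set (cara n)) (f : cara n -> T).
Proof.
move=> mf mD _ Y mY; apply: measurableI => //.
by apply: borel_lebesgue_measurable; exact: measurable_preimage.
Qed.

(** The identity map from the completed sigma-algebra to the Borel one is measurable and pushes
    [leb] forward to the Borel measure. *)
Lemma ge0_integral_leb n (D : set 'cV[R]_n) (f : 'cV[R]_n -> \bar R) :
  measurable D -> measurable_fun setT f -> (forall x, 0 <= f x) ->
  \int[leb]_(x in D) f x = \int[lam]_(x in D) f x.
Proof.
move=> mD mf f0.
have mid : measurable_fun [set: cara n] (id : cara n -> 'cV[R]_n).
  exact: measurable_fun_cara (@measurable_id _ _ _) (borel_lebesgue_measurable measurableT).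
have := @ge0_integral_pushforward _ _ _ _ R _ mid leb D f
  mD (measurable_funTS mf) (fun y _ => f0 y).
move=> <-; apply: eq_measure_integral => B mB _.
exact: leb_borel.
Qed.

(** The integral of a nonnegative function is a supremum over the simple functions below it, so
    monotonicity holds without measurability. This serves for the discrepancy, whose measurability
    is not established. *)
Lemma ge0_le_integral_subfun d (T : measurableType d)
    (mu : {measure set T -> \bar R}) (D : set T) (f g : T -> \bar R) :
  (forall x, D x -> 0 <= f x) -> (forall x, D x -> f x <= g x) ->
  \int[mu]_(x in D) f x <= \int[mu]_(x in D) g x.
Proof.
move=> f0 fg; rewrite !ge0_integralE//; last first.
  by move=> x Dx; exact: le_trans (f0 x Dx) (fg x Dx).
apply: le_ereal_sup => _ [h /= hf <-]; exists h => // x.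
by apply: le_trans (hf x) _; apply: lee_restrict.
Qed.

Lemma integral_leb_le n (D W : set 'cV[R]_n) (f g : 'cV[R]_n -> R) :
  measurable D -> measurable W -> lam W = 0 -> measurable_fun setT f ->
  (forall x, 0 <= f x)%R -> (forall x, 0 <= g x)%R ->
  (forall x, D x -> ~ W x -> g x <= f x)%R ->
  \int[leb]_(x in D) (g x)%:E <= \int[lam]_(x in D) (f x)%:E.
Proof.
move=> mD mW W0 mf f0 g0 gf.
(* Setting the majorant to [+oo] on [W] makes it dominate [g] on all of [D]; as [W] is null, its
   integral is still that of [f]. *)
pose G x := (f x)%:E + +oo * (\1_W x : R)%:E.
have ind0 x : 0 <= (\1_W x : R)%:E by rewrite lee_fin indicE.
have mG : measurable_fun setT G.
  apply: emeasurable_funD; first exact/measurable_EFinP.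
  apply: emeasurable_funM; first exact: measurable_cst.
  exact: measurable_EFin_indic.
have G0 x : 0 <= G x by rewrite adde_ge0// ?lee_fin// mule_ge0.
apply: (@le_trans _ _ (\int[leb]_(x in D) G x)).
  apply: ge0_le_integral_subfun => x Dx; first by rewrite lee_fin.
  rewrite /G indicE; have [Wx|nW] := boolP (x \in W).
    by rewrite mule1 addey ?leey// -ltNye ltNyr.
  rewrite mule0 adde0 lee_fin gf// => Wx.
  by move/negP: nW; apply; exact/mem_set.
rewrite ge0_integral_leb// (ge0_negligible_integral mW)//; last exact: measurable_funTS.
rewrite [leRHS](ge0_negligible_integral mW)//; last 2 first.
- by apply/measurable_EFinP; exact: measurable_funTS.
- by move=> x _; rewrite lee_fin.
rewrite le_eqVlt; apply/orP; left; apply/eqP; apply: eq_integral => x.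
by move=> /set_mem[_ nW]; rewrite /G indicE memNset// mule0 adde0.
Qed.

(** The outer measure is an infimum over countable Borel covers; intersecting covers of excess
    [1/(k+1)] attains it. *)
Lemma outer_cover n (A : set 'cV[R]_n) : mu_ext lam A < +oo ->
  exists B : set 'cV[R]_n, [/\ measurable B, A `<=` B & lam B = mu_ext lam A].
Proof.
move=> Aoo.
have fA : mu_ext lam A \is a fin_num by rewrite ge0_fin_numE// mu_ext_ge0.
have H k : exists B : set 'cV[R]_n, [/\ measurable B, A `<=` B &
    lam B <= mu_ext lam A + (k.+1%:R^-1)%:E].
  have k0 : (0 < k.+1%:R^-1 :> R)%R by rewrite invr_gt0.
  have [_ /= [F [mF AF] <-] /ltW le] := lb_ereal_inf_adherent k0 fA.
  exists (\bigcup_i F i); split => //.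
    exact: bigcupT_measurable.
  apply: le_trans le; apply: measure_sigma_subadditive => //.
  exact: bigcupT_measurable.
have [B HB] := choice H.
exists (\bigcap_k B k); have mcap : measurable (\bigcap_k B k).
  by apply: bigcapT_measurable => k; have [] := HB k.
have sub : A `<=` \bigcap_k B k.
  by move=> x Ax k _; have [_ + _] := HB k; exact.
split => //; apply/eqP; rewrite eq_le; apply/andP; split; last first.
  by rewrite -(measurable_mu_extE lam mcap); exact: le_mu_ext.
apply/lee_addgt0Pr => e e0.
have [k _ ke] : exists2 k : nat, True & (k.+1%:R^-1 < e)%R.
  have [k] := ltr_add_invr (e0 : (0 < e)%R).
  by rewrite add0r => ?; exists k.
have [mBk _ le] := HB k.
apply: (@le_trans _ _ (lam (B k))).
  by apply: le_measure; rewrite ?inE//; exact: bigcap_inf.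
by apply: le_trans le _; rewrite leeD2l// lee_fin ltW.
Qed.

(** [B] is a Borel hull of [A] of the same finite measure, so [B] minus [A] is null by additivity of
    the completed measure; [Z] is a Borel hull of that difference. *)
Lemma lebesgue_measurable_borel n (A : set 'cV[R]_n) :
  lebesgue_measurable A -> leb A < +oo ->
  exists B Z : set 'cV[R]_n, [/\ measurable B, measurable Z, lam Z = 0 &
    forall x, ~ Z x -> (A x <-> B x)].
Proof.
move=> mA Aoo; have [B [mB AB eB]] := outer_cover Aoo.
have mB' := borel_lebesgue_measurable mB.
have D0 : leb (B `\` A) = 0.
  have eB' : leb B = leb A by rewrite leb_borel.
  have Boo : leb B < +oo by rewrite eB'.
  have -> : leb (B `\` A) = leb B - leb (B `&` A) by exact: measureD.
  by rewrite setIidr// eB' subee// ge0_fin_numE//.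
have [|Z [mZ DZ eZ]] := @outer_cover n (B `\` A).
  by rewrite [X in X < _]D0.
exists B, Z; split => //; first by rewrite eZ.
move=> x nZ; split; first exact: AB.
by move=> Bx; apply: contrapT => nA; apply: nZ; apply: DZ.
Qed.

Section borel_version.
Variables (n : nat) (A B Z : set 'cV[R]_n).
Hypotheses (mB : measurable B) (mZ : measurable Z) (Z0 : lam Z = 0)
  (AB : forall x, ~ Z x -> (A x <-> B x)).

Lemma lebesgue_measurable_version : lebesgue_measurable A.
Proof.
have -> : A = (B `\` Z) `|` (A `&` Z).
  apply/seteqP; split => x.
    move=> Ax; have [Zx|nZ] := pselect (Z x); [by right|left].
    by split => //; apply/(AB nZ).
  by case=> [[Bx nZ]|[]//]; apply/(AB nZ).
apply: (@measurableU _ (cara n)).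
  by apply: borel_lebesgue_measurable; exact: measurableD.
apply: (@measure_is_complete_caratheodory R _ (mu_ext lam)).
exists Z; split; [exact: borel_lebesgue_measurable|by rewrite -[LHS]/(leb Z) leb_borel|].
exact: subIsetr.
Qed.

Lemma ge0_integral_version (f : 'cV[R]_n -> \bar R) :
  measurable_fun setT f -> (forall x, 0 <= f x) ->
  \int[leb]_(x in A) f x = \int[lam]_(x in B) f x.
Proof.
move=> mf f0; rewrite -ge0_integral_leb//.
have mA := lebesgue_measurable_version.
have mZ' := borel_lebesgue_measurable mZ.
have mB' := borel_lebesgue_measurable mB.
have Z0' : leb Z = 0 by rewrite leb_borel.
rewrite (ge0_negligible_integral mZ')//; last exact: measurable_fun_cara.
rewrite [RHS](ge0_negligible_integral mZ')//; last exact: measurable_fun_cara.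
congr (\int[leb]_(x in _) f x).
by apply/seteqP; split => x [Ax nZ]; split => //; apply/(AB nZ).
Qed.

Lemma integral_version (f : 'cV[R]_n -> \bar R) :
  measurable_fun setT f ->
  \int[leb]_(x in A) f x = \int[lam]_(x in B) f x.
Proof.
move=> mf; rewrite integralE [RHS]integralE.
by rewrite !ge0_integral_version//; [exact: measurable_funeneg|exact: measurable_funepos].
Qed.

Lemma leb_version : leb A = lam B.
Proof.
have := @ge0_integral_version (cst 1) (measurable_cst _) (fun=> lee01).
rewrite !integral_cst//; last exact: lebesgue_measurable_version.
by rewrite !mul1e.
Qed.

End borel_version.

End completed_lebesgue.

(** * Integrals of bounded functions *)

Section bounded_measurable.
Context {R : realType} {dT : measure_display} {T : measurableType dT}.
Implicit Types f g : T -> R.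

(** A class closed under sums, products and powers and integrable on every measurable set of finite
    measure, so that integrability never needs a separate argument. *)
Definition bounded_measurable f :=
  measurable_fun setT f /\ exists M, forall x, `|f x| <= M.

Lemma bounded_measurable_cst (r : R) : bounded_measurable (fun=> r).
Proof. by split; [exact: measurable_cst|exists `|r|]. Qed.

Lemma bounded_measurableD f g : bounded_measurable f -> bounded_measurable g ->
  bounded_measurable (fun x => f x + g x).
Proof.
move=> [mf [M fM]] [mg [N gN]]; split; first exact: measurable_funD.
by exists (M + N) => x; rewrite (le_trans (ler_normD _ _))// lerD.
Qed.

Lemma bounded_measurableM f g : bounded_measurable f -> bounded_measurable g ->
  bounded_measurable (fun x => f x * g x).
Proof.
move=> [mf [M fM]] [mg [N gN]]; split; first exact: measurable_funM.
by exists (M * N) => x; rewrite normrM ler_pM.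
Qed.

Lemma bounded_measurableZ r f : bounded_measurable f ->
  bounded_measurable (fun x => r * f x).
Proof. exact/bounded_measurableM/bounded_measurable_cst. Qed.

Lemma bounded_measurableN f : bounded_measurable f ->
  bounded_measurable (fun x => - f x).
Proof.
move=> [mf [M fM]]; split; first exact: measurable_funN.
by exists M => x; rewrite normrN.
Qed.

Lemma bounded_measurableB f g : bounded_measurable f -> bounded_measurable g ->
  bounded_measurable (fun x => f x - g x).
Proof. by move=> ? ?; apply/bounded_measurableD/bounded_measurableN. Qed.

Lemma bounded_measurableX f n : bounded_measurable f ->
  bounded_measurable (fun x => f x ^+ n).
Proof.
move=> bf; elim: n => [|n IH].
  by under eq_fun do rewrite expr0; exact: bounded_measurable_cst.
by under eq_fun do rewrite exprS; exact: bounded_measurableM.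
Qed.

Lemma bounded_measurable_norm f : bounded_measurable f ->
  bounded_measurable (fun x => `|f x|).
Proof.
move=> [mf [M fM]]; split; first exact: measurableT_comp.
by exists M => x; rewrite normr_id.
Qed.

Lemma bounded_measurable_sum I (s : seq I) (h : I -> T -> R) :
  (forall i, bounded_measurable (h i)) ->
  bounded_measurable (fun x => \sum_(i <- s) h i x).
Proof.
move=> bh; elim: s => [|i s IH].
  by under eq_fun do rewrite big_nil; exact: bounded_measurable_cst.
by under eq_fun do rewrite big_cons; exact: bounded_measurableD.
Qed.

Lemma bounded_measurable_indic (A : set T) : measurable A ->
  bounded_measurable (\1_A : T -> R).
Proof.
move=> mA; split; first exact: measurable_indic.
by exists 1 => x; rewrite indicE; case: (_ \in _); rewrite ?normr1 ?normr0.
Qed.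

Variables (mu : {measure set T -> \bar R}) (Q : set T).
Hypotheses (mQ : measurable Q) (Qoo : (mu Q < +oo)%E).
Local Notation I f := (\int[mu]_(x in Q) f x).

Lemma bounded_integrable f : bounded_measurable f ->
  mu.-integrable Q (EFin \o f).
Proof.
move=> [mf [M fM]]; apply: measurable_bounded_integrable => //.
  exact: measurable_funTS.
exists M; split; first exact: num_real.
by move=> y My x Qx /=; rewrite (le_trans (fM x))// ltW.
Qed.

Lemma bounded_integral_fin f : bounded_measurable f ->
  (\int[mu]_(x in Q) (f x)%:E = (I f)%:E)%E.
Proof.
move=> bf; rewrite /Rintegral fineK//.
exact: (integrable_fin_num mQ (bounded_integrable bf)).
Qed.

Lemma bounded_integralD f g : bounded_measurable f -> bounded_measurable g ->
  I (fun x => f x + g x) = I f + I g.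
Proof. by move=> bf bg; apply: RintegralD => //; exact: bounded_integrable. Qed.

Lemma bounded_integralB f g : bounded_measurable f -> bounded_measurable g ->
  I (fun x => f x - g x) = I f - I g.
Proof. by move=> bf bg; apply: RintegralB => //; exact: bounded_integrable. Qed.

Lemma bounded_integralZ r f : bounded_measurable f ->
  I (fun x => r * f x) = r * I f.
Proof. by move=> bf; apply: RintegralZl => //; exact: bounded_integrable. Qed.

Lemma bounded_integral_sum J (s : seq J) (h : J -> T -> R) :
  (forall i, bounded_measurable (h i)) ->
  I (fun x => \sum_(i <- s) h i x) = \sum_(i <- s) I (h i).
Proof.
move=> bh; elim: s => [|i s IH].
  rewrite big_nil -[RHS](@Rintegral_set0 _ _ _ mu (fun=> 0)).
  under eq_Rintegral do rewrite big_nil.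
  by rewrite !Rintegral_cst// !mul0r.
under eq_Rintegral do rewrite big_cons.
by rewrite bounded_integralD ?IH ?big_cons//; exact: bounded_measurable_sum.
Qed.

Lemma bounded_le_integral f g : bounded_measurable f -> bounded_measurable g ->
  (forall x, Q x -> f x <= g x) -> I f <= I g.
Proof. by move=> bf bg; apply: le_Rintegral => //; exact: bounded_integrable. Qed.

Lemma bounded_cvg_integral (f_ : nat -> T -> R) (f : T -> R) (M : R) :
  (forall n, measurable_fun setT (f_ n)) -> bounded_measurable f ->
  (forall n x, `|f_ n x| <= M) ->
  (forall x, Q x -> f_ n x @[n --> \oo] --> f x) ->
  forall e, 0 < e -> exists n, I (fun x => `|f_ n x - f x|) <= e.
Proof.
move=> mf_ bf fM cf e e0.
have [//|||||_ cv _] := @dominated_convergence _ _ _ mu Q mQ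
    (fun n => EFin \o f_ n) (EFin \o f) (EFin \o (fun=> M)).
- by move=> n; apply/measurable_EFinP; exact: measurable_funTS.
- by apply/measurable_EFinP; apply: measurable_funTS; case: bf.
- by apply: aeW => x Qx; apply: cvg_EFin; [exact: nearW|exact: cf].
- exact/bounded_integrable/bounded_measurable_cst.
- by apply: aeW => x Qx n /=; rewrite lee_fin.
have bfn n : bounded_measurable (fun x => `|f_ n x - f x|).
  apply/bounded_measurable_norm/bounded_measurableB => //.
  by split => //; exists M.
have cv' : ((I (fun x => `|f_ n x - f x|))%:E @[n --> \oo] --> 0%:E)%E.
  by under eq_fun do rewrite -bounded_integral_fin//.
move: cv' => /fine_cvgP[_ /cvgr0Pnorm_le /(_ e e0)[n _ /(_ n (leqnn n)) /=]].
by move=> le; exists n; exact: le_trans (ler_norm _) le.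
Qed.

End bounded_measurable.

(** * Tiling by integer translates of the unit cube *)

Section integer_box.
Variable d : nat.

(** The integer points of [[-m, m]^d] as a duplicate-free list: every sum over Z^d is truncated to
    such a box. *)
Definition zbox (m : nat) : seq 'cV[int]_d :=
  [seq \col_i ((f i : nat)%:Z - m%:Z) | f : {ffun 'I_d -> 'I_(m.*2.+1)} <- enum {: {ffun 'I_d -> 'I_(m.*2.+1)}}].

Lemma mem_zbox m (k : 'cV[int]_d) :
  (k \in zbox m) <-> (forall i, `|k i ord0| <= m%:Z).
Proof.
split=> [/mapP[f _ ->] i|H].
  rewrite mxE; move: (nat_of_ord (f i)) (ltn_ord (f i)) => a am.
  rewrite ler_norml; lia.
apply/mapP; exists [ffun i => inord (absz (k i ord0 + m%:Z))]; first exact: mem_enum.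
apply/colP => i; rewrite mxE ffunE.
by move: (k i ord0) (H i) => a; rewrite ler_norml => am; rewrite inordK; lia.
Qed.

Lemma zbox_uniq m : uniq (zbox m).
Proof.
rewrite map_inj_uniq ?enum_uniq// => f g /colP E.
apply/ffunP => i; apply/val_inj; have := E i; rewrite !mxE /= => /addIr[e]; exact: e.
Qed.

Lemma zboxN m k : k \in zbox m -> - k \in zbox m.
Proof. by rewrite !mem_zbox => H i; rewrite mxE normrN. Qed.

Lemma zbox_cover (s : seq 'cV[int]_d) :
  exists m, forall k, k \in s -> k \in zbox m.
Proof.
elim: s => [|k s [m IH]]; first by exists 0%N.
exists (m + \sum_i absz (k i ord0))%N => l; rewrite inE => /predU1P[->|/IH].
  apply/mem_zbox => i; rewrite (bigD1 i)//= -abszE lez_nat.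
  by rewrite addnCA leq_addr.
move/mem_zbox => H; apply/mem_zbox => i; apply: le_trans (H i) _.
by rewrite lez_nat leq_addr.
Qed.

Lemma zbox_sub m n : (m <= n)%N -> {subset zbox m <= zbox n}.
Proof. move=> mn k /mem_zbox H; apply/mem_zbox => i; apply: le_trans (H i) _.
by rewrite lez_nat. Qed.

End integer_box.

Section tiling.
Context {R : realType} {d : nat}.
Local Notation lam := (@borel_lebesgue R d).
Local Notation Q := (unit_cube R d).
Local Notation zr k := (map_mx intr k : 'cV[R]_d).
Implicit Types (x t : 'cV[R]_d) (k : 'cV[int]_d).

(** The integer translate of the unit cube that contains [x]; the shift by 1/2 comes from the cube
    being centred at the origin. *)
Definition tile x : 'cV[int]_d := \col_i Num.floor (x i ord0 + 1 / 2).

Lemma unit_cubeD x k : Q (x + zr k) <-> k = - tile x.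
Proof.
split => [H|-> i].
  apply/colP => i; have := H i; rewrite !mxE => /andP[h1 h2].
  apply/eqP; rewrite -eqr_oppLR eq_sym; apply/eqP/floor_def.
  by rewrite intrD rmorphN /=; apply/andP; split; lra.
rewrite !mxE rmorphN /=.
have := floor_itv (x i ord0 + 1 / 2); rewrite intrD => /andP[h1 h2].
by apply/andP; split; lra.
Qed.

Lemma tile_zbox m x : (forall i, `|x i ord0| <= m%:R) -> tile x \in zbox d m.
Proof.
move=> H; apply/mem_zbox => i; rewrite mxE.
have := floor_itv (x i ord0 + 1 / 2); rewrite intrD => /andP[h1 h2].
have := H i; rewrite !ler_norml => /andP[h3 h4]; apply/andP; split.
- rewrite -ltzD1 -(ltr_int R) intrD rmorphN /=; lra.
- rewrite -ltzD1 -(ltr_int R) intrD /=; lra.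
Qed.

Lemma sum_indic_cubeD m x : (forall i, `|x i ord0| <= m%:R) ->
  \sum_(k <- zbox d m) \1_Q (x + zr k) = 1 :> R.
Proof.
move=> H; have tz := zboxN (tile_zbox H).
rewrite (bigD1_seq _ tz (zbox_uniq _ _))/= big1 ?addr0.
  by rewrite indicE mem_set//; apply/unit_cubeD.
by move=> k kt; rewrite indicE memNset// => /unit_cubeD /eqP; apply/negP.
Qed.

Lemma sum_indic_cubeB m x : (forall i, `|x i ord0| <= m%:R) ->
  \sum_(k <- zbox d m) \1_Q (x - zr k) = 1 :> R.
Proof.
move=> H; have tz := tile_zbox H.
have E k : x - zr k = x + zr (- k) by congr (_ + _); apply/colP => i; rewrite !mxE rmorphN.
rewrite (bigD1_seq _ tz (zbox_uniq _ _))/= big1 ?addr0.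
  by rewrite indicE mem_set// E; apply/unit_cubeD.
move=> k kt; rewrite indicE memNset// E => /unit_cubeD /eqP.
by rewrite eqr_opp; apply/negP.
Qed.

Lemma measurable_unit_cube : measurable Q.
Proof. exact: measurable_cube. Qed.

Lemma borel_lebesgue_unit_cube : lam Q = 1%E.
Proof.
rewrite (_ : Q = [set x : 'cV[R]_d | forall i, - (1/2) <= x i ord0 < 1/2])//.
by rewrite borel_lebesgue_cube; [rewrite (_ : _ - _ = 1) ?expr1n//; lra|lra].
Qed.

(** Insert the partition of unity [sum_k 1_Q (x - k) = 1] and translate each term back to the cube;
    the bounded support of [g] makes a finite box sufficient. *)
Lemma ge0_integral_unfold m (g : 'cV[R]_d -> \bar R) :
  measurable_fun setT g -> (forall x, (0 <= g x)%E) ->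
  (forall x, g x != 0%E -> forall i, `|x i ord0| <= m%:R) ->
  (\int[lam]_x g x =
   \int[lam]_(x in Q) \sum_(k <- zbox d m) g (x + zr k)%R)%E.
Proof.
move=> mg g0 gm.
have mgt t : measurable_fun setT (fun x => g (x + t)%R).
  exact: (measurableT_comp mg (measurable_addv t)).
have mind t : measurable_fun setT (fun x => (\1_Q (x + t) : R)%:E).
  exact: (measurableT_comp (measurable_EFin_indic (R := R) measurable_unit_cube)
    (measurable_addv t)).
have ind0 x : (0 <= (\1_Q x : R)%:E)%E by rewrite lee_fin indicE.
transitivity (\int[lam]_x \sum_(k <- zbox d m) (g x * (\1_Q (x - zr k) : R)%:E))%E.
  apply: eq_integral => x _.
  rewrite -ge0_sume_distrr// sumEFin.
  have [->|/gm H] := eqVneq (g x) 0%E; first by rewrite mul0e.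
  by rewrite sum_indic_cubeB// mule1.
rewrite ge0_integral_sum//; last 2 first.
- by move=> k; apply: emeasurable_funM.
- by move=> k x _; rewrite mule_ge0.
rewrite ge0_integral_sum//; last 2 first.
- exact: measurable_unit_cube.
- by move=> k; apply: measurable_funTS.
apply: eq_bigr => k _.
pose f x := (g (x + zr k)%R * (\1_Q x : R)%:E)%E.
transitivity (\int[lam]_x f (x + - zr k)%R)%E.
  by apply: eq_integral => x _; rewrite /f subrK.
rewrite ge0_integral_translate; last 2 first.
- apply: emeasurable_funM => //.
  exact: measurable_EFin_indic measurable_unit_cube.
- by move=> x; rewrite mule_ge0.
rewrite [RHS]integral_mkcond; apply: eq_integral => x _.
rewrite patchE /f indicE.
by case: ifP => _; rewrite ?mule1 ?mule0.
Qed.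

Lemma cV_bounded x : exists m : nat, forall i, `|x i ord0| <= m%:R.
Proof.
exists (Num.truncn (\sum_i `|x i ord0|)).+1 => i.
rewrite (le_trans _ (ltW (truncnS_gt _)))// (bigD1 i)//= lerDl.
by apply: sumr_ge0.
Qed.

Lemma bounded_integral_translate (h : 'cV[R]_d -> R) t :
  bounded_measurable h -> (forall x k, h (x + zr k) = h x) ->
  \int[lam]_(x in Q) h (x + t) = \int[lam]_(x in Q) h x.
Proof.
move=> bh hp; have [mh [M hM]] := bh.
have Qoo : (lam Q < +oo)%E by rewrite borel_lebesgue_unit_cube ltry.
have mQ := measurable_unit_cube.
have bht : bounded_measurable (fun x => h (x + t)).
  split; first exact: (measurableT_comp mh (measurable_addv t)).
  by exists M.
have bM := @bounded_measurable_cst R _ 'cV[R]_d M.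
(* Adding the integral of [M] to both sides replaces [h] by the nonnegative function [h + M], to
   which the unfolding lemma applies. *)
apply: (@addIr _ (\int[lam]_(x in Q) M)).
rewrite -!bounded_integralD//.
pose H x := ((h x + M)%:E)%E.
have mH : measurable_fun setT H.
  by apply/measurable_EFinP; apply: measurable_funD.
have H0 x : (0 <= H x)%E.
  by rewrite lee_fin -lerBlDr sub0r; have := hM x; rewrite ler_norml => /andP[].
have mind : measurable_fun setT (fun x => (\1_Q (x - t) : R)%:E).
  exact: (measurableT_comp (measurable_EFin_indic (R := R) mQ)
    (measurable_addv (- t))).
have ind0 x : (0 <= (\1_Q x : R)%:E)%E by rewrite lee_fin indicE.
have [m tm] := cV_bounded t.
pose f x := (H x * (\1_Q (x - t) : R)%:E)%E.
have mf : measurable_fun setT f by exact: emeasurable_funM.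
have f0 x : (0 <= f x)%E by rewrite mule_ge0.
have b x : Q x -> forall i, `|x i ord0| <= 1.
  by move=> Qx i; have /andP[] := Qx i; rewrite ler_norml => ? ?; apply/andP; split; lra.
congr fine.
transitivity (\int[lam]_x f x)%E.
  rewrite -(ge0_integral_translate t mf f0) integral_mkcond.
  apply: eq_integral => x _; rewrite patchE /f addrK indicE.
  by case: ifP => _; rewrite ?mule1 ?mule0.
(* The support [t + Q] lies in the box of half-width [m.+1], since [m] bounds [t] and the cube adds
   at most 1. After unfolding, periodicity takes [h + M] out of the sum and the remaining indicators
   add up to 1. *)
rewrite (@ge0_integral_unfold m.+1)//; last first.
  move=> x; rewrite /f indicE; have [|] := boolP (x - t \in Q); last by rewrite mule0 eqxx.
  move/set_mem => /b + _ i => /(_ i); have := tm i; rewrite !mxE -natr1.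
  by move=> h1 h2; rewrite -[x i ord0](subrK (t i ord0)) addrC (le_trans (ler_normD _ _))// lerD.
apply: eq_integral => x /set_mem Qx.
under eq_bigr do rewrite /f /H hp addrAC.
rewrite -ge0_sume_distrr; last by [].
rewrite sumEFin sum_indic_cubeD ?mule1// => i.
by rewrite !mxE -natr1 (le_trans (ler_normD _ _))// normrN addrC lerD// b.
Qed.

End tiling.

(** * Trigonometric polynomials *)

Section trigonometric_polynomials.
Context {R : realType} {d : nat}.
Local Notation lam := (@borel_lebesgue R d).
Local Notation Q := (unit_cube R d).
Local Notation zr k := (map_mx intr k : 'cV[R]_d).
Local Notation I f := (\int[lam]_(x in Q) f x).
Implicit Types (x y t : 'cV[R]_d) (k l : 'cV[int]_d).

Lemma dotvDl x y t : dotv (x + y) t = dotv x t + dotv y t.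
Proof. by rewrite -big_split; apply: eq_bigr => i _; rewrite mxE mulrDl. Qed.

Lemma dotvC x y : dotv x y = dotv y x.
Proof. by apply: eq_bigr => i _; rewrite mulrC. Qed.

Lemma dotvDr x y t : dotv t (x + y) = dotv t x + dotv t y.
Proof. by rewrite dotvC dotvDl !(dotvC t). Qed.

Lemma dotvNl x y : dotv (- x) y = - dotv x y.
Proof. by rewrite -sumrN; apply: eq_bigr => i _; rewrite mxE mulNr. Qed.

Lemma zrD k l : zr (k + l) = zr k + zr l.
Proof. by apply/colP => i; rewrite !mxE intrD. Qed.

Lemma zrN k : zr (- k) = - zr k.
Proof. by apply/colP => i; rewrite !mxE rmorphN. Qed.

Lemma dotv_zr k l : dotv (zr k) (zr l) = (\sum_i k i ord0 * l i ord0)%:~R.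
Proof. by rewrite rmorph_sum; apply: eq_bigr => i _; rewrite !mxE rmorphM. Qed.

Definition cosz k x : R := cos (2 * pi * dotv (zr k) x).
Definition sinz k x : R := sin (2 * pi * dotv (zr k) x).

Lemma cos_sin_2pi_int (n : int) :
  cos (2 * pi * n%:~R) = 1 :> R /\ sin (2 * pi * n%:~R) = 0 :> R.
Proof.
have H (m : nat) : cos (2 * pi * m%:R) = 1 :> R /\ sin (2 * pi * m%:R) = 0 :> R.
  elim: m => [|m [IHc IHs]]; first by rewrite mulr0 cos0 sin0.
  have -> : 2 * pi * m.+1%:R = 2 * pi * m%:R + pi *+ 2 :> R.
    by rewrite -[m.+1%:R]natr1 mulrDr mulr1 mulr_natl.
  by rewrite cosD2pi sinD2pi.
case: n => m; first exact: H.
by rewrite NegzE rmorphN mulrN cosN sinN; have [-> ->] := H m.+1; rewrite oppr0.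
Qed.

Lemma coszD k x y : cosz k (x + y) = cosz k x * cosz k y - sinz k x * sinz k y.
Proof. by rewrite /cosz dotvDr mulrDr cosD. Qed.

Lemma sinzD k x y : sinz k (x + y) = sinz k x * cosz k y + cosz k x * sinz k y.
Proof. by rewrite /sinz dotvDr mulrDr sinD. Qed.

Lemma cosz_freqD k l x :
  cosz (k + l) x = cosz k x * cosz l x - sinz k x * sinz l x.
Proof. by rewrite /cosz zrD dotvDl mulrDr cosD. Qed.

Lemma sinz_freqD k l x :
  sinz (k + l) x = sinz k x * cosz l x + cosz k x * sinz l x.
Proof. by rewrite /sinz zrD dotvDl mulrDr sinD. Qed.

Lemma coszN k x : cosz (- k) x = cosz k x.
Proof. by rewrite /cosz zrN dotvNl mulrN cosN. Qed.

Lemma sinzN k x : sinz (- k) x = - sinz k x.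
Proof. by rewrite /sinz zrN dotvNl mulrN sinN. Qed.

Lemma cosz0 x : cosz 0 x = 1.
Proof.
rewrite /cosz (_ : dotv _ _ = 0) ?mulr0 ?cos0//.
by rewrite /dotv big1// => i _; rewrite !mxE mul0r.
Qed.

Lemma sinz0 x : sinz 0 x = 0.
Proof.
rewrite /sinz (_ : dotv _ _ = 0) ?mulr0 ?sin0//.
by rewrite /dotv big1// => i _; rewrite !mxE mul0r.
Qed.

Let cosz_sinz_zr k l : cosz k (zr l) = 1 /\ sinz k (zr l) = 0.
Proof. by rewrite /cosz /sinz dotv_zr; exact: cos_sin_2pi_int. Qed.

Lemma cosz_periodic k x l : cosz k (x + zr l) = cosz k x.
Proof. by rewrite coszD; have [-> ->] := cosz_sinz_zr k l; rewrite mulr1 mulr0 subr0. Qed.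

Lemma sinz_periodic k x l : sinz k (x + zr l) = sinz k x.
Proof. by rewrite sinzD; have [-> ->] := cosz_sinz_zr k l; rewrite mulr1 mulr0 addr0. Qed.

Lemma measurable_phase k : measurable_fun setT (fun x => 2 * pi * dotv (zr k) x).
Proof.
apply: measurable_funM; first exact: measurable_cst.
by apply: measurable_dotv; [exact: measurable_cst|exact: measurable_id].
Qed.

Lemma bounded_measurable_cosz k : bounded_measurable (cosz k).
Proof.
split; last by exists 1 => x; exact: cos_max.
apply: measurableT_comp (measurable_phase k).
by apply: continuous_measurable_fun; exact: continuous_cos.
Qed.

Lemma bounded_measurable_sinz k : bounded_measurable (sinz k).
Proof.
split; last by exists 1 => x; exact: sin_max.
apply: measurableT_comp (measurable_phase k).
by apply: continuous_measurable_fun; exact: continuous_sin.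
Qed.

Let mQ : measurable Q := measurable_unit_cube.
Let Qoo : (lam Q < +oo)%E.
Proof. by rewrite borel_lebesgue_unit_cube ltry. Qed.

Lemma integral_cst_cube (r : R) : I (fun=> r) = r.
Proof.
transitivity (r * fine (lam Q)); first exact: Rintegral_cst.
by rewrite borel_lebesgue_unit_cube mulr1.
Qed.

(* Translating by half a period changes the sign. *)
Lemma integral_cosz_sinz k : k != 0 -> I (cosz k) = 0 /\ I (sinz k) = 0.
Proof.
move=> k0; have [i ki] : exists i, k i ord0 != 0.
  apply: contrapT => H; move/eqP: k0; apply; apply/colP => i; rewrite mxE.
  by apply/eqP; apply: contrapT => /negP ki; apply: H; exists i.
pose t : 'cV[R]_d := \col_j (if j == i then (2 * (k i ord0)%:~R)^-1 else 0).
have kt : 2 * pi * dotv (zr k) t = pi.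
  rewrite /dotv (bigD1 i)//= big1; last by move=> j ji; rewrite !mxE (negbTE ji) mulr0.
  rewrite !mxE eqxx addr0.
  have : (k i ord0)%:~R != 0 :> R by rewrite intr_eq0.
  by move=> ?; field.
have ct : cosz k t = -1 by rewrite /cosz kt cospi.
have st : sinz k t = 0 by rewrite /sinz kt sinpi.
split.
- have := bounded_integral_translate t (bounded_measurable_cosz k) (cosz_periodic k).
  under eq_Rintegral do rewrite coszD ct st mulr0 subr0 mulrC.
  rewrite bounded_integralZ//; last exact: bounded_measurable_cosz.
  lra.
- have := bounded_integral_translate t (bounded_measurable_sinz k) (sinz_periodic k).
  under eq_Rintegral do rewrite sinzD ct st mulr0 addr0 mulrC.
  rewrite bounded_integralZ//; last exact: bounded_measurable_sinz.
  lra.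
Qed.

Lemma integral_cosz k : I (cosz k) = (k == 0)%:R.
Proof.
have [->|/integral_cosz_sinz[]//] := eqVneq k 0.
by under eq_Rintegral do rewrite cosz0; rewrite integral_cst_cube.
Qed.

Lemma integral_sinz k : I (sinz k) = 0.
Proof.
have [->|/integral_cosz_sinz[]//] := eqVneq k 0.
by under eq_Rintegral do rewrite sinz0; rewrite integral_cst_cube.
Qed.

Let bc := bounded_measurable_cosz.
Let bs := bounded_measurable_sinz.

Lemma integral_coszM k l :
  I (fun x => cosz k x * cosz l x) = ((k == l)%:R + (k == - l)%:R) / 2.
Proof.
transitivity (I (fun x => 2^-1 * (cosz (k - l) x + cosz (k + l) x))).
  apply: eq_Rintegral => x _; rewrite !cosz_freqD coszN sinzN.
  by field.
rewrite bounded_integralZ//; last exact: bounded_measurableD.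
by rewrite bounded_integralD// !integral_cosz subr_eq0 addr_eq0 mulrC.
Qed.

Lemma integral_sinzM k l :
  I (fun x => sinz k x * sinz l x) = ((k == l)%:R - (k == - l)%:R) / 2.
Proof.
transitivity (I (fun x => 2^-1 * (cosz (k - l) x - cosz (k + l) x))).
  apply: eq_Rintegral => x _; rewrite !cosz_freqD coszN sinzN.
  by field.
rewrite bounded_integralZ//; last exact: bounded_measurableB.
by rewrite bounded_integralB// !integral_cosz subr_eq0 addr_eq0 mulrC.
Qed.

Lemma integral_coszM_sinz k l : I (fun x => cosz k x * sinz l x) = 0.
Proof.
transitivity (I (fun x => 2^-1 * (sinz (k + l) x - sinz (k - l) x))).
  apply: eq_Rintegral => x _; rewrite !sinz_freqD coszN sinzN.
  by field.
rewrite bounded_integralZ//; last exact: bounded_measurableB.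
by rewrite bounded_integralB// !integral_sinz subrr mulr0.
Qed.

(** Triples hold a frequency, a cosine coefficient and a sine coefficient. Repeated frequencies are
    allowed, so that addition is concatenation. *)
Definition trig_sum (s : seq ('cV[int]_d * R * R)) x : R :=
  \sum_(t <- s) (t.1.2 * cosz t.1.1 x + t.2 * sinz t.1.1 x).

Definition trig_poly (f : 'cV[R]_d -> R) := exists s, f = trig_sum s.

Lemma trig_poly_bounded f : trig_poly f -> bounded_measurable f.
Proof.
move=> [s ->]; apply: bounded_measurable_sum => t.
by apply: bounded_measurableD; exact: bounded_measurableZ.
Qed.

Lemma trig_polyD f g : trig_poly f -> trig_poly g ->
  trig_poly (fun x => f x + g x).
Proof.
move=> [s ->] [s' ->]; exists (s ++ s').
by apply/funext => x; rewrite /trig_sum big_cat.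
Qed.

Lemma trig_poly1 k (a b : R) : trig_poly (fun x => a * cosz k x + b * sinz k x).
Proof. by exists [:: (k, a, b)]; apply/funext => x; rewrite /trig_sum big_seq1. Qed.

Lemma trig_poly_cst a : trig_poly (fun=> a).
Proof.
have := trig_poly1 0 a 0; congr trig_poly; apply/funext => x.
by rewrite cosz0 mulr1 mul0r addr0.
Qed.

Lemma trig_polyM f g : trig_poly f -> trig_poly g ->
  trig_poly (fun x => f x * g x).
Proof.
move=> [s ->] tg; elim: s => [|[[k a] b] s IH].
  have := trig_poly_cst 0; congr trig_poly; apply/funext => x.
  by rewrite /trig_sum big_nil mul0r.
have -> : (fun x => trig_sum ((k, a, b) :: s) x * g x) =
    (fun x => (a * cosz k x + b * sinz k x) * g x + trig_sum s x * g x).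
  by apply/funext => x; rewrite /trig_sum big_cons mulrDl.
apply: trig_polyD IH; case: tg => [s' ->].
elim: s' => [|[[l a'] b'] s' IH].
  have := trig_poly_cst 0; congr trig_poly; apply/funext => x.
  by rewrite /trig_sum big_nil mulr0.
have -> : (fun x => (a * cosz k x + b * sinz k x) * trig_sum ((l, a', b') :: s') x) =
    (fun x => (((a * a' + b * b') / 2 * cosz (k - l) x
               + (b * a' - a * b') / 2 * sinz (k - l) x)
            + ((a * a' - b * b') / 2 * cosz (k + l) x
               + (a * b' + b * a') / 2 * sinz (k + l) x))
       + (a * cosz k x + b * sinz k x) * trig_sum s' x).
  apply/funext => x; rewrite /trig_sum big_cons mulrDr; congr (_ + _) => /=.
  rewrite !cosz_freqD !sinz_freqD !coszN !sinzN.
  by field.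
by apply: trig_polyD IH; apply: trig_polyD; exact: trig_poly1.
Qed.

Lemma trig_polyB f g : trig_poly f -> trig_poly g ->
  trig_poly (fun x => f x - g x).
Proof.
move=> tf tg; apply: trig_polyD => //.
have := trig_polyM (trig_poly_cst (-1)) tg; congr trig_poly.
by apply/funext => x; rewrite mulN1r.
Qed.

Lemma trig_polyX f n : trig_poly f -> trig_poly (fun x => f x ^+ n).
Proof.
move=> tf; elim: n => [|n IH].
  by under eq_fun do rewrite expr0; exact: trig_poly_cst.
by under eq_fun do rewrite exprS; exact: trig_polyM.
Qed.

Definition coefc f k : R := I (fun x => f x * cosz k x).
Definition coefs f k : R := I (fun x => f x * sinz k x).

Section bessel.
Variables (f : 'cV[R]_d -> R) (m : nat).
Hypothesis bf : bounded_measurable f.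
Local Notation K := (zbox d m).

(** The box contains both [k] and [- k], which carry the same cosine and, up to sign, the same sine.
    Each nonconstant term is thus counted twice, which compensates the factor 1/2 in
    [integral_coszM] and [integral_sinzM]. *)
Let P x := \sum_(k <- K) (coefc f k * cosz k x + coefs f k * sinz k x).

Let bP : bounded_measurable P.
Proof.
apply: bounded_measurable_sum => k.
by apply: bounded_measurableD; exact: bounded_measurableZ.
Qed.

Let integral_PM g : bounded_measurable g -> I (fun x => P x * g x) =
  \sum_(k <- K) (coefc f k * I (fun x => cosz k x * g x)
               + coefs f k * I (fun x => sinz k x * g x)).
Proof.
move=> bg; under eq_Rintegral do rewrite /P mulr_suml.
have bcg k : bounded_measurable (fun x => cosz k x * g x) by exact: bounded_measurableM.
have bsg k : bounded_measurable (fun x => sinz k x * g x) by exact: bounded_measurableM.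
rewrite bounded_integral_sum//; last first.
  move=> k; apply: bounded_measurableM => //.
  by apply: bounded_measurableD; exact: bounded_measurableZ.
apply: eq_bigr => k _; under eq_Rintegral do rewrite mulrDl -!mulrA.
by rewrite bounded_integralD ?bounded_integralZ//; exact: bounded_measurableZ.
Qed.

Let sum_zbox (F : 'cV[int]_d -> R) l : l \in K ->
  \sum_(k <- K) (F k * (k == l)%:R) = F l.
Proof.
move=> lK; rewrite (bigD1_seq _ lK (zbox_uniq _ _))/= eqxx mulr1 big1 ?addr0//.
by move=> k /negbTE ->; rewrite mulr0.
Qed.

Let coefcN k : coefc f (- k) = coefc f k.
Proof. by apply: eq_Rintegral => x _; rewrite coszN. Qed.

Let coefsN k : coefs f (- k) = - coefs f k.
Proof.
rewrite -mulN1r -bounded_integralZ//; last exact: bounded_measurableM.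
by apply: eq_Rintegral => x _; rewrite sinzN mulN1r mulrN.
Qed.

Let coefc_proj l : l \in K -> coefc P l = coefc f l.
Proof.
move=> lK; rewrite /coefc integral_PM//.
transitivity (\sum_(k <- K) (coefc f k / 2 * (k == l)%:R) +
              \sum_(k <- K) (coefc f k / 2 * (k == - l)%:R)).
  rewrite -big_split; apply: eq_bigr => k _ /=; rewrite integral_coszM.
  under [X in _ + _ * X]eq_Rintegral do rewrite mulrC.
  by rewrite integral_coszM_sinz mulr0 addr0; field.
by rewrite !sum_zbox ?zboxN// coefcN -splitr.
Qed.

Let coefs_proj l : l \in K -> coefs P l = coefs f l.
Proof.
move=> lK; rewrite /coefs integral_PM//.
transitivity (\sum_(k <- K) (coefs f k / 2 * (k == l)%:R) -
              \sum_(k <- K) (coefs f k / 2 * (k == - l)%:R)).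
  rewrite -sumrB; apply: eq_bigr => k _ /=; rewrite integral_sinzM.
  by rewrite integral_coszM_sinz mulr0 add0r; field.
by rewrite !sum_zbox ?zboxN// coefsN mulNr opprK -splitr.
Qed.

Let br : bounded_measurable (fun x => f x - P x).
Proof. exact: bounded_measurableB. Qed.

Let resid_orth (s : seq ('cV[int]_d * R * R)) : (forall u, u \in s -> u.1.1 \in K) ->
  I (fun x => (f x - P x) * trig_sum s x) = 0.
Proof.
elim: s => [|[[l a] b] s IH] H.
  under eq_Rintegral do rewrite /trig_sum big_nil mulr0.
  by rewrite integral_cst_cube.
have lK : l \in K by apply: (H (l, a, b)); rewrite mem_head.
transitivity (I (fun x => (a * ((f x - P x) * cosz l x) +
                           b * ((f x - P x) * sinz l x)) +
                          (f x - P x) * trig_sum s x)).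
  by apply: eq_Rintegral => x _; rewrite /trig_sum big_cons /=; ring.
have brc := bounded_measurableM br (bc l).
have brs := bounded_measurableM br (bs l).
rewrite bounded_integralD ?IH ?addr0//; last first.
- by apply: bounded_measurableM => //; apply: trig_poly_bounded; exists s.
- by apply: bounded_measurableD; exact: bounded_measurableZ.
- by move=> t ts; apply: H; rewrite inE ts orbT.
rewrite bounded_integralD ?bounded_integralZ//; try exact: bounded_measurableZ.
have -> : I (fun x => (f x - P x) * cosz l x) = 0.
  under eq_Rintegral do rewrite mulrBl.
  rewrite bounded_integralB//; try exact: bounded_measurableM.
  by rewrite -/(coefc f l) -/(coefc P l) coefc_proj// subrr.
have -> : I (fun x => (f x - P x) * sinz l x) = 0.
  under eq_Rintegral do rewrite mulrBl.
  rewrite bounded_integralB//; try exact: bounded_measurableM.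
  by rewrite -/(coefs f l) -/(coefs P l) coefs_proj// subrr.
by rewrite !mulr0 addr0.
Qed.

(* The partial Fourier sum over the box is the best mean-square approximation
   among all trigonometric polynomials with frequencies in the box. *)
Lemma bessel_le (s : seq ('cV[int]_d * R * R)) : (forall u, u \in s -> u.1.1 \in K) ->
  I (fun x => f x ^+ 2) <=
  \sum_(k <- K) (coefc f k ^+ 2 + coefs f k ^+ 2) +
  I (fun x => (f x - trig_sum s x) ^+ 2).
Proof.
move=> sK; set T := trig_sum s.
have bT : bounded_measurable T by apply: trig_poly_bounded; exists s.
pose sP := [seq (k, coefc f k, coefs f k) | k <- K].
have PE : P = trig_sum sP.
  by apply/funext => x; rewrite /P /trig_sum /sP [RHS]big_map.
have oP : I (fun x => (f x - P x) * P x) = 0.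
  rewrite {2}PE; apply: resid_orth => t /mapP[k kK ->]; exact: kK.
have oT : I (fun x => (f x - P x) * T x) = 0 by exact: resid_orth.
have fP : I (fun x => P x * f x) = \sum_(k <- K) (coefc f k ^+ 2 + coefs f k ^+ 2).
  rewrite integral_PM//; apply: eq_bigr => k _.
  by congr (_ * _ + _ * _); apply: eq_Rintegral => x _; rewrite mulrC.
have bPP := bounded_measurableX 2 bP.
have brr := bounded_measurableM br bP.
have brT := bounded_measurableM br bT.
have bPf := bounded_measurableM bP bf.
have bPT := bounded_measurableX 2 (bounded_measurableB bP bT).
rewrite -fP.
have bff := bounded_measurableX 2 bf.
have b1 := bounded_measurableB bff bPf.
have b2 := bounded_measurableD bPT brr.
have b3 := bounded_measurableZ 2 brT.
have E : I (fun x => (f x - T x) ^+ 2) =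
    I (fun x => f x ^+ 2) - I (fun x => P x * f x) +
    (I (fun x => (P x - T x) ^+ 2) + I (fun x => (f x - P x) * P x))
    - 2 * I (fun x => (f x - P x) * T x).
  rewrite -(bounded_integralZ mQ Qoo 2 brT) -(bounded_integralD mQ Qoo bPT brr).
  rewrite -(bounded_integralB mQ Qoo bff bPf) -(bounded_integralD mQ Qoo b1 b2).
  rewrite -(bounded_integralB mQ Qoo (bounded_measurableD b1 b2) b3).
  by apply: eq_Rintegral => x _; ring.
have : 0 <= I (fun x => (P x - T x) ^+ 2).
  by apply: Rintegral_ge0 => x _; exact: sqr_ge0.
rewrite oP oT in E; lra.
Qed.

End bessel.
End trigonometric_polynomials.

(** * Polynomial approximation of a step function *)

Section threshold.
Context {R : realType}.

Lemma bernoulli_ge (a : R) n : 0 <= a -> 1 + n%:R * a <= (1 + a) ^+ n.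
Proof.
move=> a0; elim: n => [|n IH]; first by rewrite mul0r addr0.
rewrite exprS -natr1 (le_trans _ (ler_wpM2l _ IH)) ?addr_ge0//.
have : 0 <= n%:R * a * a by rewrite !mulr_ge0.
lra.
Qed.

Lemma bernoulli_le (a : R) n : 0 <= a <= 1 -> 1 - n%:R * a <= (1 - a) ^+ n.
Proof.
move=> /andP[a0 a1]; elim: n => [|n IH]; first by rewrite mul0r subr0.
rewrite exprS -natr1 (le_trans _ (ler_wpM2l _ IH)) ?subr_ge0//.
have : 0 <= n%:R * a * a by rewrite !mulr_ge0.
lra.
Qed.

(** Each of the [n] terms [r^i] with [i < n] is at least [r^n], and their geometric sum is at most
    [1/(1 - r)]. *)
Lemma natrM_expr_le (r : R) n : 0 <= r < 1 -> n%:R * r ^+ n <= (1 - r)^-1.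
Proof.
move=> /andP[r0 r1].
have r1' : 0 < 1 - r by rewrite subr_gt0.
apply: (@le_trans _ _ (\sum_(i < n) r ^+ i)).
  rewrite mulr_natl -[n in _ *+ n]card_ord -sumr_const; apply: ler_sum => i _.
  by apply: ler_wiXn2l; [exact: r0|exact: ltW|exact: ltnW].
rewrite -[leRHS]mul1r ler_pdivlMr// mulrC -opprB mulNr -subrX1.
by rewrite opprB gerBl exprn_ge0.
Qed.

(** The product of the exponent [n 4^n] with [u^(2n)] is [n (2u)^(2n)]: it tends to 0 for [u < 1/2]
    and is at least [n] for [u >= 1/2]. The extra factor [n] settles the boundary case [u = 1/2]. *)
Definition threshold n (u : R) : R := (1 - u ^+ (2 * n)) ^+ (n * 4 ^ n).

Lemma threshold_itv n (u : R) : 0 <= u <= 1 -> 0 <= threshold n u <= 1.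
Proof.
move=> /andP[u0 u1]; have := exprn_ge0 (2 * n) u0.
have := exprn_ile1 (2 * n) u0 u1 => v1 v0.
by rewrite exprn_ge0 ?subr_ge0// exprn_ile1 ?subr_ge0 ?gerBl.
Qed.

Lemma cvg_threshold (u : R) : 0 <= u <= 1 ->
  threshold n u @[n --> \oo] --> ((u < 1 / 2)%R%:R : R).
Proof.
move=> u01; have /andP[u0 u1] := u01.
have [u2|u2] := ltP u (1 / 2).
  pose r := 2 * u.
  have r01 : 0 <= r < 1 by rewrite /r; apply/andP; split; lra.
  have /andP[r0 r1] := r01.
  (* By Bernoulli the value is at least [1 - n r^(2n)], and [n r^n <= 1/(1 - r)] leaves a geometric
     error. *)
  apply: (@squeeze_cvgr _ _ _ _ (fun n => 1 - geometric (1 - r)^-1 r n) (fun=> 1)).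
  - apply: nearW => n; have /andP[_ ->] := threshold_itv n u01; rewrite andbT.
    have v01 : 0 <= u ^+ (2 * n) <= 1 by rewrite exprn_ge0// exprn_ile1.
    apply: le_trans (bernoulli_le _ v01); rewrite lerD2l lerN2 /=.
    have -> : (n * 4 ^ n)%:R * u ^+ (2 * n) = (n%:R * r ^+ n) * r ^+ n :> R.
      rewrite /r natrM natrX !exprMn -!mulrA; congr (_ * _).
      rewrite exprM expr2 exprMn (_ : 4 = 2 * 2)%R; last by ring.
      by rewrite exprMn; ring.
    by apply: ler_wpM2r; [exact: exprn_ge0|exact: natrM_expr_le].
  - rewrite -[X in _ --> X]subr0; apply: cvgB; first exact: cvg_cst.
    by apply: cvg_geometric; rewrite ger0_norm.
  - exact: cvg_cst.
(* Here [u^(2n) >= a = 4^(-n)]. With [K = n 4^n], one has [(1 - a)^K (1 + a)^K <= 1] and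
   [(1 + a)^K >= 1 + K a = n + 1], so the value is at most [1/(n + 1)]. *)
apply: (@squeeze_cvgr _ _ _ _ (fun=> 0) harmonic).
- apply: nearW => n; have /andP[-> _] /= := threshold_itv n u01.
  pose a : R := 4^-1 ^+ n.
  have a0 : 0 <= a by rewrite exprn_ge0.
  have a1 : a <= 1 by rewrite exprn_ile1//; lra.
  have au : a <= u ^+ (2 * n).
    rewrite exprM /a; apply: lerXn2r; rewrite ?nnegrE//; nra.
  have u2n1 : u ^+ (2 * n) <= 1 by rewrite exprn_ile1.
  have Ka : (n * 4 ^ n)%:R * a = n%:R :> R.
    by rewrite natrM natrX -mulrA -exprMn divff// expr1n mulr1.
  have le1 : threshold n u <= (1 - a) ^+ (n * 4 ^ n).
    by apply: lerXn2r; rewrite ?nnegrE; lra.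
  apply: le_trans le1 _; rewrite -[leRHS]mul1r ler_pdivlMr//.
  have := bernoulli_ge (n * 4 ^ n) a0; rewrite Ka addrC natr1 => le2.
  have : (1 - a) ^+ (n * 4 ^ n) * n.+1%:R <= (1 - a) ^+ (n * 4 ^ n) * (1 + a) ^+ (n * 4 ^ n).
    by apply: ler_wpM2l => //; rewrite exprn_ge0// subr_ge0.
  move/le_trans; apply; rewrite -exprMn exprn_ile1//; nra.
- exact: cvg_cst.
- exact: cvg_harmonic.
Qed.

End threshold.

(** * Density of trigonometric polynomials *)

Section trigonometric_approximation.
Context {R : realType} {d : nat}.
Local Notation lam := (@borel_lebesgue R d).
Local Notation Q := (unit_cube R d).
Local Notation zr k := (map_mx intr k : 'cV[R]_d).
Local Notation I f := (\int[lam]_(x in Q) f x).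
Implicit Types (x y t : 'cV[R]_d) (E F : set 'cV[R]_d).

Let mQ : measurable Q := measurable_unit_cube.
Let Qoo : (lam Q < +oo)%E.
Proof. by rewrite borel_lebesgue_unit_cube ltry. Qed.

(** Approximation in L^1 of the cube. The bounds [0 <= T <= 1] keep products under control in
    [trig_approxI] and let L^1 errors dominate squared errors in [trig_approx_L2]. *)
Definition trig_approx E := forall e : R, 0 < e ->
  exists T, [/\ trig_poly T, (forall x, 0 <= T x <= 1) &
    I (fun x => `|\1_E x - T x|) <= e].

Let bmd E f : measurable E -> trig_poly f ->
  bounded_measurable (fun x => `|\1_E x - f x|).
Proof.
move=> mE tf; apply/bounded_measurable_norm/bounded_measurableB.
  exact: bounded_measurable_indic.
exact: trig_poly_bounded.
Qed.

Let bmdd E F : measurable E -> measurable F ->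
  bounded_measurable (fun x => `|\1_E x - \1_F x| : R).
Proof.
by move=> mE mF; apply/bounded_measurable_norm/bounded_measurableB;
  exact: bounded_measurable_indic.
Qed.

Lemma trig_approx_eq E F : E `&` Q = F `&` Q -> trig_approx E -> trig_approx F.
Proof.
move=> EF aE e /aE [T [tT T01 le]]; exists T; split => //.
apply: le_trans le; rewrite le_eqVlt; apply/orP; left; apply/eqP.
apply: eq_Rintegral => x /set_mem Qx; congr (`|_ - _|).
rewrite !indicE; congr (_%:R); congr nat_of_bool.
by apply/idP/idP => /set_mem H; apply/mem_set;
  [have : (F `&` Q) x by []; rewrite -EF|have : (E `&` Q) x by []; rewrite EF] => -[].
Qed.

Lemma trig_approxC E : measurable E -> trig_approx E -> trig_approx (~` E).
Proof.
move=> mE aE e /aE [T [tT T01 le]]; exists (fun x => 1 - T x); split.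
- by apply: trig_polyB => //; exact: trig_poly_cst.
- by move=> x; have := T01 x; lra.
- apply: le_trans le; rewrite le_eqVlt; apply/orP; left; apply/eqP.
  apply: eq_Rintegral => x _; rewrite !indicE in_setC -normrN.
  by case: (x \in E) => /=; congr (`|_|); ring.
Qed.

Lemma trig_approxI E F : measurable E -> measurable F ->
  trig_approx E -> trig_approx F -> trig_approx (E `&` F).
Proof.
move=> mE mF aE aF e e0; have e20 : 0 < e / 2 by rewrite divr_gt0.
have [T [tT T01 leT]] := aE _ e20; have [S [tS S01 leS]] := aF _ e20.
have tTS := trig_polyM tT tS.
exists (fun x => T x * S x); split => //.
  move=> x; have /andP[t0 t1] := T01 x; have /andP[s0 s1] := S01 x.
  by rewrite mulr_ge0//= mulr_ile1.
rewrite [e]splitr; apply: le_trans (lerD leT leS).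
rewrite -bounded_integralD//; [|exact: bmd|exact: bmd].
apply: bounded_le_integral => //.
- by apply: bmd => //; exact: measurableI.
- by apply: bounded_measurableD; exact: bmd.
- move=> x _; rewrite !indicE in_setI.
  have /andP[t0 t1] := T01 x; have /andP[s0 s1] := S01 x.
  case: (x \in E); case: (x \in F) => /=; rewrite ?sub0r ?normrN.
  + rewrite [X in X <= _]ger0_norm; last by rewrite subr_ge0 mulr_ile1.
    rewrite [X in _ <= X + _]ger0_norm ?subr_ge0// [X in _ <= _ + X]ger0_norm ?subr_ge0//.
    nra.
  + rewrite ger0_norm ?mulr_ge0// [X in _ <= _ + X]ger0_norm//.
    by rewrite -[leLHS]add0r lerD// ler_piMl.
  + rewrite ger0_norm ?mulr_ge0// [X in _ <= X + _]ger0_norm//.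
    by rewrite -[leLHS]addr0 lerD// ler_piMr.
  + rewrite !ger0_norm ?mulr_ge0//.
    by rewrite -[leLHS]add0r lerD// ler_piMl.
Qed.

Lemma trig_approxU E F : measurable E -> measurable F ->
  trig_approx E -> trig_approx F -> trig_approx (E `|` F).
Proof.
move=> mE mF aE aF; rewrite -[_ `|` _]setCK setCU; apply: trig_approxC.
  by apply: measurableI; exact: measurableC.
by apply: trig_approxI; (exact: measurableC || exact: trig_approxC).
Qed.

Lemma trig_approx0 : trig_approx set0.
Proof.
move=> e e0; exists (fun=> 0); split; first exact: trig_poly_cst.
  by move=> x; rewrite lexx ler01.
under eq_Rintegral do rewrite indicE in_set0 subrr normr0.
by rewrite integral_cst_cube ltW.
Qed.

(** By dominated convergence some [F_ n] is already L^1-close to [E]; this carries finite unions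
    over to countable ones. *)
Lemma trig_approx_lim (F_ : nat -> set 'cV[R]_d) E :
  (forall n, measurable (F_ n)) -> measurable E -> (forall n, trig_approx (F_ n)) ->
  (forall x, (\1_(F_ n) x : R) @[n --> \oo] --> (\1_E x : R)) -> trig_approx E.
Proof.
move=> mF mE aF cv e e0; have e20 : 0 < e / 2 by rewrite divr_gt0.
have [||||n len] := bounded_cvg_integral mQ Qoo (f_ := fun n => \1_(F_ n)) (f := \1_E)
   (M := 1) _ _ _ _ e20.
- by move=> n; exact: measurable_indic.
- exact: bounded_measurable_indic.
- by move=> n x; rewrite indicE; case: (_ \in _); rewrite ?normr1 ?normr0.
- by move=> x _; exact: cv.
have [T [tT T01 leT]] := aF n _ e20; exists T; split => //.
rewrite [e]splitr; apply: le_trans (lerD len leT).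
rewrite -bounded_integralD//; [|exact: bmdd|exact: bmd].
apply: bounded_le_integral => //; first exact: bmd.
  by apply: bounded_measurableD; [exact: bmdd|exact: bmd].
move=> x _; have -> : \1_E x - T x = (\1_E x - \1_(F_ n) x) + (\1_(F_ n) x - T x) by ring.
by rewrite (le_trans (ler_normD _ _))// lerD2r distrC.
Qed.

Lemma trig_approx_bigcup (F_ : nat -> set 'cV[R]_d) :
  (forall n, measurable (F_ n)) -> (forall n, trig_approx (F_ n)) ->
  trig_approx (\bigcup_n F_ n).
Proof.
move=> mF aF; pose G n := \big[setU/set0]_(i < n) F_ i.
have mG n : measurable (G n) by exact: bigsetU_measurable.
apply: (@trig_approx_lim G) => //.
- exact: bigcupT_measurable.
- elim=> [|n IH]; first by rewrite /G big_ord0; exact: trig_approx0.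
  by rewrite /G big_ord_recr /=; apply: trig_approxU => //; exact: mG.
- move=> x; rewrite indicE; have [/set_mem[i _ Fix]|H] := boolP (x \in \bigcup_n F_ n).
    apply: cvg_near_cst; exists i.+1 => // n /= ni.
    by rewrite /= ?indicE mem_set//; rewrite /G -(bigcup_mkord n F_); exists i.
  apply: cvg_near_cst; apply: nearW => n; rewrite ?indicE memNset//.
  rewrite /G -(bigcup_mkord n F_) => -[i _ Fi]; move/negP: H; apply; apply/mem_set.
  by exists i.
Qed.

Lemma trig_approx_lt T : trig_poly T -> (forall x, 0 <= T x <= 1) ->
  measurable [set x | T x < 1 / 2] /\ trig_approx [set x | T x < 1 / 2].
Proof.
move=> tT T01; have [mT _] := trig_poly_bounded tT.
have mE : measurable [set x | T x < 1 / 2].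
  have := mT measurableT `]-oo, (1/2)[%classic (measurable_itv _).
  rewrite setTI; congr measurable; apply/seteqP; split => x /=; rewrite in_itv//.
split => // e e0.
have tth n : trig_poly (fun x => threshold n (T x)).
  apply: trig_polyX; apply: trig_polyB; first exact: trig_poly_cst.
  exact: trig_polyX.
have th01 n x : 0 <= threshold n (T x) <= 1 by exact: threshold_itv.
have [||||n len] := bounded_cvg_integral mQ Qoo (f_ := fun n x => threshold n (T x))
  (f := \1_[set x | T x < 1 / 2]) (M := 1) _ _ _ _ e0.
- by move=> n; have [] := trig_poly_bounded (tth n).
- exact: bounded_measurable_indic.
- by move=> n x; have /andP[? ?] := th01 n x; rewrite ger0_norm.
- move=> x _; rewrite indicE (_ : (x \in _) = (T x < 1 / 2)); first exact: cvg_threshold.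
  by apply/idP/idP => [/set_mem//|H]; apply/mem_set.
exists (fun x => threshold n (T x)); split => //.
apply: le_trans len; rewrite le_eqVlt; apply/orP; left; apply/eqP.
by apply: eq_Rintegral => x _; rewrite distrC.
Qed.

(** Inside the cube the half-space is an arc of the circle in coordinate [i], and an arc is a
    superlevel set of a translated cosine. *)
Lemma trig_approx_entry (i : 'I_d) (a : R) :
  trig_approx [set x : 'cV[R]_d | x i ord0 <= a].
Proof.
have [a1|a1] := ltP a (- (1 / 2)).
  apply: trig_approx_eq trig_approx0; apply/seteqP; split => x [] //= xa /(_ i).
  by move=> /andP[h _]; have := le_lt_trans (le_trans h xa) a1; rewrite ltxx.
have [a2|a2] := leP (1 / 2) a.
  apply: (@trig_approx_eq setT); last by rewrite -setC0; exact: trig_approxC trig_approx0.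
  apply/seteqP; split => x [] //= _ Qx; split => //.
  by have /andP[_ /ltW h] := Qx i; exact: le_trans a2.
(* Midpoint and half-length of the arc [[-1/2, a]]. *)
pose b : R := (a - 1 / 2) / 2; pose r : R := (a + 1 / 2) / 2.
pose ei : 'cV[int]_d := delta_mx i ord0.
have dei x : dotv (zr ei) x = x i ord0.
  rewrite /dotv (bigD1 i)//= big1; last first.
    by move=> j ji; rewrite !mxE (negbTE ji) mul0r.
  by rewrite !mxE !eqxx mul1r addr0.
pose f x : R := cos (2 * pi * (x i ord0 - b)).
pose th : R := cos (2 * pi * r).
have tf : trig_poly f.
  have := @trig_poly1 R d ei (cos (2 * pi * b)) (sin (2 * pi * b)).
  congr trig_poly; apply/funext => x; rewrite /f /cosz /sinz dei mulrBr cosB.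
  by congr (_ + _); exact: mulrC.
(* As [f] and [th] lie in [[-1, 1]], the factor 1/4 keeps the values in [[0, 1]]; they drop below
   1/2 exactly when [f < th], that is, off the arc. *)
have tT : trig_poly (fun x => 1 / 2 + 4^-1 * (f x - th)).
  apply: trig_polyD; first exact: trig_poly_cst.
  apply: trig_polyM; first exact: trig_poly_cst.
  by apply: trig_polyB => //; exact: trig_poly_cst.
have T01 x : 0 <= 1 / 2 + 4^-1 * (f x - th) <= 1.
  have := cos_geN1 (2 * pi * (x i ord0 - b)); have := cos_le1 (2 * pi * (x i ord0 - b)).
  have := cos_geN1 (2 * pi * r); have := cos_le1 (2 * pi * r).
  by rewrite /f /th; lra.
have [mE aE] := trig_approx_lt tT T01.
apply: trig_approx_eq (trig_approxC mE aE).
have pi0 : 0 < pi :> R := pi_gt0 R.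
have r0 : 0 <= r < 1 / 2 by rewrite /r; lra.
(* Cosine is monotone only on [[0, pi]], so [y] is first folded into [[0, 1/2]] by evenness and
   periodicity. *)
have cr (y : R) : - r <= y < 1 - r -> (th <= cos (2 * pi * y)) = (y <= r).
  move=> /andP[y1 y2].
  have key (u : R) : 0 <= u <= 1 / 2 -> (th <= cos (2 * pi * u)) = (u <= r).
    move=> u0; rewrite /th leNgt ltr_cos ?in_itv /=; last 2 first.
    - by apply/andP; split; nra.
    - by apply/andP; split; nra.
    by rewrite ltr_pM2l ?mulr_gt0// -leNgt.
  have [y0|y0] := leP 0 y; last first.
    rewrite -cosN -mulrN key; last lra.
    by rewrite lerNl y1; apply/esym; apply/idP; lra.
  have [yh|yh] := leP y (1 / 2); first by rewrite key// y0.
  have -> : cos (2 * pi * y) = cos (2 * pi * (1 - y)).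
    have -> : 2 * pi * (1 - y) = - (2 * pi * y) + pi *+ 2 by rewrite -mulr_natl; ring.
    by rewrite cosD2pi cosN.
  rewrite key; last lra.
  by apply/idP/idP; lra.
have E x : Q x -> ~ (1 / 2 + 4^-1 * (f x - th) < 1 / 2) <-> x i ord0 <= a.
  move=> Qx; have /andP[q1 q2] := Qx i.
  have := cr (x i ord0 - b); rewrite -/(f x) => H.
  have {}H : (th <= f x) = (x i ord0 - b <= r).
    by apply: H; rewrite /b /r; apply/andP; split; lra.
  have -> : (x i ord0 <= a) = (th <= f x).
    by rewrite H /b /r; apply/idP/idP; lra.
  split; first by move=> /negP; rewrite -leNgt; lra.
  by move=> h; apply/negP; rewrite -leNgt; lra.
by apply/seteqP; split => x [H Qx]; split => //; apply/(E x Qx).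
Qed.

(** The approximable Borel sets form a sigma-algebra, so it is enough to treat the cylinders that
    generate the Borel sets. *)
Lemma trig_approx_borel E : measurable E -> trig_approx E.
Proof.
pose S := [set E | measurable E /\ trig_approx E].
have SS : sigma_algebra setT S.
  split.
  - by split; [exact: measurable0|exact: trig_approx0].
  - move=> A [mA aA]; rewrite setTD; split; first exact: measurableC.
    exact: trig_approxC.
  - move=> F HF; split; first by apply: bigcupT_measurable => n; have [] := HF n.
    by apply: trig_approx_bigcup => n; have [] := HF n.
move=> mE; suff : S E by case.
apply: (smallest_sub SS _ mE) => _ [[i j] _ [B mB <-]]; rewrite setTI /=.
rewrite (ord1 j) => {j}.
(* Minimality is used a second time, for one fixed coordinate, to pass from an arbitrary Borel set
   of reals to open rays, whose complements are the half-spaces already treated. *)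
pose SB := [set B : set R | S ((fun M : 'cV[R]_d => M i ord0) @^-1` B)].
have SSB : sigma_algebra setT SB.
  have [S0 SC SU] := SS; split.
  - by rewrite /SB /= preimage_set0.
  - by move=> A; rewrite /SB /= => /SC; rewrite !setTD.
  - by move=> F HF; rewrite /SB /= preimage_bigcup; exact: SU.
have : (@RGenOInfty.G R).-sigma.-measurable B by rewrite -RGenOInfty.measurableE.
apply: (smallest_sub SSB) => _ [a ->]; have [_ SC _] := SS.
have := SC [set x : 'cV[R]_d | x i ord0 <= a]; rewrite setTD /SB /=.
have -> : ~` [set x : 'cV[R]_d | x i ord0 <= a] =
   (fun M : 'cV[R]_d => M i ord0) @^-1` `]a, +oo[%classic.
  by apply/seteqP; split => x /=; rewrite in_itv /= andbT ltNge; move/negP.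
apply; split; last exact: trig_approx_entry.
have := @measurable_preimage _ _ _ _ _ `]-oo, a]%classic (measurable_entry i (ord0 : 'I_1)) (measurable_itv _).
by congr measurable; apply/seteqP; split => x /=; rewrite in_itv.
Qed.

(** Indicators are approximated one at a time, with [(p + q)^2 <= 2 p^2 + 2 q^2]; the new error [p]
    satisfies [|p| <= 1], so [p^2 <= |p|] and its L^1 bound suffices. *)
Lemma trig_approx_L2 J (s : seq J) (E : J -> set 'cV[R]_d) (c : R) (e : R) :
  (forall j, measurable (E j)) -> 0 < e ->
  exists2 T, trig_poly T &
    I (fun x => (\sum_(j <- s) \1_(E j) x - c - T x) ^+ 2) <= e.
Proof.
move=> mE; elim: s e => [|j s IH] e e0.
  exists (fun=> - c); first exact: trig_poly_cst.
  under eq_Rintegral do rewrite big_nil sub0r subrr expr0n.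
  by rewrite integral_cst_cube ltW.
have e40 : 0 < e / 4 by rewrite divr_gt0.
have [T tT leT] := IH _ e40; have [S [tS S01 leS]] := trig_approx_borel (mE j) e40.
exists (fun x => S x + T x); first exact: trig_polyD.
have bsum : bounded_measurable (fun x => \sum_(j <- s) \1_(E j) x - c - T x).
  apply: bounded_measurableB; last exact: trig_poly_bounded.
  apply: bounded_measurableB; last exact: bounded_measurable_cst.
  by apply: bounded_measurable_sum => i; exact: bounded_measurable_indic.
have b1 := bmd (mE j) tS.
have b2 := bounded_measurableX 2 bsum.
have -> : e = 2 * (e / 4 + e / 4) by field.
apply: (@le_trans _ _ (2 * (I (fun x => `|\1_(E j) x - S x|) +
   I (fun x => (\sum_(j <- s) \1_(E j) x - c - T x) ^+ 2)))); last first.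
  by apply: ler_wpM2l => //; exact: lerD.
rewrite -bounded_integralD// -bounded_integralZ//; last exact: bounded_measurableD.
apply: bounded_le_integral => //.
- apply: bounded_measurableX; apply: bounded_measurableB; last first.
    by apply: trig_poly_bounded; exact: trig_polyD.
  apply: bounded_measurableB; last exact: bounded_measurable_cst.
  by apply: bounded_measurable_sum => i; exact: bounded_measurable_indic.
- by apply: bounded_measurableZ; exact: bounded_measurableD.
move=> x _; rewrite big_cons.
set A := \sum_(_ <- _) _.
have /andP[s0 s1] := S01 x.
have sq : (\1_(E j) x - S x) ^+ 2 <= `|\1_(E j) x - S x|.
  rewrite -real_normK ?num_real// expr2 ler_piMl// ler_norml indicE.
  by case: (_ \in _) => /=; lra.
have -> : \1_(E j) x + A - c - (S x + T x) = (\1_(E j) x - S x) + (A - c - T x) by ring.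
set p := \1_(E j) x - S x in sq *; set q := A - c - T x.
have := sqr_ge0 (p - q); rewrite expr2 => h.
by nra.
Qed.

(* The half of Parseval's identity that expresses completeness. *)
Lemma parseval_le J (s : seq J) (E : J -> set 'cV[R]_d) (c : R) (e : R)
    (f := fun x => \sum_(j <- s) \1_(E j) x - c) :
  (forall j, measurable (E j)) -> 0 < e ->
  exists m, I (fun x => f x ^+ 2) <=
    \sum_(k <- zbox d m) (coefc f k ^+ 2 + coefs f k ^+ 2) + e.
Proof.
move=> mE e0; have [_ [S ->] le] := trig_approx_L2 s c mE e0.
have [m Hm] := zbox_cover [seq u.1.1 | u <- S].
have bf : bounded_measurable f.
  apply: bounded_measurableB; last exact: bounded_measurable_cst.
  by apply: bounded_measurable_sum => i; exact: bounded_measurable_indic.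
have SK u : u \in S -> u.1.1 \in zbox d m.
  by move=> uS; apply: Hm; apply/mapP; exists u.
by exists m; rewrite (le_trans (bessel_le bf SK))// lerD2l.
Qed.

End trigonometric_approximation.

(** * Fourier coefficients of the discrepancy *)

Section discrepancy_fourier.
Context {R : realType} {d : nat}.
Local Notation lam := (@borel_lebesgue R d).
Local Notation Q := (unit_cube R d).
Local Notation zr k := (map_mx intr k : 'cV[R]_d).
Local Notation I f := (\int[lam]_(x in Q) f x).
Implicit Types (x y t : 'cV[R]_d) (k l : 'cV[int]_d).

Let mQ : measurable Q := measurable_unit_cube.
Let Qoo : (lam Q < +oo)%E.
Proof. by rewrite borel_lebesgue_unit_cube ltry. Qed.

Lemma bounded_set_lty (E : set 'cV[R]_d) m : measurable E ->
  (forall x, E x -> forall i, `|x i ord0| <= m%:R) -> (lam E < +oo)%E.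
Proof.
move=> mE Em.
have sub : E `<=` [set x : 'cV[R]_d | forall i, - m%:R <= x i ord0 < m%:R + 1].
  by move=> x Ex i; have := Em x Ex i; rewrite ler_norml => /andP[? ?]; apply/andP; split; lra.
apply: (@le_lt_trans _ _ (((m%:R + 1 - - m%:R) ^+ d)%:E)); last exact: ltry.
rewrite -borel_lebesgue_cube; last by have := ler0n R m; lra.
by apply: le_measure => //; rewrite inE//; exact: measurable_cube.
Qed.

Lemma integral_shift (E : set 'cV[R]_d) t (f : 'cV[R]_d -> \bar R) :
  measurable E -> measurable_fun setT f ->
  (\int[lam]_(x in (fun x => t + x)%R @^-1` E) f x = \int[lam]_(x in E) f (x - t)%R)%E.
Proof.
move=> mE.
have ge0 (g : 'cV[R]_d -> \bar R) : measurable_fun setT g -> (forall x, 0 <= g x)%E ->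
  (\int[lam]_(x in (fun x => t + x)%R @^-1` E) g x = \int[lam]_(x in E) g (x - t)%R)%E.
  move=> mg g0; rewrite integral_mkcond [RHS]integral_mkcond.
  have mgt : measurable_fun setT (fun x => g (x - t)%R).
    exact: (measurableT_comp mg (measurable_addv (- t))).
  rewrite -[RHS](@ge0_integral_translate _ _ t).
  - apply: eq_integral => x _; rewrite !patchE addrK; congr (if _ then _ else _).
    by apply/idP/idP => /set_mem H; apply/mem_set; rewrite /= addrC.
  - by apply/(measurable_restrictT _ mE); exact: measurable_funTS.
  - by move=> x; rewrite patchE; case: ifP.
move=> mf; rewrite integralE [RHS]integralE !ge0//.
- by congr (_ - _)%E; apply: eq_integral => x _; rewrite ?funeposE ?funenegE.
- exact: measurable_funeneg.
- exact: measurable_funepos.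
Qed.

(** Signed [h] is reduced to the nonnegative case by adding [|M|], which is itself periodic. *)
Lemma bounded_integral_unfold (E : set 'cV[R]_d) m (h : 'cV[R]_d -> R) :
  measurable E -> (forall x, E x -> forall i, `|x i ord0| <= m%:R) ->
  bounded_measurable h -> (forall x k, h (x + zr k) = h x) ->
  \int[lam]_(x in E) h x = I (fun x => \sum_(k <- zbox d m) \1_E (x + zr k) * h x).
Proof.
move=> mE Em.
have Eoo := bounded_set_lty mE Em.
have bsum (g : 'cV[R]_d -> R) : bounded_measurable g ->
    bounded_measurable (fun x => \sum_(k <- zbox d m) \1_E (x + zr k) * g x).
  move=> bg; apply: bounded_measurable_sum => k; apply: bounded_measurableM => //.
  have [mi [M iM]] := @bounded_measurable_indic R _ _ _ mE.
  split; last by exists M.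
  exact: (measurableT_comp mi (measurable_addv (zr k))).
have ge0 (g : 'cV[R]_d -> R) : bounded_measurable g ->
    (forall x k, g (x + zr k) = g x) -> (forall x, 0 <= g x) ->
    \int[lam]_(x in E) g x = I (fun x => \sum_(k <- zbox d m) \1_E (x + zr k) * g x).
  move=> bg gp g0; congr fine.
  transitivity (\int[lam]_x ((\1_E x * g x)%:E))%E.
    rewrite integral_mkcond; apply: eq_integral => x _; rewrite patchE indicE.
    by case: ifP => _; rewrite ?mul1r ?mul0r.
  rewrite (@ge0_integral_unfold _ _ m).
  - by apply: eq_integral => x _; rewrite sumEFin; under eq_bigr do rewrite gp.
  - apply/measurable_EFinP; apply: measurable_funM; first exact: measurable_indic.
    by case: bg.
  - by move=> x; rewrite lee_fin mulr_ge0// indicE.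
  - move=> x; rewrite indicE; have [/set_mem/Em//|] := boolP (x \in E).
    by rewrite mul0r eqxx.
move=> bh hp; have [_ [M hM]] := bh.
have bM := @bounded_measurable_cst R _ 'cV[R]_d `|M|.
have bhM := bounded_measurableD bh bM.
have -> : h = (fun x => (h x + `|M|) - `|M|) by apply/funext => x; rewrite addrK.
rewrite bounded_integralB// ge0//; last 2 first.
- by move=> x k; rewrite hp.
- move=> x; have := hM x; rewrite ler_norml => /andP[h1 h2].
  by have := ler_norm M; lra.
rewrite (ge0 (fun=> `|M|))// -bounded_integralB//; [|exact: bsum|exact: bsum].
apply: eq_Rintegral => x _; rewrite -sumrB; apply: eq_bigr => k _; ring.
Qed.

Lemma periodized_indicE (E : set 'cV[R]_d) m n x :
  (forall x, E x -> forall i, `|x i ord0| <= m%:R) ->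
  (forall i, `|x i ord0| <= n%:R) ->
  periodized_indic E x = \sum_(k <- zbox d (m + n)) \1_E (x + zr k).
Proof.
move=> Em xn; rewrite /periodized_indic (fsbig_seq _ _ (zbox_uniq d (m + n))).
apply/esym/fsbig_widen => // k [_ /= kz]; rewrite indicE memNset// => Ek.
apply: kz; apply/mem_zbox => i; rewrite -(ler_int R) intr_norm.
have := Em _ Ek i; rewrite !mxE => h.
have -> : (k i ord0)%:~R = (x i ord0 + (k i ord0)%:~R) - x i ord0 by ring.
by rewrite -pmulrn natrD (le_trans (ler_normB _ _))// lerD.
Qed.

Lemma shift_cube_bounded N (z : 'I_N -> 'cV[R]_d) : exists n, forall j x, Q x -> forall i, `|(z j + x) i ord0| <= n%:R.
Proof.
have [n Hn] : exists n : nat, forall j i, `|(z j) i ord0| <= n%:R.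
  have [n_ Hn] := choice (fun j => cV_bounded (z j)).
  exists (\sum_j n_ j)%N => j i; rewrite (le_trans (Hn j i))// ler_nat.
  by rewrite (bigD1 j)//= leq_addr.
exists n.+1 => j x Qx i; rewrite mxE -natr1 (le_trans (ler_normD _ _))// lerD//.
by have /andP[q1 q2] := Qx i; rewrite ler_norml; apply/andP; split; lra.
Qed.

Section fixed_set.
Variables (E : set 'cV[R]_d) (m N : nat) (z : 'I_N -> 'cV[R]_d).
Hypotheses (mE : measurable E) (Em : forall x, E x -> forall i, `|x i ord0| <= m%:R).

Let F k := \int[lam]_(x in E) cosz k x.
Let G k := \int[lam]_(x in E) sinz k x.
Let Eoo := bounded_set_lty mE Em.

Let shift j := (fun x => z j + x) @^-1` E.

Let mshift j : measurable (shift j).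
Proof.
apply: measurable_preimage => //.
by have := measurable_addv (z j); congr measurable_fun; apply/funext => x; rewrite addrC.
Qed.

(** The coefficients of the discrepancy are those of [E] multiplied by exponential sums over the
    points, which equal [N] on [L] and vanish elsewhere; at frequency 0 the term [N |E|] cancels.
    The error [e] and the cutoff [n] come from the polynomial approximation. *)
Lemma discrepancy_L2_le (L : pred 'cV[int]_d) (e : R) :
  (forall k, \sum_(j < N) cosz k (z j) = N%:R * (L k)%:R) ->
  (forall k, \sum_(j < N) sinz k (z j) = 0) -> 0 < e ->
  exists n, I (fun x => (\sum_(j < N) periodized_indic E (z j + x) -
                         N%:R * fine (lam E)) ^+ 2) <=
    N%:R ^+ 2 * \sum_(k <- zbox d n | L k && (k != 0)) (F k ^+ 2 + G k ^+ 2) + e.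
Proof.
move=> zc zs e0; have [n zb] := shift_cube_bounded z.
have [n' zb'] : exists n' : nat, forall j x, shift j x -> forall i, `|x i ord0| <= n'%:R.
  have [n_ Hn] := choice (fun j => cV_bounded (z j)).
  exists (m + \sum_j n_ j)%N => j x /Em H i; have := H i; rewrite mxE => h.
  have -> : x i ord0 = (z j i ord0 + x i ord0) - z j i ord0 by ring.
  rewrite natrD (le_trans (ler_normB _ _))// lerD// (le_trans (Hn j i))// ler_nat.
  by rewrite (bigD1 j)//= leq_addr.
(* [m + n] suffices for the periodization of [E] at the points [z j + x], and [n'] for unfolding
   integrals over the translates [shift j]. *)
pose M := maxn (m + n) n'.
pose s := [seq (j, k) | j <- enum 'I_N, k <- zbox d M].
(* Indexing by pairs writes the periodized count as one finite sum of indicators, the form that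
   [parseval_le] accepts. *)
pose EE (p : 'I_N * 'cV[int]_d) : set 'cV[R]_d := (fun x => x + zr p.2) @^-1` shift p.1.
pose c := N%:R * fine (lam E).
have sE (h : 'I_N -> 'cV[int]_d -> R) :
    \sum_(p <- s) h p.1 p.2 = \sum_(j < N) \sum_(k <- zbox d M) h j k.
  by rewrite /s big_allpairs_dep big_enum.
have mEE p : measurable (EE p).
  by apply: measurable_preimage => //; exact: measurable_addv.
pose f x := \sum_(p <- s) \1_(EE p) x - c : R.
have per0 j x : Q x -> periodized_indic E (z j + x) = \sum_(k <- zbox d M) \1_(EE (j, k)) x.
  move=> Qx; have Qx' : forall i, `|(z j + x) i ord0| <= (M - m)%:R.
    by move=> i; rewrite (le_trans (zb _ _ Qx i))// ler_nat /M; lia.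
  rewrite (periodized_indicE Em Qx') subnKC ?/M; last by lia.
  by apply: eq_bigr => k _; rewrite !indicE /EE /shift /= -addrA.
have DE : I (fun x => (\sum_(j < N) periodized_indic E (z j + x) - c) ^+ 2) =
          I (fun x => f x ^+ 2).
  apply: eq_Rintegral => x /set_mem Qx; congr (_ ^+ 2); congr (_ - _).
  by rewrite (sE (fun j k => \1_(EE (j, k)) x)); apply: eq_bigr => j _; exact: per0.
have [k0 le] := parseval_le s c mEE e0.
exists k0; rewrite -/c DE; apply: le_trans le _; rewrite lerD2r.
have bI p : bounded_measurable (\1_(EE p) : _ -> R) by exact: bounded_measurable_indic.
(* By unfolding, pairing a periodized indicator with a periodic [h] over the cube amounts to
   integrating [h] over a translate of [E]. *)
have coefE (h : 'cV[R]_d -> R) : bounded_measurable h ->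
    (forall x k, h (x + zr k) = h x) ->
    I (fun x => f x * h x) =
    \sum_(j < N) \int[lam]_(x in E) h (x - z j) - c * I h.
  move=> bh hp.
  have bj j : bounded_measurable (fun x => \sum_(k <- zbox d M) \1_(EE (j, k)) x * h x).
    by apply: bounded_measurable_sum => k; exact: bounded_measurableM.
  rewrite -bounded_integralZ//.
  transitivity (I (fun x => \sum_(j < N) \sum_(k <- zbox d M) \1_(EE (j, k)) x * h x - c * h x)).
    apply: eq_Rintegral => x _; rewrite /f mulrBl; congr (_ - _).
    rewrite (sE (fun j k => \1_(EE (j, k)) x)) mulr_suml.
    by apply: eq_bigr => j _; rewrite mulr_suml.
  rewrite bounded_integralB//; last 2 first.
  - by apply: bounded_measurable_sum.
  - exact: bounded_measurableZ.
  rewrite bounded_integral_sum//; congr (_ - _); apply: eq_bigr => j _.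
  transitivity (\int[lam]_(x in shift j) h x).
    have zM x : shift j x -> forall i, `|x i ord0| <= M%:R.
      by move=> /zb' H i; rewrite (le_trans (H i))// ler_nat /M; lia.
    rewrite (bounded_integral_unfold (mshift j) zM bh hp).
    by apply: eq_Rintegral => x _; apply: eq_bigr => k _; rewrite !indicE.
  congr fine; rewrite /shift (@integral_shift E (z j) (EFin \o h))//.
  by apply/measurable_EFinP; case: bh.
have FE k j : \int[lam]_(x in E) cosz k (x - z j) =
              cosz k (z j) * F k + sinz k (z j) * G k.
  rewrite /F /G -!bounded_integralZ//; [|exact: bounded_measurable_sinz|exact: bounded_measurable_cosz].
  rewrite -bounded_integralD//; [|exact/bounded_measurableZ/bounded_measurable_cosz|exact/bounded_measurableZ/bounded_measurable_sinz].
  apply: eq_Rintegral => x _; rewrite coszD.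
  have -> : cosz k (- z j) = cosz k (z j) by rewrite -[in RHS]coszN /cosz zrN dotvNl dotvC dotvNl dotvC.
  have -> : sinz k (- z j) = - sinz k (z j) by rewrite -[in RHS]sinzN /sinz zrN dotvNl dotvC dotvNl dotvC.
  ring.
have GE k j : \int[lam]_(x in E) sinz k (x - z j) =
              cosz k (z j) * G k - sinz k (z j) * F k.
  rewrite /F /G -!bounded_integralZ//; [|exact: bounded_measurable_cosz|exact: bounded_measurable_sinz].
  rewrite -bounded_integralB//; [|exact/bounded_measurableZ/bounded_measurable_sinz|exact/bounded_measurableZ/bounded_measurable_cosz].
  apply: eq_Rintegral => x _; rewrite sinzD.
  have -> : cosz k (- z j) = cosz k (z j) by rewrite -[in RHS]coszN /cosz zrN dotvNl dotvC dotvNl dotvC.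
  have -> : sinz k (- z j) = - sinz k (z j) by rewrite -[in RHS]sinzN /sinz zrN dotvNl dotvC dotvNl dotvC.
  ring.
have cc k : coefc f k = N%:R * (L k)%:R * F k - c * (k == 0)%:R.
  rewrite /coefc coefE; [|exact: bounded_measurable_cosz|exact: cosz_periodic].
  rewrite integral_cosz; congr (_ - _); under eq_bigr do rewrite FE.
  by rewrite big_split /= -!mulr_suml zc zs mul0r addr0.
have cs k : coefs f k = N%:R * (L k)%:R * G k.
  rewrite /coefs coefE; [|exact: bounded_measurable_sinz|exact: sinz_periodic].
  rewrite integral_sinz mulr0 subr0; under eq_bigr do rewrite GE.
  by rewrite sumrB /= -!mulr_suml zc zs mul0r subr0.
have F0 : F 0 = fine (lam E).
  rewrite /F; under eq_Rintegral do rewrite cosz0.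
  by rewrite Rintegral_cst// mul1r.
have G0 : G 0 = 0.
  rewrite /G; under eq_Rintegral do rewrite sinz0.
  by rewrite Rintegral_cst// mul0r.
(* Membership of 0 in [L] is read off from [zc] at frequency 0; the product form also covers
   [N = 0]. *)
have L0 : N%:R * (L 0)%:R = N%:R :> R.
  by rewrite -zc; under eq_bigr do rewrite cosz0; rewrite sumr_const card_ord.
rewrite [in leRHS]big_mkcond mulr_sumr; apply: ler_sum => k _; rewrite cc cs.
have [->|k0'] := eqVneq k 0.
  by rewrite andbF F0 G0 L0 /c mulr1 subrr mulr0 expr0n !mulr0 addr0.
rewrite andbT mulr0 subr0; case: (L k); rewrite ?mulr1 ?mulr0 ?mul0r.
  by rewrite !exprMn mulrDr.
by rewrite expr0n addr0.
Qed.

End fixed_set.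
End discrepancy_fourier.

(** * Integration over rotations *)

Section integrated_discrepancy.
Context {R : realType} {d : nat}.
Local Notation lam := (@borel_lebesgue R d).
Local Notation Q := (unit_cube R d).
Local Notation zr k := (map_mx intr k : 'cV[R]_d).
Local Notation I f := (\int[lam]_(x in Q) f x).
Implicit Types (x y : 'cV[R]_d) (k l : 'cV[int]_d) (s : 'M[R]_d).

(** An entry is bounded by the Euclidean norm, which [s] preserves; the resulting bound is the same
    for all rotations. *)
Lemma rotate_bounded s (E : set 'cV[R]_d) : s^T *m s = 1%:M -> E `<=` Q ->
  forall x, rotate s E x -> forall i, `|x i ord0| <= d%:R.
Proof.
move=> ss EQ _ [x Ex <-] i; set y := s *m x.
have d1 : 1 <= d%:R :> R by rewrite ler1n; case: i {y} => ? /=; lia.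
have yy : (y i ord0) ^+ 2 <= d%:R ^+ 2.
  apply: (@le_trans _ _ (dotv y y)).
    rewrite /dotv (bigD1 i)//= -expr2 lerDl; apply: sumr_ge0 => j _.
    by rewrite -expr2 sqr_ge0.
  rewrite dotv_orth// /dotv (@le_trans _ _ (\sum_(i < d) 1))//.
    apply: ler_sum => j _; have /andP[q1 q2] := EQ x Ex j; nra.
  by rewrite sumr_const card_ord expr2 ler_peMl// ler0n.
rewrite -ler_sqr ?nnegrE ?ler0n//.
by rewrite real_normK ?num_real.
Qed.

Lemma normc_sqr (a b : R) : Normc.normc (Complex a b) ^+ 2 = a ^+ 2 + b ^+ 2.
Proof. by rewrite /= sqr_sqrtr// addr_ge0 ?sqr_ge0. Qed.

Lemma ler_sum_sub (T : eqType) (s1 s2 : seq T) (P : pred T) (F : T -> R) :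
  uniq s1 -> uniq s2 -> {subset s1 <= s2} -> (forall t, 0 <= F t) ->
  \sum_(t <- s1 | P t) F t <= \sum_(t <- s2 | P t) F t.
Proof.
move=> u1 u2 s12 F0.
have p : perm_eq s1 [seq t <- s2 | t \in s1].
  apply: uniq_perm => //; first exact: filter_uniq.
  by move=> t; rewrite mem_filter; have [/s12 ->|] := boolP (t \in s1).
rewrite (perm_big _ p) big_filter_cond [leRHS]big_mkcond [leLHS]big_mkcond /=.
by apply: ler_sum => t _; case: (t \in s1); case: (P t) => /=.
Qed.

Variables (Omega B Z : set 'cV[R]_d).
Hypotheses (OQ : Omega `<=` Q) (BQ : B `<=` Q) (mB : measurable B)
  (mZ : measurable Z) (Z0 : lam Z = 0%E)
  (OB : forall x, ~ Z x -> (Omega x <-> B x)).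

Let rot_version s : s^T *m s = 1%:M ->
  forall x, ~ rotate s Z x -> (rotate s Omega x <-> rotate s B x).
Proof.
by move=> ss x; rewrite !rotateE// => nZ; exact: OB.
Qed.

Let Foc s k : R := \int[lam]_(x in B) cosz k (s *m x).
Let Fos s k : R := \int[lam]_(x in B) sinz k (s *m x).

Let integral_rot s (h : 'cV[R]_d -> R) : s^T *m s = 1%:M -> bounded_measurable h ->
  \int[lam]_(x in rotate s B) h x = \int[lam]_(x in B) h (s *m x).
Proof.
move=> ss [mh _]; congr fine.
by apply: (@integral_rotate R d s B (EFin \o h)) => //; exact/measurable_EFinP.
Qed.

Let fourier_version s k : s^T *m s = 1%:M ->
  Normc.normc (fourier_indic (rotate s Omega) (zr k)) ^+ 2 = Foc s k ^+ 2 + Fos s k ^+ 2.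
Proof.
move=> ss; rewrite /fourier_indic normc_sqr sqrrN.
have E (h : 'cV[R]_d -> R) : bounded_measurable h ->
    \int[leb]_(x in rotate s Omega) h x = \int[lam]_(x in B) h (s *m x).
  move=> bh; rewrite -integral_rot//; have [mh _] := bh; congr fine.
  apply: (@integral_version R d _ (rotate s B) (rotate s Z) _ _ _ _ (EFin \o h)).
  - exact: measurable_rotate.
  - exact: measurable_rotate.
  - by rewrite borel_lebesgue_rotate.
  - exact: rot_version.
  - exact/measurable_EFinP.
by rewrite !E//; [exact: bounded_measurable_sinz|exact: bounded_measurable_cosz].
Qed.

Let Boo : (lam B < +oo)%E.
Proof.
apply: le_lt_trans (ltry 1); rewrite -(@borel_lebesgue_unit_cube R d).
by apply: le_measure => //; rewrite inE//; exact: measurable_unit_cube.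
Qed.

(** Adding [|M|] makes the integrand nonnegative, so that Tonelli gives measurability of the inner
    integral in [s]; the added constant is then subtracted. *)
Lemma measurable_fun_coef (h : 'cV[R]_d -> R) : bounded_measurable h ->
  measurable_fun setT (fun s : 'M[R]_d => \int[lam]_(x in B) h (s *m x)).
Proof.
move=> bh; have [mh [M hM]] := bh.
pose g (p : 'M[R]_d * 'cV[R]_d) : \bar R := (((h (p.1 *m p.2) + `|M|) * \1_B p.2)%:E).
have mg : measurable_fun setT g.
  apply/measurable_EFinP; apply: measurable_funM.
    apply: measurable_funD; last exact: measurable_cst.
    exact: (measurableT_comp mh (@measurable_mulmxv R d)).
  exact: (measurableT_comp (measurable_indic mB) measurable_snd).
have g0 p : (0 <= g p)%E.
  rewrite lee_fin mulr_ge0//.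
  have := hM (p.1 *m p.2); rewrite ler_norml => /andP[h1 h2].
  by have := ler_norm M; lra.
have := measurable_fun_fubini_tonelli_F (m2 := lam) g mg g0.
rewrite /fubini_F => mF.
have -> : (fun s => \int[lam]_(x in B) h (s *m x)) =
          (fun s => fine (\int[lam]_y g (s, y))%E - `|M| * fine (lam B)).
  apply/funext => s.
  have bs : bounded_measurable (fun x => h (s *m x)).
    by split; [exact: (measurableT_comp mh (measurable_mulmx_const s))|exists M].
  have -> : (\int[lam]_y g (s, y))%E =
            (\int[lam]_(x in B) (h (s *m x) + `|M|)%:E)%E.
    rewrite [RHS]integral_mkcond; apply: eq_integral => x _.
    rewrite patchE /g /= ?indicE; case: ifP => _; rewrite ?mulr1 ?mulr0//.
  have := bounded_integralD mB Boo bs (bounded_measurable_cst `|M|).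
  rewrite /Rintegral => ->; rewrite -/(Rintegral _ _ _) -/(Rintegral _ _ _).
  by rewrite (Rintegral_cst lam mB) addrK.
apply: measurable_funB; last exact: measurable_cst.
exact: (measurableT_comp (fine_measurable measurableT) mF).
Qed.

Variables (N : nat) (z : 'I_N -> 'cV[R]_d) (L : pred 'cV[int]_d).
Hypotheses (zc : forall k, \sum_(j < N) cosz k (z j) = N%:R * (L k)%:R)
  (zs : forall k, \sum_(j < N) sinz k (z j) = 0).

(** The two discrepancies differ only where some [z j + x + k] falls in [rotate s Z]. Only finitely
    many pairs [(j, k)] occur for [x] in the cube, so this exceptional set [W] is a finite union of
    null translates. *)
Let disc_version s : s^T *m s = 1%:M ->
  (\int[leb]_(x in Q) ((discrepancy Omega z x s) ^+ 2)%:E <=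
   (I (fun x => (\sum_(j < N) periodized_indic (rotate s B) (z j + x) -
                 N%:R * fine (lam (rotate s B))) ^+ 2))%:E)%E.
Proof.
move=> ss; have [n zb] := shift_cube_bounded z.
pose J := [seq (j, k) | j <- enum 'I_N, k <- zbox d (d + n)].
pose sh (p : 'I_N * 'cV[int]_d) x : 'cV[R]_d := z p.1 + x + zr p.2.
pose f (A : set 'cV[R]_d) x : R :=
  (\sum_(p <- J) \1_A (sh p x) - N%:R * fine (lam B)) ^+ 2.
have perE A x : (forall x, rotate s A x -> forall i, `|x i ord0| <= d%:R) -> Q x ->
    \sum_(j < N) periodized_indic (rotate s A) (z j + x) =
    \sum_(p <- J) \1_(rotate s A) (sh p x) :> R.
  move=> Ad Qx; rewrite /J big_allpairs_dep big_enum; apply: eq_bigr => j _.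
  exact: (periodized_indicE Ad (zb j x Qx)).
have shE p x : sh p x = x + (z p.1 + zr p.2) by rewrite /sh addrAC addrC.
have msh p : measurable_fun setT (sh p).
  by have := measurable_addv (z p.1 + zr p.2); congr measurable_fun;
    apply/funext => x; rewrite shE.
have mrB := measurable_rotate ss mB; have mrZ := measurable_rotate ss mZ.
have bf : bounded_measurable (f (rotate s B)).
  apply: bounded_measurableX; apply: bounded_measurableB; last exact: bounded_measurable_cst.
  apply: bounded_measurable_sum => p.
  have [mi [M iM]] := @bounded_measurable_indic R _ _ _ mrB.
  by split; [exact: (measurableT_comp mi (msh p))|exists M].
have [W [mW W0 JW]] : exists W : set 'cV[R]_d, [/\ measurable W, lam W = 0%E &
    forall p x, p \in J -> ~ W x -> ~ rotate s Z (sh p x)].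
  move: J {f perE bf} => J; elim: J => [|p J [W [mW W0 JW]]]; first by exists set0.
  have mp : measurable (sh p @^-1` rotate s Z) by exact: measurable_preimage.
  exists (W `|` (sh p @^-1` rotate s Z)); split; first exact: measurableU.
    rewrite null_set_setU//.
    have -> : sh p @^-1` rotate s Z = (fun x => x + (z p.1 + zr p.2)) @^-1` rotate s Z.
      by apply/seteqP; split => x /=; rewrite shE.
    by apply: etrans (borel_lebesgue_translate _ mrZ) _; rewrite borel_lebesgue_rotate.
  move=> q x; rewrite inE => /predU1P[->|qJ] nW; first by move=> H; apply: nW; right.
  by apply: JW => // Wx; apply: nW; left.
have mQ := @measurable_unit_cube R d.
have cO : fine (leb Omega) = fine (lam B).
  by congr fine; exact: (leb_version mB mZ Z0 OB).
have -> : (\int[leb]_(x in Q) ((discrepancy Omega z x s) ^+ 2)%:E =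
           \int[leb]_(x in Q) (f (rotate s Omega) x)%:E)%E.
  apply: eq_integral => x /set_mem Qx; rewrite /discrepancy /f cO perE//.
  exact: (rotate_bounded ss OQ).
have -> : I (fun x => (\sum_(j < N) periodized_indic (rotate s B) (z j + x) -
    N%:R * fine (lam (rotate s B))) ^+ 2) = I (f (rotate s B)).
  apply: eq_Rintegral => x /set_mem Qx; rewrite borel_lebesgue_rotate//.
  by rewrite /f perE//; exact: (rotate_bounded ss BQ).
have Qoo : (lam Q < +oo)%E by rewrite borel_lebesgue_unit_cube ltry.
rewrite -(bounded_integral_fin mQ Qoo bf).
apply: (integral_leb_le mQ mW W0) => //.
- by case: bf.
- by move=> x; exact: sqr_ge0.
- by move=> x; exact: sqr_ge0.
move=> x Qx nW; rewrite /f le_eqVlt; apply/orP; left; apply/eqP.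
congr ((_ - _) ^+ 2); apply: eq_big_seq => p pJ.
have := rot_version ss (JW p x pJ nW).
by rewrite !indicE => H; congr ((_ : bool)%:R); apply/idP/idP => /set_mem/H /mem_set.
Qed.

Let h n s : R := \sum_(k <- zbox d n | L k && (k != 0)) (Foc s k ^+ 2 + Fos s k ^+ 2).

Let disc_le s e : s^T *m s = 1%:M -> 0 < e -> exists n,
  (\int[leb]_(x in Q) ((discrepancy Omega z x s) ^+ 2)%:E <=
   (N%:R ^+ 2 * h n s + e)%:E)%E.
Proof.
move=> ss e0.
have [n le] := discrepancy_L2_le (measurable_rotate ss mB) (rotate_bounded ss BQ) zc zs e0.
exists n; apply: le_trans (disc_version ss) _; rewrite lee_fin; apply: le_trans le _.
rewrite lerD2r ler_wpM2l ?sqr_ge0// le_eqVlt; apply/orP; left; apply/eqP.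
by apply: eq_bigr => k _; rewrite !integral_rot//;
  [exact: bounded_measurable_sinz|exact: bounded_measurable_cosz].
Qed.

Variables (haar : probability 'M[R]_d R) (U : set 'M[R]_d).
Hypotheses (mU : measurable U) (U_sub : U `<=` SO R d).

Let Uorth s : U s -> s^T *m s = 1%:M.
Proof. by move/U_sub => -[]. Qed.

Lemma integrated_discrepancy_le (C : R) :
  (forall n, (\sum_(k <- zbox d n | L k && (k != 0%R))
     \int[haar]_(s in U)
       (Normc.normc (fourier_indic (rotate s Omega) (zr k)) ^+ 2)%:E <= C%:E)%E) ->
  (\int[haar]_(s in U) \int[leb]_(x in Q) ((discrepancy Omega z x s) ^+ 2)%:E <=
    (N%:R ^+ 2 * C)%:E)%E.
Proof.
move=> HC.
have N0 : 0 <= N%:R ^+ 2 :> R by exact: sqr_ge0.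
have F0 s k : 0 <= Foc s k ^+ 2 + Fos s k ^+ 2 by rewrite addr_ge0 ?sqr_ge0.
have mF k : measurable_fun setT (fun s => Foc s k ^+ 2 + Fos s k ^+ 2).
  apply: measurable_funD; apply: measurable_funX; apply: measurable_fun_coef.
  - exact: bounded_measurable_cosz.
  - exact: bounded_measurable_sinz.
have h0 n s : 0 <= h n s by apply: sumr_ge0.
have mh n : measurable_fun setT (h n).
  rewrite /h; under eq_fun do rewrite big_mkcond /=.
  by apply: measurable_sum => k; case: (L k && (k != 0)).
have nd s : {homo h^~ s : m n / (m <= n)%N >-> m <= n}.
  by move=> m n mn; apply: ler_sum_sub => //; [exact: zbox_uniq|exact: zbox_uniq|exact: zbox_sub].
pose g n s : \bar R := (N%:R ^+ 2 * h n s)%:E.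
have g0 n s : (0 <= g n s)%E by rewrite lee_fin mulr_ge0.
have ndg s : {homo g^~ s : m n / (m <= n)%N >-> (m <= n)%E}.
  by move=> m n mn; rewrite lee_fin ler_wpM2l// nd.
have mg n : measurable_fun setT (g n).
  by apply/measurable_EFinP; apply: measurable_funM => //; exact: measurable_cst.
(* The cutoff given by [disc_le] depends on [s] and [e]; bounding by the limit over all boxes
   removes this dependence and leaves a measurable majorant. *)
have le1 s : U s -> (\int[leb]_(x in Q) ((discrepancy Omega z x s) ^+ 2)%:E <=
    limn (g^~ s))%E.
  move=> /Uorth ss; apply/lee_addgt0Pr => e e0.
  have [n le] := disc_le ss e0; apply: le_trans le _; rewrite EFinD leeD2r//.
  rewrite (cvg_lim _ (ereal_nondecreasing_cvgn (ndg s)))//.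
  by apply: ereal_sup_ubound; exists n.
apply: (@le_trans _ _ (\int[haar]_(s in U) limn (g^~ s))%E).
  apply: ge0_le_integral_subfun => // s Us.
  by apply: integral_ge0 => x _; rewrite lee_fin sqr_ge0.
rewrite monotone_convergence//; last by move=> n; exact: measurable_funTS.
apply: lime_le.
  apply: ereal_nondecreasing_is_cvgn => m n mn; apply: ge0_le_integral => //.
  - exact: measurable_funTS.
  - exact: measurable_funTS.
  - by move=> s _; exact: ndg.
apply: nearW => n; rewrite /g.
under eq_integral do rewrite EFinM.
rewrite ge0_integralZl_EFin//; last first.
- exact/measurable_EFinP/measurable_funTS.
- by move=> s _; rewrite lee_fin.
rewrite [leRHS]EFinM; apply: lee_wpmul2l; first by rewrite lee_fin.
apply: le_trans (HC n); rewrite le_eqVlt; apply/orP; left; apply/eqP.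
under eq_integral do rewrite /h -sumEFin.
rewrite [LHS](_ : _ = \int[haar]_(s in U) \sum_(k <- [seq k <- zbox d n | L k && (k != 0%R)])
    (Foc s k ^+ 2 + Fos s k ^+ 2)%:E)%E; last first.
  by apply: eq_integral => s _; rewrite big_filter.
rewrite ge0_integral_sum//; last first.
- by move=> k s _; rewrite lee_fin.
- by move=> k; exact/measurable_EFinP/measurable_funTS.
rewrite big_filter; apply: eq_bigr => k _; apply: eq_integral => s /set_mem /Uorth ss.
by rewrite fourier_version.
Qed.

End integrated_discrepancy.

(** * Lattice sums *)

Section lattice_sums.
Context {R : realType}.

(** Telescoping: [(a + mu)^(-2) <= 1/(a (a + mu)) = (1/a - 1/(a + mu)) / mu]. *)
Lemma sum_inv_sqr_nat (A mu : R) m : 0 < mu -> 0 < A ->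
  \sum_(i < m) (A + mu * i.+1%:R) ^- 2 <= (A * mu)^-1.
Proof.
move=> mu0 A0.
suff : \sum_(i < m) (A + mu * i.+1%:R) ^- 2 <= (A^-1 - (A + mu * m%:R)^-1) / mu.
  move/le_trans; apply; rewrite invfM ler_wpM2r ?invr_ge0 ?(ltW mu0)//.
  by rewrite gerBl invr_ge0 addr_ge0 ?(ltW A0)// mulr_ge0 ?(ltW mu0).
elim: m => [|m IH]; first by rewrite big_ord0 mulr0 addr0 subrr mul0r.
rewrite big_ord_recr /= (le_trans (lerD IH (lexx _)))//.
have a0 : 0 < A + mu * m%:R by rewrite ltr_wpDr// mulr_ge0 ?(ltW mu0).
rewrite -natr1 mulrDr mulr1 addrA; move: (A + mu * m%:R) a0 => a a0.
have b0 : 0 < a + mu by rewrite addr_gt0.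
rewrite -lerBrDl.
have -> : (A^-1 - (a + mu)^-1) / mu - (A^-1 - a^-1) / mu = (a * (a + mu))^-1.
  by field; rewrite !gt_eqF.
rewrite lef_pV2 ?posrE ?mulr_gt0 ?exprn_gt0// expr2 ler_pM2r// lerDl ltW//.
Qed.

(** The positive and the negative integers contribute [1/(A mu)] each, and so does [x = 0], because
    [mu <= A]. *)
Lemma sum_inv_sqr_int (A mu : R) (s : seq int) : uniq s ->
  0 < mu -> mu <= A ->
  \sum_(x <- s) (A + mu * `|x|%:~R) ^- 2 <= 3 / (A * mu).
Proof.
move=> us mu0 muA; have A0 : 0 < A by exact: lt_le_trans muA.
pose F (x : int) := (A + mu * `|x|%:~R) ^- 2.
have F0 x : 0 <= F x by rewrite invr_ge0 exprn_ge0// addr_ge0 ?(ltW A0)// mulr_ge0 ?(ltW mu0).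
have [m sm] : exists m, forall x, x \in s -> (absz x < m)%N.
  exists (\sum_(x <- s) absz x).+1%N => x xs.
  by rewrite (big_rem x)//= ltnS leq_addr.
pose r := [:: 0] ++ ([seq Posz i.+1 | i <- iota 0 m] ++ [seq Negz i | i <- iota 0 m]).
have ur : uniq r.
  rewrite /r !cat_uniq /= !map_inj_uniq ?iota_uniq/=; [|by move=> i j []|by move=> i j []].
  rewrite andbT; apply/andP; split.
    by rewrite -all_predC; apply/allP => x; rewrite mem_cat => /orP[|] /mapP[i _ ->].
  by rewrite -all_predC; apply/allP => x /mapP[i _ ->] /=; apply/negP => /mapP[j _].
have sr : {subset s <= r}.
  move=> x /sm; case: x => [[|i]|i] h; rewrite /r !mem_cat ?inE ?eqxx//=.
    apply/orP; left; apply/mapP; exists i => //; rewrite mem_iota /=; move: h => /=; lia.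
  apply/orP; right; apply/mapP; exists i => //; rewrite mem_iota /=; move: h => /=; lia.
apply: le_trans (ler_sum_sub xpredT (F := F) us ur sr F0) _.
rewrite !big_cat big_seq1 /= !big_map.
have E1 : \sum_(i <- iota 0 m) F (Posz i.+1) = \sum_(i < m) (A + mu * i.+1%:R) ^- 2.
  by rewrite -(big_mkord xpredT (fun i => (A + mu * i.+1%:R) ^- 2)) /index_iota subn0.
have E2 : \sum_(i <- iota 0 m) F (Negz i) = \sum_(i < m) (A + mu * i.+1%:R) ^- 2.
  by rewrite -(big_mkord xpredT (fun i => (A + mu * i.+1%:R) ^- 2)) /index_iota subn0.
rewrite E1 ?E2 /F normr0 mulr0 addr0.
have h := sum_inv_sqr_nat m mu0 A0.
have h0 : A ^- 2 <= (A * mu)^-1.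
  by rewrite lef_pV2 ?posrE ?mulr_gt0 ?exprn_gt0// expr2 ler_pM2l.
lra.
Qed.

Lemma sum_inv_expr_int (A mu : R) p (s : seq int) : uniq s ->
  0 < mu -> mu <= A ->
  \sum_(x <- s) (A + mu * `|x|%:~R) ^- p.+2 <= 3 * A ^- p.+1 / mu.
Proof.
move=> us mu0 muA; have A0 : 0 < A by exact: lt_le_trans muA.
apply: (@le_trans _ _ (\sum_(x <- s) A ^- p * (A + mu * `|x|%:~R) ^- 2)).
  apply: ler_sum => x _.
  have a0 : A <= A + mu * `|x|%:~R by rewrite lerDl mulr_ge0 ?(ltW mu0).
  rewrite -addn2 exprD invfM ler_wpM2r ?invr_ge0 ?exprn_ge0 ?(le_trans (ltW A0))//.
  rewrite lef_pV2 ?posrE ?exprn_gt0 ?(lt_le_trans A0)//.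
  by apply: lerXn2r; rewrite ?nnegrE ?(ltW A0) ?(le_trans (ltW A0)).
rewrite -mulr_sumr (le_trans (ler_wpM2l _ (sum_inv_sqr_int us mu0 muA)))//.
  by rewrite invr_ge0 exprn_ge0 ?(ltW A0).
have Ap : A ^+ p != 0 by rewrite expf_neq0// gt_eqF.
by rewrite exprS le_eqVlt; apply/orP; left; apply/eqP; field; rewrite Ap !gt_eqF.
Qed.

Definition cons_at n (j : 'I_n.+1) (x : int) (c : 'cV[int]_n) : 'cV[int]_n.+1 :=
  \col_i oapp (fun i' => c i' ord0) x (unlift j i).

Lemma cons_at_eq n (j : 'I_n.+1) x c : cons_at j x c j ord0 = x.
Proof. by rewrite mxE unlift_none. Qed.

Lemma cons_at_lift n (j : 'I_n.+1) x c i : cons_at j x c (lift j i) ord0 = c i ord0.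
Proof. by rewrite mxE liftK. Qed.

(** A finite family of vectors lies in a product of two finite families, one for coordinate [j] and
    one for the rest; nonnegative terms allow the enlargement, and the sum becomes iterated. *)
Lemma sum_cons_at n (j : 'I_n.+1) (s : seq 'cV[int]_n.+1) (P : pred int)
    (F : 'cV[int]_n.+1 -> R) : uniq s -> (forall c, 0 <= F c) ->
  exists xs cs, [/\ uniq xs, uniq cs &
    \sum_(c <- s | P (c j ord0)) F c <=
    \sum_(x <- xs | P x) \sum_(c <- cs) F (cons_at j x c)].
Proof.
move=> us F0.
pose tl (c : 'cV[int]_n.+1) : 'cV[int]_n := \col_i c (lift j i) ord0.
pose xs := undup [seq (c : 'cV[int]_n.+1) j ord0 | c <- s]; pose cs := undup [seq tl c | c <- s].
exists xs, cs; split; [exact: undup_uniq|exact: undup_uniq|].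
pose r := [seq cons_at j x c | x <- xs, c <- cs].
have ur : uniq r.
  apply: allpairs_uniq; [exact: undup_uniq|exact: undup_uniq|].
  move=> [x c] [y e] _ _ /= E; have -> : x = y.
    by have := congr1 (fun a : 'cV[int]_n.+1 => a j ord0) E; rewrite !cons_at_eq.
  congr pair; apply/colP => i.
  by have := congr1 (fun a : 'cV[int]_n.+1 => a (lift j i) ord0) E; rewrite !cons_at_lift.
have sr : {subset s <= r}.
  move=> c cs'; apply/allpairsP; exists (c j ord0, tl c); split => /=.
  - by rewrite mem_undup; apply/mapP; exists c.
  - by rewrite mem_undup; apply/mapP; exists c.
  - apply/colP => i; case: (unliftP j i) => [i' ->|->].
      by rewrite cons_at_lift mxE.
    by rewrite cons_at_eq.
have le := ler_sum_sub (fun c : 'cV[int]_n.+1 => P (c j ord0)) us ur sr F0.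
apply: le_trans le _.
rewrite /r big_mkcond big_allpairs_dep [leRHS]big_mkcond /=.
apply: ler_sum => x _.
under eq_bigr do rewrite cons_at_eq.
by case: (P x) => //; rewrite big1.
Qed.

(** Discrete analogue of an iterated integral: each coordinate costs one power and a factor
    [3 / mu i]. Once one coordinate is fixed, [A] grows, so [mu i <= A] persists in the
    induction. *)
Lemma sum_inv_expr_vec n (mu : 'I_n -> R) (A : R) p (s : seq 'cV[int]_n) :
  uniq s -> 0 < A -> (forall i, 0 < mu i <= A) ->
  \sum_(c <- s) (A + \sum_i mu i * `|c i ord0|%:~R) ^- (n + p.+1) <=
  3 ^+ n * A ^- p.+1 / \prod_i mu i.
Proof.
elim: n mu A p s => [|n IH] mu A p s us A0 muA.
  rewrite big_ord0 expr0 mul1r invr1 mulr1.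
  case: s us => [|c [|c' s]].
  - by rewrite big_nil invr_ge0 exprn_ge0 ?(ltW A0).
  - by rewrite big_seq1 big_ord0 addr0 add0n.
  - by rewrite (flatmx0 c) (flatmx0 c') /= inE eqxx.
have F0 (c : 'cV[int]_n.+1) :
    0 <= (A + \sum_i mu i * `|c i ord0|%:~R) ^- (n.+1 + p.+1).
  rewrite invr_ge0 exprn_ge0// addr_ge0 ?(ltW A0)// sumr_ge0// => i _.
  by rewrite mulr_ge0//; have /andP[/ltW] := muA i.
have [xs [cs [ux uc le]]] := sum_cons_at ord0 xpredT us F0.
apply: le_trans le _.
have /andP[m0 m1] := muA ord0.
have P0 : 0 < \prod_(i < n) mu (lift ord0 i).
  by apply: prodr_gt0 => i _; have /andP[] := muA (lift ord0 i).
apply: (@le_trans _ _ (\sum_(x <- xs) 3 ^+ n * (A + mu ord0 * `|x|%:~R) ^- p.+2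
                          / \prod_(i < n) mu (lift ord0 i))).
  apply: ler_sum => x _.
  have a0 : A <= A + mu ord0 * `|x|%:~R by rewrite lerDl mulr_ge0 ?(ltW m0).
  apply: le_trans (IH (fun i => mu (lift ord0 i)) _ p.+1 cs uc _ _).
  - rewrite le_eqVlt; apply/orP; left; apply/eqP; apply: eq_bigr => c _.
    have -> : (n.+1 + p.+1 = n + p.+2)%N by lia.
    rewrite big_ord_recl cons_at_eq addrA; congr ((_ + _) ^- _).
    by apply: eq_bigr => i _; rewrite cons_at_lift.
  - exact: lt_le_trans a0.
  - by move=> i; have /andP[-> h] /= := muA (lift ord0 i); exact: le_trans a0.
rewrite -mulr_suml -mulr_sumr big_ord_recl /=.
have := sum_inv_expr_int p ux m0 m1.
set S := \sum_(x <- xs) _ => hS.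
have -> : 3 ^+ n.+1 * A ^- p.+1 / (mu ord0 * \prod_(i < n) mu (lift ord0 i)) =
   3 ^+ n * (3 * A ^- p.+1 / mu ord0) / \prod_(i < n) mu (lift ord0 i).
  by rewrite exprS; field; rewrite !gt_eqF// exprn_gt0.
by rewrite ler_wpM2r ?invr_ge0 ?(ltW P0)// ler_wpM2l// exprn_ge0.
Qed.

(** For [|x| >= 1] one has [1 + |x| <= 2 |x|], so the constant is 4 times the bound 3 for
    [A = mu = 1]. *)
Lemma sum_inv_sqr_nz (s : seq int) : uniq s ->
  \sum_(x <- s | x != 0) `|x|%:~R ^- 2 <= 12 :> R.
Proof.
move=> us; have := sum_inv_sqr_int us (ltr01 : 0 < 1 :> R) (lexx 1).
rewrite mulr1 divr1 => h.
apply: (@le_trans _ _ (\sum_(x <- s) 4 * (1 + 1 * `|x|%:~R) ^- 2)); last first.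
  by rewrite -mulr_sumr; lra.
rewrite big_mkcond; apply: ler_sum => x _; case: ifP => x0; last first.
  by rewrite mulr_ge0// invr_ge0 exprn_ge0// addr_ge0// mulr_ge0.
have y1 : 1 <= `|x|%:~R :> R by rewrite ler1z -gtz0_ge1 normr_gt0.
rewrite mul1r; move: (`|x|%:~R : R) y1 => y y1.
have y0 : 0 < y by lra.
rewrite -[4]invrK -invfM lef_pV2 ?posrE ?mulr_gt0 ?exprn_gt0 ?invr_gt0//; try lra.
by rewrite !expr2; nra.
Qed.

Section two_weights.
Variables (n : nat) (i0 : 'I_n.+1) (L M : R).
Hypotheses (L0 : 0 < L) (LM : L <= M).

Let mu i : R := if i == i0 then L else M.
Let M0 : 0 < M. Proof. exact: lt_le_trans LM. Qed.
Let mu0 i : 0 < mu i <= M.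
Proof. by rewrite /mu; case: ifP => _; rewrite ?L0 ?LM ?M0 /=. Qed.

(** Union bound over the index [j] of a nonzero transverse coordinate. With [c j = x] fixed,
    [A = M |x|] dominates all weights, as [sum_inv_expr_vec] requires; the power [(M |x|)^(-2)] that
    remains is summable over [x != 0]. *)
Lemma sum_transverse (s : seq 'cV[int]_n.+1) : uniq s ->
  \sum_(c <- s | [exists j, (j != i0) && (c j ord0 != 0)])
     (\sum_i mu i * `|c i ord0|%:~R) ^- n.+2 <=
  n.+1%:R * (12 * 3 ^+ n) / (L * M ^+ n.+1).
Proof.
move=> us; pose nu (c : 'cV[int]_n.+1) : R := \sum_i mu i * `|c i ord0|%:~R.
have nu0 c : 0 <= nu c.
  by apply: sumr_ge0 => i _; rewrite mulr_ge0//; have /andP[/ltW] := mu0 i.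
have F0 c : 0 <= nu c ^- n.+2 by rewrite invr_ge0 exprn_ge0.
apply: (@le_trans _ _ (\sum_(c <- s) \sum_(j | j != i0)
    (if c j ord0 != 0 then nu c ^- n.+2 else 0))).
  rewrite big_mkcond; apply: ler_sum => c _; case: ifP => [/existsP[j /andP[ji cj]]|_].
    rewrite (bigD1 j ji) cj lerDl; apply: sumr_ge0 => i _.
    by case: ifP.
  by apply: sumr_ge0 => i _; case: ifP.
rewrite exchange_big /=.
have B0 : 0 <= (12 * 3 ^+ n) / (L * M ^+ n.+1).
  by rewrite divr_ge0 ?mulr_ge0 ?exprn_ge0 ?(ltW L0) ?(ltW M0).
apply: (@le_trans _ _ (\sum_(j | j != i0) ((12 * 3 ^+ n) / (L * M ^+ n.+1)))); last first.
  apply: (@le_trans _ _ (\sum_(j < n.+1) ((12 * 3 ^+ n) / (L * M ^+ n.+1)))).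
    rewrite [leLHS]big_mkcond; apply: ler_sum => j _; case: ifP => _ //.
  by rewrite sumr_const card_ord -[leLHS]mulr_natl mulrA.
apply: ler_sum => j ji; rewrite -big_mkcond /=.
have [xs [cs [ux uc le]]] := sum_cons_at j (fun x => x != 0) us F0.
apply: le_trans le _.
have muj : mu j = M by rewrite /mu (negbTE ji).
pose Pr := \prod_(i < n) mu (lift j i).
have Pr0 : 0 < Pr by apply: prodr_gt0 => i _; have /andP[] := mu0 (lift j i).
have PrE : M * Pr = L * M ^+ n.
  have <- : \prod_i mu i = M * Pr by rewrite (bigD1_ord j)//= muj.
  rewrite (bigD1 i0)//= {1}/mu eqxx; congr (_ * _).
  rewrite (eq_bigr (fun=> M)); last by move=> i ii; rewrite /mu (negbTE ii).
  rewrite prodr_const; congr (_ ^+ _).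
  by rewrite cardC1 card_ord.
apply: (@le_trans _ _ (\sum_(x <- xs | x != 0) 3 ^+ n * (M * `|x|%:~R) ^- 2 / Pr)).
  apply: ler_sum => x x0.
  have y1 : 1 <= `|x|%:~R :> R by rewrite ler1z -gtz0_ge1 normr_gt0.
  have Mx : M <= M * `|x|%:~R by rewrite ler_peMr// (ltW M0).
  apply: le_trans (@sum_inv_expr_vec n (fun i => mu (lift j i)) (M * `|x|%:~R) 1 cs uc _ _).
  - rewrite le_eqVlt; apply/orP; left; apply/eqP; apply: eq_bigr => c _.
    rewrite addn2 /nu (bigD1_ord j)//= muj cons_at_eq; congr ((_ + _) ^- _).
    by apply: eq_bigr => i _; rewrite cons_at_lift.
  - exact: lt_le_trans Mx.
  - by move=> i; have /andP[-> h] /= := mu0 (lift j i); exact: le_trans Mx.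
rewrite -mulr_suml -mulr_sumr.
have -> : \sum_(x <- xs | x != 0) (M * `|x|%:~R) ^- 2 =
          M ^- 2 * \sum_(x <- xs | x != 0) `|x|%:~R ^- 2.
  by rewrite mulr_sumr; apply: eq_bigr => x _; rewrite exprMn invfM.
have h := sum_inv_sqr_nz ux.
have -> : 12 * 3 ^+ n / (L * M ^+ n.+1) = 3 ^+ n * (M ^- 2 * 12) / Pr.
  rewrite exprS mulrCA -PrE; field; rewrite !gt_eqF//.
rewrite ler_wpM2r ?invr_ge0 ?(ltW Pr0)// ler_wpM2l ?exprn_ge0//.
by rewrite ler_wpM2l// invr_ge0 exprn_ge0 ?(ltW M0).
Qed.

Lemma sum_longitudinal (s : seq 'cV[int]_n.+1) p : uniq s ->
  \sum_(c <- s | ~~ [exists j, (j != i0) && (c j ord0 != 0)] && (c != 0))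
     (L * `|c i0 ord0|%:~R) ^- p.+2 <= 12 / L ^+ p.+2.
Proof.
move=> us.
pose P (c : 'cV[int]_n.+1) := ~~ [exists j, (j != i0) && (c j ord0 != 0)] && (c != 0).
change (\sum_(c <- s | P c) (L * `|c i0 ord0|%:~R) ^- p.+2 <= 12 / L ^+ p.+2).
have Pc c : P c -> c = cons_at i0 (c i0 ord0) 0.
  move=> /andP[H _]; apply/colP => i; case: (unliftP i0 i) => [i' ->|->].
    rewrite cons_at_lift mxE; apply/eqP; apply: contraNT H => ci.
    by apply/existsP; exists (lift i0 i'); rewrite ci eq_sym neq_lift.
  by rewrite cons_at_eq.
have Pc0 c : P c -> c i0 ord0 != 0.
  move=> Hc; apply/negP => /eqP ci0; have /andP[_ /eqP] := Hc; apply.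
  rewrite (Pc c Hc) ci0; apply/colP => i; case: (unliftP i0 i) => [i' ->|->].
    by rewrite cons_at_lift !mxE.
  by rewrite cons_at_eq mxE.
rewrite -big_filter.
have uf : uniq [seq (c : 'cV[int]_n.+1) i0 ord0 | c <- [seq c <- s | P c]].
  rewrite map_inj_in_uniq ?filter_uniq// => c c'; rewrite !mem_filter.
  by move=> /andP[Hc _] /andP[Hc' _] E; rewrite (Pc c)// (Pc c')// E.
have := sum_inv_sqr_nz uf; rewrite big_map.
rewrite big_filter_cond big_filter.
have -> : 12 / L ^+ p.+2 = L ^- p.+2 * 12 by rewrite mulrC.
move=> h; apply: (@le_trans _ _ (L ^- p.+2 * \sum_(c <- s | P c && (c i0 ord0 != 0))
   `|c i0 ord0|%:~R ^- 2)); last first.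
  by rewrite ler_wpM2l// invr_ge0 exprn_ge0 ?(ltW L0).
rewrite mulr_sumr big_mkcond [leRHS]big_mkcond; apply: ler_sum => c _.
case: ifP => Hc; last by rewrite andFb.
rewrite Pc0//= exprMn invfM ler_wpM2l ?invr_ge0 ?exprn_ge0 ?(ltW L0)//.
have y1 : 1 <= `|c i0 ord0|%:~R :> R by rewrite ler1z -gtz0_ge1 normr_gt0 Pc0.
rewrite lef_pV2 ?posrE ?exprn_gt0 ?(lt_le_trans ltr01)//.
by apply: ler_weXn2l.
Qed.

End two_weights.
End lattice_sums.

(** * The point set and its dual lattice *)

Section exponential_sums.
Context {R : realType}.

Lemma cos_2pi_lt1 (r : int) (m : nat) : (0 < m)%N -> ~~ (m%:Z %| r)%Z ->
  cos (2 * pi * (r%:~R / m%:R)) < 1 :> R.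
Proof.
move=> m0 mr; have m0' : 0 < m%:R :> R by rewrite ltr0n.
have E : 2 * pi * (r%:~R / m%:R) =
         2 * pi * ((r %% m)%Z%:~R / m%:R) + 2 * pi * (r %/ m)%Z%:~R :> R.
  rewrite {1}(divz_eq r m) intrD intrM -[(Posz m)%:~R]/(m%:R).
  by field; rewrite gt_eqF.
have [c1 s0] := @cos_sin_2pi_int R (r %/ m)%Z.
rewrite E cosD c1 s0 mulr1 mulr0 subr0.
set y := (r %% m)%Z; have y0 : (0 < y)%R.
  rewrite lt_neqAle modz_ge0 ?andbT; last by rewrite eqz_nat -lt0n.
  by rewrite eq_sym; apply: contra mr => /eqP/dvdz_mod0P.
have ym : (y < m%:Z)%R by rewrite ltz_pmod// ltz_nat.
have -> : 2 * pi * (y%:~R / m%:R) = (pi * (y%:~R / m%:R)) *+ 2 :> R.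
  by rewrite -[RHS]mulr_natl; ring.
rewrite cos_mulr2n cos2sin2.
have : 0 < sin (pi * (y%:~R / m%:R)) :> R.
  have pi0 : 0 < pi :> R := pi_gt0 R.
  have y0' : 0 < y%:~R :> R by rewrite ltr0z.
  have ym' : y%:~R < m%:R :> R by rewrite -[m%:R]/((Posz m)%:~R) ltr_int.
  apply: sin_gt0_pi; rewrite mulr_gt0 ?divr_gt0//=.
  by rewrite gtr_pMr// ltr_pdivrMr// mul1r.
by move=> s0'; have := exprn_gt0 2 s0'; rewrite mulr2n; lra.
Qed.

(* The sum [S phi] satisfies [S (phi + th) = S phi = S (phi - th)], whereas
   [S (phi + th) + S (phi - th) = 2 (cos th) (S phi)]. *)
Lemma sum_cos_shift (T : finType) (E : T -> R) (sg : T -> T) (th phi : R) :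
  injective sg ->
  (forall t, exists n : int, E (sg t) = E t + th + 2 * pi * n%:~R) ->
  cos th < 1 -> \sum_t cos (E t + phi) = 0.
Proof.
move=> inj sh th1.
have shift psi : \sum_t cos (E t + psi) = \sum_t cos (E t + (th + psi)).
  rewrite (reindex_inj inj) /=; apply: eq_bigr => t _; have [n ->] := sh t.
  have [c1 s0] := @cos_sin_2pi_int R n.
  have -> : E t + th + 2 * pi * n%:~R + psi = (E t + (th + psi)) + 2 * pi * n%:~R by ring.
  by rewrite cosD c1 s0 mulr1 mulr0 subr0.
have e1 := shift phi; have e2 := shift (phi - th); rewrite subrKC in e2.
have e3 : \sum_t cos (E t + (th + phi)) + \sum_t cos (E t + (phi - th)) =
    2 * cos th * \sum_t cos (E t + phi).
  rewrite mulr_sumr -big_split /=; apply: eq_bigr => t _.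
  have -> : E t + (th + phi) = (E t + phi) + th by ring.
  have -> : E t + (phi - th) = (E t + phi) - th by ring.
  rewrite cosD cosB; ring.
rewrite -e1 e2 in e3.
apply/eqP; have : (2 - 2 * cos th) * \sum_t cos (E t + phi) == 0.
  by apply/eqP; rewrite mulrBl -e3; ring.
by rewrite mulf_eq0 => /orP[/eqP|//]; lra.
Qed.

Lemma sum_cos_int (T : finType) (E : T -> R) (phi : R) :
  (forall t, exists n : int, E t = 2 * pi * n%:~R) ->
  \sum_t cos (E t + phi) = #|T|%:R * cos phi.
Proof.
move=> H; rewrite mulr_natl -sumr_const; apply: eq_bigr => t _.
have [n ->] := H t; have [c1 s0] := @cos_sin_2pi_int R n.
by rewrite addrC cosD c1 s0 mulr1 mulr0 subr0.
Qed.

Section points.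
Variables (n : nat) (i0 : 'I_n.+1) (w : 'cV[int]_n.+1) (q L M : nat).
Hypotheses (wq : w i0 ord0 = q%:Z) (q0 : (0 < q)%N) (L0 : (0 < L)%N) (M0 : (0 < M)%N).
Local Notation zr k := (map_mx intr k : 'cV[R]_n.+1).
Implicit Types (k : 'cV[int]_n.+1).

(** The integer span of [L w] and of the [M e_i] for [i != i0], expressed by congruences: [k i0] is
    [q L a], and [k - a L w] has its other entries divisible by [M]. *)
Definition dual_lattice k : bool :=
  ((q * L)%N%:Z %| k i0 ord0)%Z &&
  [forall i : 'I_n, (M%:Z %| k (lift i0 i) ord0 -
                             (k i0 ord0 %/ q%:Z)%Z * w (lift i0 i) ord0)%Z].

Definition point_index := ('I_(q * L) * {ffun 'I_n -> 'I_M})%type.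

Lemma card_point_index : #|{: point_index}| = (q * L * M ^ n)%N.
Proof. by rewrite card_prod card_ffun !card_ord. Qed.

(** With indices [a] and [b], the shear in entry [i0] is chosen so that the pairing with [L w] is
    the integer [a], while the pairing with [M e_i] is [b i]. *)
Definition lattice_point (t : point_index) : 'cV[R]_n.+1 :=
  \col_i oapp (fun i' => (t.2 i' : nat)%:R / M%:R)
    ((t.1 : nat)%:R / (q * L)%:R -
     \sum_(i' < n) (w (lift i0 i') ord0)%:~R * ((t.2 i' : nat)%:R / M%:R) / q%:R)
    (unlift i0 i).

Let q0' : q%:R != 0 :> R. Proof. by rewrite pnatr_eq0 -lt0n. Qed.
Let L0' : L%:R != 0 :> R. Proof. by rewrite pnatr_eq0 -lt0n. Qed.
Let M0' : M%:R != 0 :> R. Proof. by rewrite pnatr_eq0 -lt0n. Qed.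

Lemma dotv_lattice_point k t : dotv (zr k) (lattice_point t) =
  (k i0 ord0)%:~R / (q * L)%:R * (t.1 : nat)%:R +
  \sum_(i < n) ((k (lift i0 i) ord0)%:~R - (k i0 ord0)%:~R / q%:R * (w (lift i0 i) ord0)%:~R)
      / M%:R * (t.2 i : nat)%:R.
Proof.
rewrite /dotv (bigD1_ord i0)//= !mxE unlift_none /= mulrBr -addrA; congr (_ + _).
  by field; rewrite ?natrM ?mulf_neq0 ?q0' ?L0'.
rewrite mulr_sumr -sumrN -big_split /=; apply: eq_bigr => i _.
rewrite !mxE liftK /=.
by field; rewrite q0' M0'.
Qed.

Let phase k t := 2 * pi * dotv (zr k) (lattice_point t).

(** Off the dual lattice, a cyclic increment of one index rotates the phase by a fixed non-integral
    fraction of a turn, so the sum vanishes. The index [t.1] is tried first, because [rho] describes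
    the phase of the other indices only once [q] divides [k i0]. *)
Lemma sum_cos_lattice_point k phi :
  \sum_t cos (phase k t + phi) =
  (q * L * M ^ n)%:R * (dual_lattice k)%:R * cos phi.
Proof.
have qL0 : (0 < q * L)%N by rewrite muln_gt0 q0.
have [dv|ndv] := boolP ((q * L)%N%:Z %| k i0 ord0)%Z; last first.
  rewrite /dual_lattice (negbTE ndv) mulr0 mul0r.
  pose sg (t : point_index) : point_index := (ordS t.1, t.2).
  apply: (@sum_cos_shift _ _ sg _ _ _ _ (cos_2pi_lt1 qL0 ndv)).
    by move=> [a b] [a' b'] /= E; rewrite -[a]ordSK -[a']ordSK (congr1 fst E : ordS a = ordS a') (congr1 snd E : b = b').
  (* The integer accounts for the wrap of the index from [q L - 1] to 0. *)
  move=> t; exists (if ((t.1 : nat).+1 < q * L)%N then 0 else - k i0 ord0).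
  rewrite /phase !dotv_lattice_point /=.
  set S := \sum_(_ < _) _; have := ltn_ord t.1; move: (t.1 : nat) => a al.
  case: ltnP => h.
    by rewrite modn_small// -[a.+1%:R]natr1; ring.
  have -> : a.+1 = (q * L)%N by lia.
  rewrite modnn rmorphN /=.
  have -> : a%:R = (q * L)%:R - 1 :> R.
    by apply/eqP; rewrite eq_sym subr_eq natr1; apply/eqP; congr (_%:R); lia.
  by field; rewrite ?natrM ?mulf_neq0 ?q0' ?L0'.
have qdv : (q%:Z %| k i0 ord0)%Z.
  by apply: dvdz_trans dv; rewrite PoszM dvdz_mulr.
pose rho i := k (lift i0 i) ord0 - (k i0 ord0 %/ q%:Z)%Z * w (lift i0 i) ord0.
have rhoE i : (k (lift i0 i) ord0)%:~R - (k i0 ord0)%:~R / q%:R * (w (lift i0 i) ord0)%:~R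
    = (rho i)%:~R :> R.
  rewrite /rho intrB intrM; congr (_ - _ * _).
  rewrite -[in LHS](divzK qdv) intrM -[(Posz q)%:~R]/(q%:R).
  by rewrite mulfK.
have -> : dual_lattice k = [forall i, (M%:Z %| rho i)%Z] by rewrite /dual_lattice dv.
have [dM|] := boolP [forall i, (M%:Z %| rho i)%Z]; last first.
  rewrite negb_forall => /existsP[i ndM].
  rewrite mulr0 mul0r.
  pose sg (t : point_index) : point_index :=
    (t.1, [ffun i' => if i' == i then ordS (t.2 i') else t.2 i']).
  apply: (@sum_cos_shift _ _ sg _ _ _ _ (cos_2pi_lt1 M0 ndM)).
    move=> [a b] [a' b'] [-> /ffunP E]; congr pair; apply/ffunP => i'.
    have := E i'; rewrite !ffunE; case: ifP => // _.
    exact: ordS_inj.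
  move=> t; exists (if ((t.2 i : nat).+1 < M)%N then 0 else - rho i).
  rewrite /phase !dotv_lattice_point /= (bigD1 i)//= [in RHS](bigD1 i)//= !rhoE ffunE eqxx /=.
  have -> : \sum_(j < n | j != i) ((k (lift i0 j) ord0)%:~R -
      (k i0 ord0)%:~R / q%:R * (w (lift i0 j) ord0)%:~R) / M%:R *
      ([ffun i' => if i' == i then ordS (t.2 i') else t.2 i'] j : nat)%:R =
      \sum_(j < n | j != i) ((k (lift i0 j) ord0)%:~R -
      (k i0 ord0)%:~R / q%:R * (w (lift i0 j) ord0)%:~R) / M%:R * (t.2 j : nat)%:R :> R.
    by apply: eq_bigr => j /negbTE ji; rewrite ffunE ji.
  set S := \sum_(_ < _ | _) _; have := ltn_ord (t.2 i); move: (t.2 i : nat) => a al.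
  case: ltnP => h.
    by rewrite modn_small// -[a.+1%:R]natr1; field; rewrite ?natrM ?mulf_neq0 ?q0' ?L0' ?M0'.
  have -> : a.+1 = M by lia.
  rewrite modnn rmorphN /=.
  have -> : a%:R = M%:R - 1 :> R.
    by apply/eqP; rewrite eq_sym subr_eq natr1; apply/eqP; congr (_%:R); lia.
  by field; rewrite ?natrM ?mulf_neq0 ?q0' ?L0' ?M0'.
rewrite mulr1 -card_point_index sum_cos_int// => t.
move/forallP: dM => dM.
exists ((k i0 ord0 %/ (q * L)%N%:Z)%Z * (t.1 : nat)%:Z +
        \sum_(i < n) (rho i %/ M%:Z)%Z * (t.2 i : nat)%:Z).
rewrite /phase dotv_lattice_point; congr (_ * _).
rewrite intrD intrM rmorph_sum /=; congr (_ + _).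
  rewrite -[in LHS](divzK dv) intrM -[(Posz (q * L))%:~R]/((q * L)%:R) mulfK//.
  by rewrite natrM mulf_neq0.
apply: eq_bigr => i _; rewrite rhoE intrM.
by rewrite -[in LHS](divzK (dM i)) intrM -[(Posz M)%:~R]/(M%:R) mulfK.
Qed.

Local Notation N := (q * L * M ^ n)%N.

Lemma exists_points : exists z : 'I_N -> 'cV[R]_n.+1,
  [/\ forall j, unit_cube R n.+1 (z j),
    forall k, \sum_(j < N) cosz k (z j) = N%:R * (dual_lattice k)%:R &
    forall k, \sum_(j < N) sinz k (z j) = 0].
Proof.
pose y (j : 'I_N) := lattice_point (enum_val (cast_ord (esym card_point_index) j)).
pose z j := y j + zr (- tile (y j)).
have sumE (h : 'cV[R]_n.+1 -> R) : \sum_(j < N) h (y j) = \sum_t h (lattice_point t).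
  rewrite [RHS](reindex (fun j : 'I_N => enum_val (cast_ord (esym card_point_index) j)))//=.
  exists (fun t => cast_ord card_point_index (enum_rank t)) => t _.
    by rewrite enum_valK cast_ordKV.
  by rewrite cast_ordK enum_rankK.
exists z; split.
- by move=> j; apply/unit_cubeD.
- move=> k; under eq_bigr do rewrite cosz_periodic; rewrite (sumE (cosz k)).
  have := sum_cos_lattice_point k 0; rewrite cos0 mulr1 => <-.
  by apply: eq_bigr => t _; rewrite addr0.
- move=> k; under eq_bigr do rewrite sinz_periodic; rewrite (sumE (sinz k)).
  (* Shifting the phase by a quarter turn turns cosines into sines, and the right-hand side becomes
     0. *)
  have := sum_cos_lattice_point k (- (pi / 2)); rewrite cosN cos_pihalf mulr0 => E.
  rewrite -[RHS]E.
  by apply: eq_bigr => t _; rewrite cosBpihalf.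
Qed.

End points.
End exponential_sums.

(** * Integer directions and coordinates on the dual lattice *)

Section dual_lattice_decay.
Context {R : realType}.

(** Rounding [T v] down entrywise gives an error bounded independently of [T], so for large [T] the
    direction of [w] is as close to [v] as desired. *)
Lemma exists_integer_direction d (v : 'cV[R]_d) (beta : R) :
  unit_sphere R d v -> 0 < beta < 1 ->
  exists (w : 'cV[int]_d) (i0 : 'I_d) (q : nat), [/\ (0 < q)%N, w i0 ord0 = q%:Z &
    beta ^+ 2 * dotv (map_mx intr w) (map_mx intr w : 'cV[R]_d) <
    dotv (map_mx intr w) v ^+ 2].
Proof.
move=> v1 /andP[b0 b1].
have b2 : beta ^+ 2 < 1 by rewrite expr_lt1 ?(ltW b0).
pose b := beta ^+ 2; have b20 : 0 < b by rewrite exprn_gt0.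
have v_le i : `|v i ord0| <= 1.
  rewrite -(@ler_pXn2r _ 2) ?nnegrE// expr1n -v1 real_normK ?num_real//.
  by rewrite /dotv (bigD1 i)//= -expr2 lerDl sumr_ge0// => j _; rewrite -expr2 sqr_ge0.
pose D : R := d%:R.
have D0 : 0 <= D by exact: ler0n.
(* Chosen so that [(1 - b) T >= 4 D], which gives [b (T^2 + 2 T D + D) < (T - D)^2] against the
   worst rounding errors. *)
pose T : R := 4 * D / (1 - b) + D + 1.
have b1' : 0 < 1 - b by rewrite subr_gt0.
have T0 : D + 1 <= T by rewrite /T -addrA lerDr divr_ge0 ?mulr_ge0 ?(ltW b1').
have T1 : 4 * D <= (1 - b) * T.
  have -> : (1 - b) * T = 4 * D + (1 - b) * (D + 1) by rewrite /T; field; rewrite gt_eqF.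
  by rewrite lerDl mulr_ge0 ?(ltW b1')// addr_ge0.
have [w e01] : exists w : 'cV[int]_d, forall i, 0 <= T * v i ord0 - (w i ord0)%:~R <= 1.
  exists (\col_i Num.floor (T * v i ord0)) => i.
  have := floor_itv (T * v i ord0); rewrite intrD mxE => /andP[h1 h2].
  by apply/andP; split; lra.
pose e i : R := T * v i ord0 - (w i ord0)%:~R.
have {}e01 i : 0 <= e i <= 1 by exact: e01.
have ve i : -1 <= v i ord0 * e i <= 1.
  have /andP[e0 e1] := e01 i.
  by rewrite -ler_norml normrM mulr_ile1// ger0_norm.
have wE i : (w i ord0)%:~R = T * v i ord0 - e i by rewrite /e; ring.
have sumD (F : 'I_d -> R) : (forall i, -1 <= F i <= 1) -> -D <= \sum_i F i <= D.
  move=> HF; rewrite -[D]mulr1 /D mulr_natl -[d in _ *+ d]card_ord -sumr_const -sumrN.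
  by apply/andP; split; apply: ler_sum => i _; have /andP[] := HF i.
have hv := sumD _ ve.
have he : -D <= \sum_i e i ^+ 2 <= D.
  by apply: sumD => i; have /andP[e0 e1] := e01 i; apply/andP; split; nra.
have vv : \sum_i v i ord0 * v i ord0 = 1 by exact: v1.
have wv : dotv (map_mx intr w) v = T - \sum_i v i ord0 * e i.
  rewrite -[T in RHS]mulr1 -[X in T * X]vv mulr_sumr -sumrB /dotv; apply: eq_bigr => i _.
  by rewrite mxE /= wE; ring.
have ww : dotv (map_mx intr w) (map_mx intr w : 'cV[R]_d) =
    T ^+ 2 - 2 * T * (\sum_i v i ord0 * e i) + \sum_i e i ^+ 2.
  rewrite -[T ^+ 2]mulr1 -[X in T ^+ 2 * X]vv !mulr_sumr -sumrB -big_split /dotv; apply: eq_bigr => i _.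
  by rewrite !mxE /= wE; ring.
have main : b * dotv (map_mx intr w) (map_mx intr w : 'cV[R]_d) < dotv (map_mx intr w) v ^+ 2.
  rewrite wv ww; move: (\sum_i v i ord0 * e i) hv => x /andP[x1 x2].
  move: (\sum_i e i ^+ 2) he => y /andP[y1 y2].
  apply: (@le_lt_trans _ _ (b * (T ^+ 2 + 2 * T * D + D))).
    by apply: ler_wpM2l; [exact: ltW|nra].
  apply: (@lt_le_trans _ _ ((T - D) ^+ 2)); last by nra.
  have TT : 4 * D * T <= (1 - b) * T * T by apply: ler_wpM2r => //; lra.
  have bDT : b * (D * T) <= D * T by apply: ler_piMl; [nra|lra].
  have bD : b * D <= D by apply: ler_piMl; lra.
  have DT : D <= D * T by nra.
  have [D00|D1] : D = 0 \/ 1 <= D.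
    by rewrite /D; case: (d) => [|m]; [left|right; rewrite ler1n].
    by rewrite D00; nra.
  nra.
have [i0 wi0] : exists i, w i ord0 != 0.
  apply: contrapT => H; move: main.
  rewrite (_ : w = 0) => [|]; last first.
    apply/colP => i; rewrite mxE; apply/eqP; apply: contrapT => /negP wi.
    by apply: H; exists i.
  rewrite /dotv !big1 ?mulr0 ?expr0n ?ltxx// => i _; by rewrite !mxE mul0r.
(* The cone is symmetric, so the sign of [w] can be changed to make the pivot positive. *)
have [wp|wn] := ltrP 0 (w i0 ord0).
  exists w, i0, (absz (w i0 ord0)); split => //; first by rewrite absz_gt0.
  by rewrite gez0_abs// ltW.
exists (- w), i0, (absz (w i0 ord0)); split.
- by rewrite absz_gt0.
- by rewrite mxE lez0_abs.
- have -> : map_mx intr (- w) = - map_mx intr w :> 'cV[R]_d.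
    by apply/colP => i; rewrite !mxE rmorphN.
  by rewrite !dotvNl dotvC dotvNl opprK sqrrN.
Qed.

Section coordinates.
Variables (n : nat) (i0 : 'I_n.+1) (w : 'cV[int]_n.+1) (q L M : nat).
Hypotheses (wq : w i0 ord0 = q%:Z) (q0 : (0 < q)%N) (L0 : (0 < L)%N) (LM : (L <= M)%N).
Local Notation zr k := (map_mx intr k : 'cV[R]_n.+1).
Local Notation dual := (dual_lattice i0 w q L M).
Implicit Types (k : 'cV[int]_n.+1).

(** Coordinates of [k] in the basis formed by [L w], at index [i0], and the [M e_i]. *)
Definition dual_coord k : 'cV[int]_n.+1 :=
  cons_at i0 (k i0 ord0 %/ (q * L)%N%:Z)%Z
    (\col_i ((k (lift i0 i) ord0 - (k i0 ord0 %/ q%:Z)%Z * w (lift i0 i) ord0) %/ M%:Z)%Z).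

Lemma dual_coord_i0 k : dual k ->
  k i0 ord0 = q%:Z * L%:Z * dual_coord k i0 ord0.
Proof. by move=> /andP[dv _]; rewrite cons_at_eq mulrC -PoszM divzK. Qed.

Lemma dual_coord_lift k i : dual k ->
  k (lift i0 i) ord0 = M%:Z * dual_coord k (lift i0 i) ord0 +
                       L%:Z * dual_coord k i0 ord0 * w (lift i0 i) ord0.
Proof.
move=> dk; have ki0 := dual_coord_i0 dk; have /andP[_ /forallP/(_ i) dv] := dk.
rewrite cons_at_lift mxE mulrC divzK//.
have -> : (k i0 ord0 %/ q%:Z)%Z = L%:Z * dual_coord k i0 ord0.
  by rewrite ki0 -mulrA mulKz// eqz_nat -lt0n.
by rewrite subrK.
Qed.

Lemma dual_coord_inj k k' : dual k -> dual k' -> dual_coord k = dual_coord k' -> k = k'.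
Proof.
move=> dk dk' E; apply/colP => i; case: (unliftP i0 i) => [i' ->|->].
  by rewrite (dual_coord_lift _ dk) (dual_coord_lift _ dk') E.
by rewrite (dual_coord_i0 dk) (dual_coord_i0 dk') E.
Qed.

Lemma dual_coord_neq0 k : dual k -> k != 0 -> dual_coord k != 0.
Proof.
move=> dk; apply: contraNneq => E; apply/eqP/colP => i.
case: (unliftP i0 i) => [i' ->|->].
  by rewrite (dual_coord_lift _ dk) E !mxE !mulr0 mul0r addr0.
by rewrite (dual_coord_i0 dk) E !mxE mulr0.
Qed.

Definition weighted_norm (c : 'cV[int]_n.+1) : R :=
  \sum_i (if i == i0 then L%:R else M%:R) * `|c i ord0|%:~R.

Lemma weighted_norm_ge c : c != 0 -> L%:R <= weighted_norm c.
Proof.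
move=> c0; have [i ci] : exists i, c i ord0 != 0.
  apply: contrapT => H; move/eqP: c0; apply; apply/colP => i; rewrite mxE.
  by apply/eqP; apply: contrapT => /negP ci; apply: H; exists i.
have y1 : 1 <= `|c i ord0|%:~R :> R by rewrite ler1z -gtz0_ge1 normr_gt0.
rewrite /weighted_norm (bigD1 i)//=.
apply: (@le_trans _ _ ((if i == i0 then L%:R else M%:R) * `|c i ord0|%:~R)).
  apply: (@le_trans _ _ (if i == i0 then L%:R else M%:R)).
    by case: ifP => _ //; rewrite ler_nat.
  by rewrite ler_peMr//; case: ifP => _; exact: ler0n.
by rewrite lerDl; apply: sumr_ge0 => j _; rewrite mulr_ge0//; case: ifP => _; exact: ler0n.
Qed.

Variable W : R.
Hypothesis wW : forall i, `|w i ord0|%:~R <= W.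

(** Entry [i0] of [k] controls [L |c i0|] because [q >= 1]; subtracting the multiple of [w] from
    another entry then controls [M |c i|] at the cost of a factor [1 + W], independent of [L] and
    [M]. *)
Lemma weighted_norm_le k : dual k ->
  weighted_norm (dual_coord k) <=
  n.+1%:R * (1 + W) * Num.sqrt (dotv (zr k) (zr k)).
Proof.
move=> dk; set r := Num.sqrt _.
have W0 : 0 <= W by apply: le_trans (wW i0); rewrite ler0z.
have kr i : `|k i ord0|%:~R <= r.
  rewrite intr_norm -sqrtr_sqr ler_sqrt; last first.
    by apply: sumr_ge0 => j _; rewrite -expr2 sqr_ge0.
  rewrite /dotv (bigD1 i)//= !mxE -expr2 lerDl; apply: sumr_ge0 => j _.
  by rewrite -expr2 sqr_ge0.
have r0 : 0 <= r by exact: sqrtr_ge0.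
have q1 : 1 <= q%:R :> R by rewrite ler1n.
have Lc : L%:R * `|dual_coord k i0 ord0|%:~R <= r.
  apply: le_trans (kr i0); move: (dual_coord_i0 dk).
  set c := dual_coord k i0 ord0 => ->; rewrite !normrM !intrM -mulrA.
  change (L%:R * `|c|%:~R <= q%:R * (L%:R * `|c|%:~R) :> R).
  by rewrite ler_peMl// mulr_ge0// ler0z.
rewrite -mulrA mulr_natl -[X in _ *+ X](card_ord n.+1) -sumr_const; apply: ler_sum => i _.
case: (unliftP i0 i) => [i' ->|->]; last first.
  by rewrite eqxx (le_trans Lc)// ler_peMl// lerDl.
rewrite eq_sym (negbTE (neq_lift _ _)).
have := dual_coord_lift i' dk; set c := dual_coord k (lift _ _) _.
set c0 := dual_coord k i0 ord0 in Lc *; set wi := w (lift _ _) _ => E.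
have -> : M%:R * `|c|%:~R = `|(k (lift i0 i') ord0)%:~R - L%:R * c0%:~R * wi%:~R| :> R.
  rewrite E intrD !intrM addrK normrM intr_norm.
  by rewrite (ger0_norm (_ : 0 <= (M%:Z)%:~R)) ?ler0z.
rewrite (le_trans (ler_normB _ _))// mulrDl mul1r lerD//.
  by rewrite -intr_norm.
rewrite normrM mulrC ler_pM//.
  by rewrite -intr_norm; exact: wW.
by rewrite normrM ger0_norm ?ler0n// -intr_norm.
Qed.

End coordinates.
End dual_lattice_decay.

(** * Conclusion *)

Section dual_lattice_sum.
Context {R : realType}.
Variables (n : nat) (i0 : 'I_n.+1) (w : 'cV[int]_n.+1) (q L M : nat).
Hypotheses (wq : w i0 ord0 = q%:Z) (q0 : (0 < q)%N) (L0 : (0 < L)%N) (LM : (L <= M)%N).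
Local Notation zr k := (map_mx intr k : 'cV[R]_n.+1).
Local Notation dual := (dual_lattice i0 w q L M).
Local Notation coord := (dual_coord i0 w q L M).
Implicit Types (k c : 'cV[int]_n.+1).
Variables (W kappa beta R0 : R) (v : 'cV[R]_n.+1) (B : 'cV[R]_n.+1 -> \bar R).
Hypotheses (wW : forall i, `|w i ord0|%:~R <= W) (kappa0 : 0 < kappa) (beta0 : 0 < beta)
  (wv : beta ^+ 2 * dotv (zr w) (zr w) < dotv (zr w) v ^+ 2)
  (decay : forall rho, R0 < rho -> forall Theta, unit_sphere R n.+1 Theta ->
    (B (rho *: Theta) <= (if `|dotv Theta v| <= beta then kappa / rho ^+ n.+2
                          else kappa / rho ^+ n.+3)%:E)%E)
  (LR0 : R0 * (n.+1%:R * (1 + W)) < L%:R).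

Let K := n.+1%:R * (1 + W).

Let K0 : 0 < K.
Proof.
rewrite mulr_gt0 ?ltr0n// ltr_wpDr//.
by apply: le_trans (wW i0); rewrite ler0z.
Qed.

Let nu c : R := weighted_norm i0 L M c.
Let transverse c := [exists j, (j != i0) && (c j ord0 != 0)].
Let bound c : R := if transverse c then kappa * K ^+ n.+2 * nu c ^- n.+2
  else kappa * (L%:R * `|c i0 ord0|%:~R) ^- n.+3.

Let decay_le k : dual k -> k != 0 -> (B (zr k) <= (bound (coord k))%:E)%E.
Proof.
move=> dk k0; set r := Num.sqrt (dotv (zr k) (zr k)).
have c0 := dual_coord_neq0 q0 dk k0.
have nuL : L%:R <= nu (coord k) by exact: (@weighted_norm_ge R n i0 L M LM _ c0).
have nuK : nu (coord k) <= K * r by exact: (@weighted_norm_le R n i0 w q L M q0 W wW k dk).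
have L0' : 0 < L%:R :> R by rewrite ltr0n.
have nu0 : 0 < nu (coord k) by exact: lt_le_trans nuL.
have r0 : 0 < r by rewrite -(pmulr_rgt0 _ K0); exact: lt_le_trans nuK.
(* The weighted norm is at least [L] on nonzero vectors and at most [K r], so [LR0] takes [r] beyond
   the decay threshold. *)
have R0r : R0 < r.
  by rewrite -(ltr_pM2r K0) (lt_le_trans LR0)// (le_trans nuL)// mulrC.
have rr : r ^+ 2 = dotv (zr k) (zr k).
  by rewrite sqr_sqrtr//; apply: sumr_ge0 => j _; rewrite -expr2 sqr_ge0.
have dotZl (a : R) (x y : 'cV[R]_n.+1) : dotv (a *: x) y = a * dotv x y.
  by rewrite /dotv mulr_sumr; apply: eq_bigr => i _; rewrite mxE mulrA.
have r1 : 1 <= r.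
  rewrite -(@ler_pXn2r _ 2) ?nnegrE ?(ltW r0)// expr1n rr.
  have [i ki] : exists i, k i ord0 != 0.
    apply: contrapT => H; move/eqP: k0; apply; apply/colP => i; rewrite mxE.
    by apply/eqP; apply: contrapT => /negP ki; apply: H; exists i.
  rewrite /dotv (bigD1 i)//= !mxE -intrM.
  rewrite (@le_trans _ _ (k i ord0 * k i ord0)%:~R)//.
    by rewrite ler1z -gtz0_ge1 -expr2 exprn_even_gt0.
  by rewrite lerDl; apply: sumr_ge0 => j _; rewrite -expr2 sqr_ge0.
pose Theta : 'cV[R]_n.+1 := r^-1 *: zr k.
have Tk : r *: Theta = zr k by rewrite scalerA divff ?scale1r// gt_eqF.
have ST : unit_sphere R n.+1 Theta.
  rewrite /unit_sphere /= dotZl dotvC dotZl -rr expr2.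
  by field; rewrite gt_eqF.
have := decay R0r ST; rewrite Tk => /le_trans; apply; rewrite lee_fin.
rewrite /bound; have [tr|tr] := boolP (transverse (coord k)).
  have h1 : kappa / r ^+ n.+2 <= kappa * K ^+ n.+2 * nu (coord k) ^- n.+2.
    rewrite -mulrA ler_pM2l// -[K ^+ _]invrK -invfM lef_pV2 ?posrE; last 2 first.
    - by rewrite exprn_gt0.
    - by rewrite mulr_gt0 ?invr_gt0 ?exprn_gt0.
    rewrite mulrC ler_pdivrMr ?exprn_gt0// -exprMn mulrC.
    by apply: lerXn2r; rewrite ?nnegrE ?(ltW nu0)// mulr_ge0 ?(ltW r0) ?(ltW K0).
  (* Since [r >= 1], the stronger decay implies the weaker one, which is all that transverse
     frequencies need. *)
  case: ifP => _ //; apply: (le_trans _ h1); rewrite ler_pM2l// lef_pV2 ?posrE ?exprn_gt0//.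
  by apply: ler_weXn2l.
(* Without transverse coordinates [k] is a multiple of [w], whose direction lies in the fast-decay
   cone by [wv]. *)
have kE : zr k = (L%:R * (coord k i0 ord0)%:~R) *: zr w.
  have Hl i : k (lift i0 i) ord0 = L%:Z * coord k i0 ord0 * w (lift i0 i) ord0.
    rewrite (dual_coord_lift q0 _ dk).
    have -> : coord k (lift i0 i) ord0 = 0.
      apply/eqP; apply: contraNT tr => ci; apply/existsP; exists (lift i0 i).
      by rewrite ci eq_sym neq_lift.
    by rewrite mulr0 add0r.
  move: (coord k i0 ord0) Hl (dual_coord_i0 dk) => c Hl Hi.
  apply/colP => i; rewrite !mxE; case: (unliftP i0 i) => [i' ->|->].
    by rewrite Hl !intrM.
  by rewrite Hi wq !intrM -[(Posz L)%:~R]/(L%:R : R); ring.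
set a := L%:R * _ in kE.
have a0 : a != 0.
  by apply: contraNneq k0 => a0; move: r0; rewrite /r kE a0 scale0r /dotv big1 ?sqrtr0 ?ltxx// => i _; rewrite mxE mul0r.
have ww1 : 1 <= dotv (zr w) (zr w).
  rewrite /dotv (bigD1 i0)//= !mxE wq -intrM.
  rewrite (@le_trans _ _ (q%:Z * q%:Z)%:~R)//.
    by rewrite ler1z -gtz0_ge1 mulr_gt0.
  by rewrite lerDl; apply: sumr_ge0 => j _; rewrite -expr2 sqr_ge0.
have rE : r ^+ 2 = a ^+ 2 * dotv (zr w) (zr w).
  by rewrite rr kE dotZl dotvC dotZl expr2 mulrA.
have -> : (`|dotv Theta v| <= beta) = false.
  apply/negbTE; rewrite -ltNge -(@ltr_pXn2r _ 2) ?nnegrE ?(ltW beta0)//.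
  rewrite real_normK ?num_real//.
  have ww0 : 0 < dotv (zr w) (zr w) by exact: lt_le_trans ww1.
  have -> : dotv Theta v ^+ 2 = dotv (zr w) v ^+ 2 / dotv (zr w) (zr w).
    by rewrite dotZl exprMn exprVn rE kE dotZl; field; rewrite a0 gt_eqF.
  by rewrite ltr_pdivlMr.
rewrite ler_pM2l// lef_pV2 ?posrE ?exprn_gt0//; last first.
  by rewrite mulr_gt0// ltr0z normr_gt0; apply: contra a0 => /eqP c00; rewrite /a c00 mulr0.
apply: lerXn2r; rewrite ?nnegrE ?(ltW r0) ?mulr_ge0 ?ler0z ?ler0n//.
rewrite -(@ler_pXn2r _ 2) ?nnegrE ?(ltW r0) ?mulr_ge0 ?ler0z ?ler0n// rE.
have -> : (L%:R * `|coord k i0 ord0|%:~R) ^+ 2 = a ^+ 2 :> R.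
  by rewrite /a !exprMn intr_norm real_normK ?num_real.
by rewrite ler_peMr// sqr_ge0.
Qed.

Lemma sum_decay_le m :
  (\sum_(k <- zbox n.+1 m | dual k && (k != 0%R)) B (zr k) <=
   (kappa * K ^+ n.+2 * (n.+1%:R * (12 * 3 ^+ n) / (L%:R * M%:R ^+ n.+1)) +
    kappa * (12 / L%:R ^+ n.+3))%:E)%E.
Proof.
have L0' : 0 < L%:R :> R by rewrite ltr0n.
have LM' : L%:R <= M%:R :> R by rewrite ler_nat.
apply: (@le_trans _ _ (\sum_(k <- zbox n.+1 m | dual k && (k != 0%R)) (bound (coord k))%:E)%E).
  by apply: lee_sum => k /andP[dk k0]; exact: decay_le.
rewrite sumEFin lee_fin.
pose s := [seq coord k | k <- [seq k <- zbox n.+1 m | dual k && (k != 0)]].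
have us : uniq s.
  rewrite map_inj_in_uniq ?filter_uniq ?zbox_uniq// => k k'; rewrite !mem_filter.
  move=> /andP[/andP[dk _] _] /andP[/andP[dk' _] _].
  exact: (dual_coord_inj q0 dk dk').
have -> : \sum_(k <- zbox n.+1 m | dual k && (k != 0)) bound (coord k) = \sum_(c <- s) bound c.
  by rewrite /s [RHS]big_map big_filter.
have s0 c : c \in s -> c != 0.
  move=> /mapP[k]; rewrite mem_filter => /andP[/andP[dk k0] _] ->.
  exact: (dual_coord_neq0 q0 dk k0).
rewrite (bigID transverse) /=; apply: lerD.
  apply: le_trans (ler_wpM2l _ (sum_transverse i0 L0' LM' us)).
    rewrite mulr_sumr le_eqVlt; apply/orP; left; apply/eqP; apply: eq_bigr => c tr.
    by rewrite /bound tr.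
  by rewrite mulr_ge0 ?exprn_ge0 ?(ltW kappa0) ?(ltW K0).
apply: le_trans (ler_wpM2l (ltW kappa0) (sum_longitudinal i0 L0' n.+1 us)).
rewrite mulr_sumr big_seq_cond [leRHS]big_seq_cond le_eqVlt; apply/orP; left; apply/eqP.
apply: eq_big => [c|c /andP[_ /negbTE tr]]; last by rewrite /bound tr.
by case: (boolP (c \in s)) => //= /s0 ->; rewrite andbT.
Qed.

End dual_lattice_sum.

Theorem theorem1p5 (R : realType) (d : nat) (hd : (2 <= d)%N)
  (haar : probability 'M[R]_d R) (haarP : is_haar haar)
  (Omega : set 'cV[R]_d)
  (Omega_sub : Omega `<=` unit_cube R d)
  (Omega_meas : lebesgue_measurable Omega)
  (kappa2 beta2 : R) (kappa2_gt0 : 0 < kappa2) (beta2_itv : 0 < beta2 < 1)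
  (U : set 'M[R]_d) (U_sub : U `<=` SO R d) (U_meas : measurable U)
  (U_nbhs : \forall s \near (1%:M : 'M[R]_d), SO R d s -> U s)
  (v : 'cV[R]_d) (v_sphere : unit_sphere R d v)
  (decay : \forall rho \near +oo,
    forall Theta : 'cV[R]_d, unit_sphere R d Theta ->
    (\int[haar]_(s in U)
        (Normc.normc (fourier_indic (rotate s Omega) (rho *: Theta)) ^+ 2)%:E
     <= (if `|dotv Theta v| <= beta2 then kappa2 / rho ^+ (d + 1)
         else kappa2 / rho ^+ (d + 2))%:E)%E) :
  exists2 c : R, 0 < c &
  exists2 N : nat -> nat, N j @[j --> \oo] --> \oo &
  forall j : nat, exists2 z : 'I_(N j) -> 'cV[R]_d,
    (forall i, unit_cube R d (z i)) &
    (\int[haar]_(s in U) \int[leb]_(x in unit_cube R d)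
        ((discrepancy Omega z x s) ^+ 2)%:E
     <= (c * (N j)%:R `^
           (1 - (d%:R + 1) / (d%:R ^+ 2 + d%:R - 1)))%:E)%E.
Proof.
case: d hd haar haarP Omega Omega_sub Omega_meas U U_sub U_meas U_nbhs v v_sphere decay => [//|n] hn
  haar _ Omega Omega_sub Omega_meas U U_sub U_meas _ v v_sphere [R0 [_ decay]].
have [beta0 beta1] := andP beta2_itv.
have [w [i0 [q [q0 wq wv]]]] := exists_integer_direction v_sphere beta2_itv.
have [W wW] : exists W : R, forall i, `|w i ord0|%:~R <= W.
  have [m Hm] := cV_bounded (map_mx intr w : 'cV[R]_n.+1).
  by exists m%:R => i; have := Hm i; rewrite mxE -intr_norm.
have [B0 [Z [mB0 mZ Z0 OB0]]] : exists B Z : set 'cV[R]_n.+1, [/\ measurable B,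
    measurable Z, borel_lebesgue n.+1 Z = 0%E & forall x, ~ Z x -> (Omega x <-> B x)].
  apply: lebesgue_measurable_borel => //.
  apply: (@le_lt_trans _ _ (leb (unit_cube R n.+1))); first exact: le_mu_ext.
  rewrite leb_borel; last exact: measurable_unit_cube.
  by rewrite borel_lebesgue_unit_cube ltry.
(* A Borel version may leave the cube on a null set; intersecting restores the uniform bound on its
   rotations. *)
pose B := B0 `&` unit_cube R n.+1.
have mB : measurable B by apply: measurableI => //; exact: measurable_unit_cube.
have OB x : ~ Z x -> (Omega x <-> B x).
  move=> nZ; split; last by case=> /(OB0 x nZ).
  by move=> Ox; split; [exact/(OB0 x nZ)|exact: Omega_sub].
pose K : R := n.+1%:R * (1 + W).
pose C1 : R := kappa2 * K ^+ n.+2 * (n.+1%:R * (12 * 3 ^+ n)) + kappa2 * 12.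
have W0 : 0 <= W by apply: le_trans (wW i0); rewrite ler0z.
have C10 : 0 < C1.
  apply: (@lt_le_trans _ _ (kappa2 * 12)); first by rewrite mulr_gt0.
  rewrite lerDr; apply: mulr_ge0; last by rewrite !mulr_ge0 ?exprn_ge0.
  by apply: mulr_ge0; [exact: ltW|rewrite exprn_ge0// mulr_ge0// addr_ge0].
(* Starting at [t0] gives [L j >= t j > R0 K], so the decay applies to all nonzero dual frequencies
   for every [j]. *)
pose t0 := (Num.truncn `|R0 * K|).+1.
pose t j := (t0 + j)%N.
pose L j := (t j ^ n.+1)%N; pose M j := (t j ^ n.+2)%N.
have tp j : (0 < t j)%N by [].
exists (q%:R ^+ 2 * C1); first by rewrite mulr_gt0// exprn_gt0// ltr0n.
exists (fun j => q * L j * M j ^ n)%N.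
  apply/cvgnyPge => A; exists A => // j /= Aj.
  rewrite (leq_trans Aj)// (@leq_trans (t j))//; first by rewrite /t leq_addl.
  rewrite -mulnA (leq_trans _ (leq_pmull _ q0))//.
  rewrite (@leq_trans (L j))//; first by rewrite /L expnS leq_pmulr// expn_gt0.
  by rewrite leq_pmulr// expn_gt0 expn_gt0.
move=> j.
have L0 : (0 < L j)%N by rewrite expn_gt0 tp.
have LM : (L j <= M j)%N by rewrite leq_pexp2l.
have M0 : (0 < M j)%N by exact: leq_trans LM.
have [z [zQ zc zs]] := @exists_points R n i0 w q (L j) (M j) wq q0 L0 M0.
exists z => //.
pose BB (xi : 'cV[R]_n.+1) : \bar R := (\int[haar]_(s in U)
        (Normc.normc (fourier_indic (rotate s Omega) xi) ^+ 2)%:E)%E.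
have decay' rho : R0 < rho -> forall Theta, unit_sphere R n.+1 Theta ->
    (BB (rho *: Theta) <= (if `|dotv Theta v| <= beta2 then kappa2 / rho ^+ n.+2
                          else kappa2 / rho ^+ n.+3)%:E)%E.
  by move=> /decay H Theta /H; rewrite addn1 addn2.
have LR0 : R0 * K < (L j)%:R.
  apply: (le_lt_trans (ler_norm _)); apply: lt_le_trans (truncnS_gt _) _.
  rewrite ler_nat (@leq_trans (t j))//; first by rewrite /t leq_addr.
  by rewrite /L expnS leq_pmulr// expn_gt0.
have sumle := sum_decay_le wq q0 L0 LM wW kappa2_gt0 beta0 wv decay' LR0.
have := integrated_discrepancy_le Omega_sub (@subIsetr _ B0 _) mB mZ Z0 OB zc zs U_meas U_sub sumle.
move/le_trans; apply; rewrite lee_fin -/K.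
pose T : R := (t j)%:R.
have T0 : 0 < T by rewrite ltr0n.
(* [E] is the exponent of [T] in [N], [P = d(d+2)] that of the decay, and [G = 2E - P] that of the
   final bound. The truncated subtraction is exact because [d >= 2] gives [n >= 1]. *)
pose E := (n.+1 + n.+2 * n)%N; pose P := (n.+1 * n.+3)%N.
pose G := (n * n + 2 * n - 1)%N.
have EG : (2 * E = G + P)%N by rewrite /E /G /P; nia.
have -> : kappa2 * K ^+ n.+2 * (n.+1%:R * (12 * 3 ^+ n) / ((L j)%:R * (M j)%:R ^+ n.+1)) +
    kappa2 * (12 / (L j)%:R ^+ n.+3) = C1 / T ^+ P.
  have -> : (L j)%:R * (M j)%:R ^+ n.+1 = T ^+ P :> R.
    rewrite /L /M !natrX -/T -exprM -exprD; congr (_ ^+ _); rewrite /P; lia.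
  have -> : (L j)%:R ^+ n.+3 = T ^+ P :> R by rewrite /L !natrX -/T -exprM.
  by rewrite /C1; move: (T ^- P) (K ^+ n.+2) => a b; ring.
have NE : (q * L j * M j ^ n)%:R = q%:R * T ^+ E :> R.
  by rewrite !natrM !natrX -/T -mulrA -!exprM -exprD.
have -> : (q * L j * M j ^ n)%:R ^+ 2 * (C1 / T ^+ P) = q%:R ^+ 2 * C1 * T ^+ G :> R.
  rewrite NE exprMn -exprM mulnC EG exprD.
  by field; rewrite expf_neq0// gt_eqF.
rewrite ler_pM2l; last by rewrite mulr_gt0// exprn_gt0// ltr0n.
have E0 : 0 < E%:R :> R by rewrite ltr0n.
have EE : E%:R = n.+1%:R ^+ 2 + n.+1%:R - 1 :> R.
  by rewrite /E !natrD natrM -!natr1; ring.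
have -> : 1 - (n.+1%:R + 1) / (n.+1%:R ^+ 2 + n.+1%:R - 1) = G%:R / E%:R :> R.
  rewrite -EE; have -> : G%:R = E%:R - (n.+1%:R + 1) :> R.
    have -> : (E = G + n.+2)%N by rewrite /E /G; nia.
    by rewrite natrD -natr1; ring.
  by field; rewrite gt_eqF.
(* As [q >= 1], [T^E] is at most [N], and the nonnegative power [G/E] is monotone. *)
have -> : T ^+ G = (T ^+ E) `^ (G%:R / E%:R).
  rewrite -!powR_mulrn ?(ltW T0)// -powRrM mulrC divfK// gt_eqF//.
apply: ge0_ler_powR; rewrite ?nnegrE ?divr_ge0 ?exprn_ge0 ?(ltW T0)//.
by rewrite NE ler_peMl ?exprn_ge0 ?(ltW T0)// ler1n.
Qed.
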